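(* Let $\Omega\subset\mathbb{R}^N$ be a bounded domain with Lipschitz boundary, let $T>0$, $M>0$, and let $P,h,H,F,G$ be as in the context. Assume that (A-1) there is $C_1>0$ with $F(s)\le C_1G'(s)G(s)$ for all $s\in(0,M]$, and (A-2) there are $C_2>0$ and $\lambda\in(0,2)$ with $\left(\sqrt{sF(s)}\right)^{\lambda}\le C_2H(s)$ for all $s\in[0,M]$. Let $u$, with $0\le u\le M$, be a nonnegative solution (in the sense of the context) of $$[H(u)]_t-F(u)\Delta u\le 0\ \text{ in }\Omega\times(0,T],\qquad u(x,t)=0\ \text{ on }\partial\Omega\times(0,T],$$ with initial datum $u(\cdot,0)\ge 0$ continuous on $\Omega$, and let $\Omega'\subset\Omega$ be such that $u(x,0)=0$ for $x\in\Omega'$. Then for every ball $B_R(x_0)\Subset\Omega'$ and every $R'\in(0,R)$ there exists $T'\in(0,T]$ such that $u(x,t)=0$ for $(x,t)\in B_{R'}(x_0)\times[0,T']$.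
   Context: Functions: $P\in C[0,\infty)$ with $P(0)=0$ and $0<P(s)<c_3<\infty$ for $s>0$. $h\in C(0,\infty)$, $h>0$, is integrable at $0$, and $H(u)=\int_0^u h(s)\,ds$. $F=hP$ is such that $F(0)=0$ and $F$ is differentiable on $(0,\infty)$ with locally bounded derivative $F'>0$. $G(s)=\int_0^s\sqrt{F'(r)}\,dr$, so $G(0)=0$ and $G'=\sqrt{F'}$. Solution: $u$ is a nonnegative measurable function on $\Omega\times[0,T]$ with $u\in L^\infty_{loc}(\Omega\times[0,T])$, $\nabla u\in L^2_{loc}(\Omega\times(0,T])$, $u_t\in L^1_{loc}(\Omega\times(0,T])$, and $u(\cdot,t)\to u(\cdot,0)$ as $t\to0$ in local measure. The term $F(u)\Delta u$ is understood weakly: for every $\theta\in Lip_c(\Omega)$ (Lipschitz functions with compact support in $\Omega$), $$-\int_\Omega\theta F(u)\Delta u\,dx=\int_\Omega\left[F(u)\nabla u\cdot\nabla\theta+|\nabla G(u)|^2\theta\right]dx .$$ The differential inequality means that, for every nonnegative $\theta\in Lip_c(\Omega)$ and all $0<s<t\le T$, $$\int_\Omega\theta H(u(x,t))\,dx-\int_\Omega\theta H(u(x,s))\,dx+\int_s^t\int_\Omega\left[F(u)\nabla u\cdot\nabla\theta+|\nabla G(u)|^2\theta\right]dx\,d\tau\le 0 .$$ Equalities between such functions are understood almost everywhere. $B_R(x_0)$ is the open ball of radius $R$ centred at $x_0$, and $A\Subset B$ means that the closure of $A$ is compact and contained in $B$. *)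

(* Defs.v *)
From HB Require Import structures.
From mathcomp Require Import all_boot all_order all_algebra.
From mathcomp Require Import all_classical all_reals all_analysis.
Set Implicit Arguments.
Unset Strict Implicit.
Unset Printing Implicit Defensive.
Import Order.TTheory GRing.Theory Num.Theory.
Import numFieldNormedType.Exports.
Local Open Scope classical_set_scope.
Local Open Scope ring_scope.

(* Row vectors carry the product sigma-algebra, that is, the Borel sets. *)
Definition measure_row_display : measure_display -> measure_display.
Proof. exact. Qed.

Section measurable_row.
Context {d} {T : sigmaRingType d}.
Variable n : nat.

Let coors : 'I_n -> 'rV[T]_n -> T := fun i x => x ord0 i.

Let row_set0 : g_sigma_preimage coors set0.
Proof. exact: sigma_algebra0. Qed.

Let row_setC A : g_sigma_preimage coors A -> g_sigma_preimage coors (~` A).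
Proof. exact: sigma_algebraC. Qed.

Let row_bigcup (F : _^nat) : (forall i, g_sigma_preimage coors (F i)) ->
  g_sigma_preimage coors (\bigcup_i (F i)).
Proof. exact: sigma_algebra_bigcup. Qed.

HB.instance Definition _ := @isMeasurable.Build (measure_row_display d)
  'rV[T]_n (g_sigma_preimage coors) row_set0 row_setC row_bigcup.

End measurable_row.

Lemma measurable_coord d (T : sigmaRingType d) n (i : 'I_n) :
  measurable_fun [set: 'rV[T]_n] (fun x : 'rV[T]_n => x ord0 i).
Proof.
move=> _ Y mY; rewrite setTI; apply: sub_sigma_algebra => /=.
rewrite -bigcup_seq/=; exists i => /=; first by rewrite mem_index_enum.
by exists Y => //; rewrite setTI.
Qed.


Lemma measurable_rowP d1 d2 (T1 : measurableType d1) (T2 : sigmaRingType d2)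
    n (f : T1 -> 'rV[T2]_n) :
  (forall i, measurable_fun [set: T1] (fun x => f x ord0 i)) ->
  measurable_fun [set: T1] f.
Proof.
move=> mf _ A mA; rewrite setTI.
suff : measurable `<=` [set B : set 'rV[T2]_n | measurable (f @^-1` B)] by apply.
rewrite /measurable/=; apply: smallest_sub.
  split=> /=.
  - by rewrite preimage_set0; exact: measurable0.
  - by move=> B mB; rewrite /= setTD preimage_setC; exact: measurableC.
  - by move=> B mB; rewrite preimage_bigcup; exact: bigcupT_measurable.
rewrite -bigcup_seq; apply: bigcup_sub => i _ _ [C mC <-] /=.
by rewrite setTI; have := mf i measurableT C mC; rewrite setTI.
Qed.

Section lebesgue_row.
Context {R : realType}.
Local Notation Rm := (measurableTypeR R).

Definition row_cons n (z : Rm * 'rV[R]_n) : 'rV[R]_n.+1 :=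
  \row_i oapp (z.2 ord0) z.1 (unlift ord0 i).

Definition row_uncons n (x : 'rV[R]_n.+1) : Rm * 'rV[R]_n :=
  (x ord0 ord0, \row_j x ord0 (lift ord0 j)).

Lemma row_consK n : cancel (@row_cons n) (@row_uncons n).
Proof.
case=> a y; rewrite /row_uncons /row_cons mxE unlift_none /=; congr pair.
by apply/rowP => j; rewrite !mxE liftK.
Qed.

Lemma measurable_row_cons n : measurable_fun setT (@row_cons n).
Proof.
apply: measurable_rowP => i.
have [j ->|->] := unliftP ord0 i.
- rewrite (_ : (fun _ => _) = (fun x : 'rV[R]_n => x ord0 j) \o snd); last first.
    by apply/funext => z; rewrite /row_cons mxE liftK.
  by apply: measurableT_comp => //; exact: measurable_coord.
- rewrite (_ : (fun _ => _) = fst); last first.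
    by apply/funext => z; rewrite /row_cons mxE unlift_none.
  exact: measurable_fst.
Qed.

Lemma measurable_row_uncons n : measurable_fun setT (@row_uncons n).
Proof.
apply/measurable_fun_pairP; split; first exact: measurable_coord.
apply: measurable_rowP => j.
rewrite (_ : (fun _ => _) = fun x : 'rV[R]_n.+1 => x ord0 (lift ord0 j)).
  exact: measurable_coord.
by apply/funext => x; rewrite /= mxE.
Qed.

Section step.
Variables (n : nat) (mu : {sigma_finite_measure set 'rV[R]_n -> \bar R}).
Local Open Scope ereal_scope.

Definition lebesgue_row_step : set 'rV[R]_n.+1 -> \bar R :=
  pushforward (lebesgue_measure \x mu) (@row_cons n).

Let step0 : lebesgue_row_step set0 = 0.
Proof. by rewrite /lebesgue_row_step /pushforward preimage_set0 measure0. Qed.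

Let step_ge0 A : 0 <= lebesgue_row_step A.
Proof. by rewrite /lebesgue_row_step /pushforward; apply: measure_ge0. Qed.

Let step_sigma_additive : semi_sigma_additive lebesgue_row_step.
Proof.
move=> F mF tF mUF; rewrite /lebesgue_row_step /pushforward preimage_bigcup.
have mpre A : measurable A -> measurable (@row_cons n @^-1` A).
  by move=> mA; rewrite -[X in measurable X]setTI; exact: measurable_row_cons.
apply: measure_semi_sigma_additive.
- by move=> k; exact: mpre.
- apply/trivIsetP => /= i j _ _ ij; rewrite -preimage_setI.
  by move/trivIsetP : tF => /(_ _ _ _ _ ij) ->//; rewrite preimage_set0.
- by rewrite -preimage_bigcup; exact: mpre.
Qed.

HB.instance Definition _ := isMeasure.Build _ _ _
  lebesgue_row_step step0 step_ge0 step_sigma_additive.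

Let step_sigma_finite : sigma_finite setT lebesgue_row_step.
Proof.
have /sigma_finiteP[F [TF ndF Foo]] := sigma_finiteT (@lebesgue_measure R).
have /sigma_finiteP[G [TG ndG Goo]] := sigma_finiteT mu.
exists (fun k => @row_uncons n @^-1` (F k `*` G k)).
  rewrite -preimage_bigcup -(preimage_setT (@row_uncons n)); congr preimage.
  rewrite -setXTT TF TG predeqE => -[x y]; split.
    move=> [/= [i _ Fix] [j _ Gjy]]; exists (maxn i j) => //; split.
    - by move: x Fix; exact/subsetPset/ndF/leq_maxl.
    - by move: y Gjy; exact/subsetPset/ndG/leq_maxr.
  by move=> [i _ []/= ? ?]; split; exists i.
move=> k; have [mF Fk] := Foo k; have [mG Gk] := Goo k; split.
  rewrite -[X in measurable X]setTI; apply: measurable_row_uncons => //.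
  exact: measurableX.
rewrite /lebesgue_row_step /pushforward -comp_preimage.
rewrite (_ : _ \o _ = id) ?preimage_id; last first.
  by apply/funext => z; exact: row_consK.
by rewrite product_measure1E// lte_mul_pinfty// ge0_fin_numE.
Qed.

HB.instance Definition _ := Measure_isSigmaFinite.Build _ _ _
  lebesgue_row_step step_sigma_finite.

End step.

(* N-dimensional Lebesgue measure on Borel sets, as the iterated product of the
   measure on the line under R^(k+1) = R * R^k. *)
Fixpoint lebesgue_row n : {sigma_finite_measure set 'rV[R]_n -> \bar R} :=
  match n with
  | 0 => \d_(0 : 'rV[R]_0)
  | k.+1 => lebesgue_row_step (lebesgue_row k)
  end.

End lebesgue_row.

Section euclidean.
Context {R : realType}.
Implicit Types n : nat.

(* The library norm on 'rV[R]_n is the sup norm: it gives the usual topology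
   and the usual Lipschitz functions, but not the Euclidean balls. *)
Definition dotv n (v w : 'rV[R]_n) : R := \sum_i v ord0 i * w ord0 i.
Definition enorm n (v : 'rV[R]_n) : R := Num.sqrt (dotv v v).
Definition eball n (x0 : 'rV[R]_n) (r : R) : set 'rV[R]_n :=
  [set x | enorm (x - x0) < r].

Definition grad n (f : 'rV[R]_n -> R) (x : 'rV[R]_n) : 'rV[R]_n :=
  \row_i 'D_(delta_mx ord0 i) f x.

Definition compactly_inside (V : topologicalType) (A B : set V) : Prop :=
  compact (closure A) /\ closure A `<=` B.

Definition topboundary (V : topologicalType) (A : set V) : set V :=
  closure A `\` interior A.

Definition domain n (Omega : set 'rV[R]_n) : Prop :=
  [/\ Omega !=set0, open Omega & connected Omega].

(* Near each boundary point, in some rotated orthonormal frame, Omega is the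
   strict epigraph of a Lipschitz function of the coordinates other than the
   k-th one; col' k drops that coordinate. *)
Definition lipschitz_boundary n (Omega : set 'rV[R]_n) : Prop :=
  forall p, topboundary Omega p ->
  exists (Q : 'M[R]_n) (k : 'I_n) (r : R) (g : 'rV[R]_n.-1 -> R),
    [/\ Q *m Q^T = 1%:M, 0 < r, lipschitz g &
      forall x, enorm (x - p) < r ->
        (Omega x <-> g (col' k (x *m Q)) < (x *m Q) ord0 k)].

(* Lip_c(Omega); its elements are extended by zero outside Omega *)
Definition Lip_c n (Omega : set 'rV[R]_n) (theta : 'rV[R]_n -> R) : Prop :=
  lipschitz theta /\ compactly_inside [set x | theta x != 0] Omega.

End euclidean.

Section lebesgue_spaces.
Context d (V : measurableType d) {R : realType}.
Variable mu : set V -> \bar R.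

(* Measurability for the completion of mu; sets of V itself are Borel sets. *)
Definition ae_measurable (D : set V) (f : V -> R) : Prop :=
  exists2 g : V -> R, measurable_fun setT g &
    {ae mu, forall z, D z -> f z = g z}.

End lebesgue_spaces.

Section space_time.
Context {R : realType} (N : nat).
Implicit Types (D K : set ('rV[R]_N * R)) (f g u : 'rV[R]_N * R -> R).

Definition lebesgue_spacetime :
    {measure set ('rV[R]_N * measurableTypeR R) -> \bar R} :=
  (lebesgue_row N \x lebesgue_measure)%E.

Definition Lp_loc (p : R) D f : Prop :=
  ae_measurable lebesgue_spacetime D f /\
  forall K, compact K -> K `<=` D ->
    (\int[lebesgue_spacetime]_(z in K) (`|f z| `^ p)%:E < +oo)%E.

Definition Linfty_loc D f : Prop :=
  ae_measurable lebesgue_spacetime D f /\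
  forall K, compact K -> K `<=` D ->
    exists C : R, {ae lebesgue_spacetime, forall z, K z -> `|f z| <= C}.

Definition C1_c D (phi : 'rV[R]_N * R -> R) : Prop :=
  [/\ forall z, differentiable phi z,
      forall v, continuous ('D_v phi) &
      compactly_inside [set z | phi z != 0] D].

Definition weak_derivative D (v : 'rV[R]_N * R) f g : Prop :=
  forall phi, C1_c D phi ->
    \int[lebesgue_spacetime]_(z in D) (f z * 'D_v phi z) =
    - \int[lebesgue_spacetime]_(z in D) (g z * phi z).

Variables (Omega : set 'rV[R]_N) (T : R).

Definition weak_gradient f (Df : 'rV[R]_N * R -> 'rV[R]_N) : Prop :=
  forall i, weak_derivative (Omega `*` `]0, T[)
    (delta_mx ord0 i, 0) f (fun z => Df z ord0 i).

Definition weak_time_derivative f g : Prop :=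
  weak_derivative (Omega `*` `]0, T[) (0, 1) f g.

(* The outer measure only serves to measure sets that are Lebesgue but not
   Borel measurable. *)
Definition cvg_local_measure_at0 u : Prop :=
  forall K : set 'rV[R]_N, compact K -> K `<=` Omega ->
  forall eps : R, 0 < eps ->
    mu_ext (lebesgue_row N) [set x | K x /\ eps <= `|u (x, t) - u (x, 0)|]
      @[t --> 0^'+] --> 0%E.

Definition boundary_strip (delta : R) : set 'rV[R]_N :=
  [set x | Omega x /\ exists2 p, topboundary Omega p & enorm (x - p) < delta].

(* u = 0 on the lateral boundary.  As the gradient of u is only locally
   integrable in Omega there is no Sobolev trace; the vanishing of the averages
   over thin boundary strips follows from continuous vanishing at the boundary
   and, on a Lipschitz domain, amounts to a zero trace for W^{1,1} functions. *)
Definition zero_lateral_boundary u : Prop :=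
  {ae lebesgue_measure, forall t : R, 0 < t <= T ->
    (delta^-1 * \int[lebesgue_row N]_(x in boundary_strip delta) `|u (x, t)|)
      @[delta --> 0^'+] --> (0 : R)}.

End space_time.

Section nonlinearities.
Context {R : realType}.
Variables h P : R -> R.

Definition H_of (u : R) : R := \int[lebesgue_measure]_(s in `]0, u]) h s.

(* h is only meaningful on ]0, +oo[; as P 0 = 0 below, F_of 0 = 0 whatever the
   value of h at 0. *)
Definition F_of (s : R) : R := h s * P s.

(* G'(s) is understood as sqrt(F'(s)) at every s > 0. *)
Definition dG_of (s : R) : R := Num.sqrt (derive1 F_of s).

Definition G_of (s : R) : R := \int[lebesgue_measure]_(r in `]0, s]) dG_of r.

Record nonlinearities : Prop := {
  P_continuous : {within `[0, +oo[, continuous P};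
  P_at0 : P 0 = 0;
  P_bounds : exists c3 : R, forall s, 0 < s -> 0 < P s < c3;
  h_continuous : {within `]0, +oo[, continuous h};
  h_gt0 : forall s, 0 < s -> 0 < h s;
  h_integrable : lebesgue_measure.-integrable `]0, 1] (EFin \o h);
  F_at0 : F_of 0 = 0;
  F_derivable : forall s, 0 < s -> derivable F_of s 1;
  F_derivative_gt0 : forall s, 0 < s -> 0 < derive1 F_of s;
  F_derivative_locally_bounded : forall a b, 0 < a ->
    exists C : R, forall s, a <= s <= b -> `|derive1 F_of s| <= C }.

End nonlinearities.

Section solution.
Context {R : realType} (N : nat).
Variables (h P : R -> R) (Omega : set 'rV[R]_N) (T : R).

(* - \int theta F(u) \Delta u at time t; Du and DGu stand for the spatial weak
   gradients of u and of G(u). *)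
Definition weak_diffusion (u : 'rV[R]_N * R -> R)
    (Du DGu : 'rV[R]_N * R -> 'rV[R]_N) (theta : 'rV[R]_N -> R) (t : R) : R :=
  \int[lebesgue_row N]_(x in Omega)
    (F_of h P (u (x, t)) * dotv (Du (x, t)) (grad theta x)
     + enorm (DGu (x, t)) ^+ 2 * theta x).

(* The measurability of every time slice and the local square integrability of
   the gradient of G(u) are what the integrals of the inequality require. *)
Definition subsolution (u : 'rV[R]_N * R -> R) : Prop :=
  [/\ Linfty_loc (Omega `*` `[0, T]) u,
      forall t, 0 <= t <= T ->
        ae_measurable (lebesgue_row N) Omega (fun x => u (x, t)) /\
        {ae lebesgue_row N, forall x, Omega x -> 0 <= u (x, t)},
      exists2 ut, Lp_loc 1 (Omega `*` `]0, T]) ut &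
        weak_time_derivative Omega T u ut,
      cvg_local_measure_at0 Omega u &
      exists Du DGu : 'rV[R]_N * R -> 'rV[R]_N,
        [/\ forall i, Lp_loc 2 (Omega `*` `]0, T]) (fun z => Du z ord0 i),
            weak_gradient Omega T u Du,
            forall i, Lp_loc 2 (Omega `*` `]0, T]) (fun z => DGu z ord0 i),
            weak_gradient Omega T (G_of h P \o u) DGu &
            forall theta, Lip_c Omega theta -> (forall x, 0 <= theta x) ->
            forall s t, 0 < s -> s < t -> t <= T ->
              \int[lebesgue_row N]_(x in Omega) (theta x * H_of h (u (x, t)))
              - \int[lebesgue_row N]_(x in Omega) (theta x * H_of h (u (x, s)))
              + \int[lebesgue_measure]_(tau in `[s, t])
                  weak_diffusion u Du DGu theta tau <= 0]].

End solution.

(* Main.v *)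
Require Import Defs.
From HB Require Import structures.
From mathcomp Require Import all_boot all_order all_algebra.
From mathcomp Require Import all_classical all_reals all_analysis.
From mathcomp Require Import measurable_realfun ring lra.
Set Implicit Arguments.
Unset Strict Implicit.
Unset Printing Implicit Defensive.
Import Order.TTheory GRing.Theory Num.Theory.
Import numFieldNormedType.Exports.
Local Open Scope classical_set_scope.
Local Open Scope ring_scope.

(* Put v = G(u).  Testing the inequality with theta = max(rho^2 - |x - x0|^2, 0)^2
   and using (A-1) in the form F(u) |D_i u| <= C1 v |D_i v|, the convection term is
   absorbed in the dissipation; as u vanishes initially on the ball, the integral
   of H(u) over a smaller ball and the space-time integral of |Dv|^2 are bounded
   by a multiple of Y(rho), the integral of v^2 over B_rho x (0,T').  No chain rule
   is available: the gradients of u and v are compared through difference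
   quotients, along which G(u) is a monotone function of u.
   Conversely, averaging v(x)^2 <= |v(x+w) - v(x)|^2 + 2 v(x) v(x+w) over w in a
   cube of side e bounds the integral of v^2 over a ball by e^2 times that of
   |Dv|^2 plus e^-N times the squared mass of v, both over a slightly larger ball,
   and (A-2) bounds the mass of v: v <= d + C d^(1-p) H(u) with p < 2.  On radii
   decreasing to R' with geometric gaps, and e, d chosen geometric too, Y decays
   geometrically when T' is small, so v = 0 on the limit cylinder. *)

(** * Null sets and translation invariance of Lebesgue measure *)

(** The obstacle is that u and v = G(u) are only weakly differentiable and known up to null sets,
    while G need not be Lipschitz near 0. Borel representatives are fixed; at almost every point
    their increments along coordinate lines are integrals of the weak derivatives, and Lebesgue
    differentiation along the lines returns the pointwise gradients. Integrated from a to b, (A-1)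
    reads F(a)(b - a) <= C1 G(b)(G(b) - G(a)), which passes to the limit of difference quotients.
    The averaging acts as an interpolation inequality with two free parameters. At level k the
    energy is at most L 4^k Y_k and e is of order 2^-k, so the mass term is of order t 2^(kn) (d +
    d^(1-p) 4^k Y_k)^2. If Y_k is of order q^k and d = kappa^k, the square is of order kappa^(2k)
    once 4 q <= kappa^p, and the whole term is of order t q^k once q = 2^n kappa^2. The two are
    compatible because p < 2; a small T' then supplies the remaining constant for all k at once. The
    cylinders keep their bottom at time 0, because convergence in measure makes the initial energy
    vanish. *)

Section integral_ae.
Local Open Scope ereal_scope.
Context d (T : measurableType d) (R : realType).
Variable mu : {measure set T -> \bar R}.
Import HBNNSimple.

(* No measurability is required of the integrands: deleting a null set from a
   simple function below one of them gives a simple function below the other. *)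
Lemma integral_ae_congr (D : set T) (f g : T -> \bar R) :
  {ae mu, forall x, D x -> f x = g x} ->
  \int[mu]_(x in D) f x = \int[mu]_(x in D) g x.
Proof.
move=> fg.
have le_nn (a b : T -> \bar R) : {ae mu, forall x, a x = b x} ->
    (forall x, 0 <= b x) ->
    ereal_sup [set sintegral mu h |
      h in [set h : {nnsfun T >-> R} | forall x, (h x)%:E <= a x]] <=
    ereal_sup [set sintegral mu h |
      h in [set h : {nnsfun T >-> R} | forall x, (h x)%:E <= b x]].
  move=> [Z [mZ Z0 abZ]] b0; apply/ge_ereal_sup => _ [h /= ha <-].
  have [k kE] : exists k : {nnsfun T >-> R},
      forall x, k x = (h x * (x \in ~` Z)%:R)%R.
    by exists (mul_nnsfun h (indic_nnsfun R (measurableC mZ))) => x; rewrite /= mindicE.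
  have -> : sintegral mu h = sintegral mu k.
    rewrite -!integralT_nnsfun; apply: ge0_ae_eq_integral => //.
    - exact/measurable_EFinP.
    - exact/measurable_EFinP.
    - by move=> x _; rewrite lee_fin.
    - by move=> x _; rewrite lee_fin.
    - exists Z; split => // x /=; apply: contra_notP => Zx _.
      by rewrite kE mem_set// mulr1.
  apply: ereal_sup_ubound; exists k => //= x; rewrite kE.
  have [xZ|xZ] := pselect (Z x).
    by rewrite memNset ?mulr0//=; apply.
  rewrite mem_set// mulr1 (_ : b x = a x)//.
  by apply: contrapT => ba; apply: xZ; apply: abZ => /= ab; exact: ba.
have eq_nn (a b : T -> \bar R) : {ae mu, forall x, a x = b x} ->
    (forall x, 0 <= a x) -> (forall x, 0 <= b x) ->
    ereal_sup [set sintegral mu h |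
      h in [set h : {nnsfun T >-> R} | forall x, (h x)%:E <= a x]] =
    ereal_sup [set sintegral mu h |
      h in [set h : {nnsfun T >-> R} | forall x, (h x)%:E <= b x]].
  move=> ab a0 b0; apply/eqP; rewrite eq_le !le_nn//.
  by apply: filterS ab.
have fg' : {ae mu, forall x, (f \_ D) x = (g \_ D) x}.
  apply: filterS fg => x fgx; rewrite !patchE; case: ifPn => // xD.
  by apply: fgx; exact: set_mem.
rewrite /integral; congr (_ - _); apply: eq_nn => //.
- by apply: filterS fg' => x e; rewrite !funeposE e.
- by apply: filterS fg' => x e; rewrite !funenegE e.
Qed.

Lemma Rintegral_ae_congr (D : set T) (f g : T -> R) :
  {ae mu, forall x, D x -> f x = g x} ->
  (\int[mu]_(x in D) f x = \int[mu]_(x in D) g x)%R.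
Proof.
move=> fg; congr fine; apply: integral_ae_congr.
by apply: filterS fg => x fgx Dx; rewrite fgx.
Qed.

End integral_ae.

Lemma ae_imply d (T : measurableType d) (R : realType)
    (mu : {measure set T -> \bar R}) (P Q : T -> Prop) :
  (forall x, P x -> Q x) -> {ae mu, forall x, P x} -> {ae mu, forall x, Q x}.
Proof.
move=> PQ [Z [mZ Z0 ZP]]; exists Z; split => // x nQ; apply: ZP => /= Px.
exact/nQ/PQ.
Qed.

Lemma ae_and d (T : measurableType d) (R : realType)
    (mu : {measure set T -> \bar R}) (P Q : T -> Prop) :
  {ae mu, forall x, P x} -> {ae mu, forall x, Q x} ->
  {ae mu, forall x, P x /\ Q x}.
Proof.
move=> aeP aeQ; apply: (@filterS2 _ _ (ae_filter_ringOfSetsType mu) _ _ _ _ aeP aeQ).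
by [].
Qed.

Lemma ae_all_nat d (T : measurableType d) (R : realType)
    (mu : {measure set T -> \bar R}) (P : nat -> T -> Prop) :
  (forall n, {ae mu, forall x, P n x}) -> {ae mu, forall x, forall n, P n x}.
Proof.
move=> aeP; have := @negligible_bigcup _ _ _ mu (fun n => ~` [set x | P n x]) aeP.
by apply: negligibleS => x /= /existsNP[n nP]; exists n.
Qed.

Lemma ae_ord d (T : measurableType d) (R : realType)
    (mu : {measure set T -> \bar R}) n (P : 'I_n -> T -> Prop) :
  (forall i, {ae mu, forall x, P i x}) -> {ae mu, forall x, forall i, P i x}.
Proof.
move=> aeP; have : {ae mu, forall x, forall k (kn : (k < n)%N), P (Ordinal kn) x}.
  apply: ae_all_nat => k; have [kn|kn] := pselect (is_true (k < n)%N).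
    apply: ae_imply (aeP (Ordinal kn)) => x Px kn'.
    by rewrite (_ : Ordinal kn' = Ordinal kn)//; exact: val_inj.
  by apply: aeW => x kn'.
by apply: ae_imply => x Px [k kn].
Qed.

Section translation.
Context {R : realType}.
Local Notation Rm := (measurableTypeR R).

Lemma measurable_shift (c : R) : measurable_fun setT (fun x : Rm => x + c : Rm).
Proof. exact: measurable_funD. Qed.

(** The pushforward under the shift is a measure that agrees with Lebesgue measure on half-open
    intervals, and these determine it. *)
Lemma lebesgue_measure_shift (c : R) (A : set Rm) : measurable A ->
  lebesgue_measure ((fun x : Rm => x + c) @^-1` A) = lebesgue_measure A.
Proof.
move=> mA; have mc := measurable_shift c.
apply/esym.
pose m' : {measure set Rm -> \bar R} :=
  @measure_function_pushforward__canonical__measure_function_Measure _ _ Rm Rm R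
    lebesgue_measure _ mc.
apply: (@lebesgue_measure_unique R m') => // _ [[a b] /= ab <-].
rewrite /m' /= /pushforward.
have -> : (fun x : Rm => x + c) @^-1` `]a, b] = `]a - c, b - c]%classic.
  by apply/seteqP; split => x /=; rewrite !in_itv/= ltrBlDr lerBrDr.
rewrite /= !lebesgue_measure_itv/= !lte_fin.
rewrite ltrBlDr subrK; case: ifP => // _.
by rewrite -!EFinB; congr EFin; ring.
Qed.

Lemma measurable_shift_row n (w : 'rV[R]_n) :
  measurable_fun [set: 'rV[R]_n] (fun x : 'rV[R]_n => x + w : 'rV[R]_n).
Proof.
apply: measurable_rowP => i.
rewrite (_ : (fun _ => _) = fun x : 'rV[R]_n => (x ord0 i) + w ord0 i).
  apply: measurable_funD => //; exact: measurable_coord.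
by apply/funext => x; rewrite mxE.
Qed.

(** Induction on the dimension: [row_cons] intertwines the shift by [w] with the product of the
    shifts by its first coordinate and by the rest, and the product measure is determined by its
    values on rectangles. *)
Lemma lebesgue_row_shift n (w : 'rV[R]_n) (A : set 'rV[R]_n) : measurable A ->
  lebesgue_row n ((fun x => x + w) @^-1` A) = lebesgue_row n A.
Proof.
elim: n w A => [|n ih] w A mA.
  congr (lebesgue_row 0 _); apply/seteqP.
  have xw (x : 'rV[R]_0) : x + w = x by apply/rowP => -[].
  by split => x /=; rewrite xw.
pose w' : 'rV[R]_n := \row_j w ord0 (lift ord0 j).
pose sh (z : Rm * 'rV[R]_n) : Rm * 'rV[R]_n := (z.1 + w ord0 ord0, z.2 + w').
have msh : measurable_fun setT sh.
  apply/measurable_fun_pairP; split => /=.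
    apply: (@measurableT_comp _ _ _ _ _ _ (fun x : Rm => x + w ord0 ord0 : Rm)).
      exact: measurable_shift.
    exact: measurable_fst.
  apply: (@measurableT_comp _ _ _ _ _ _ (fun x : 'rV[R]_n => x + w')).
    exact: measurable_shift_row.
  exact: measurable_snd.
pose m' : {measure set (Rm * 'rV[R]_n) -> \bar R} :=
  @measure_function_pushforward__canonical__measure_function_Measure
    _ _ (Rm * 'rV[R]_n)%type (Rm * 'rV[R]_n)%type R
    (lebesgue_measure \x lebesgue_row n)%E _ msh.
rewrite /= /lebesgue_row_step /pushforward.
have mB : measurable (@row_cons R n @^-1` A).
  by rewrite -[X in measurable X]setTI; exact: measurable_row_cons.
transitivity (m' (@row_cons R n @^-1` A)).
  rewrite /m' /= /pushforward; congr (product_measure1 _ _ _).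
  apply/seteqP; split => z /=; rewrite /sh.
  - have -> // : row_cons (z.1 + w ord0 ord0, z.2 + w') = row_cons z + w.
    apply/rowP => i; rewrite !mxE /=; have [j ->|->] := unliftP ord0 i.
      by rewrite /= !mxE.
    by rewrite /=.
  - have -> // : row_cons (z.1 + w ord0 ord0, z.2 + w') = row_cons z + w.
    apply/rowP => i; rewrite !mxE /=; have [j ->|->] := unliftP ord0 i.
      by rewrite /= !mxE.
    by rewrite /=.
apply/esym; apply: (@product_measure_unique _ _ _ _ _ lebesgue_measure (lebesgue_row n) m') => //.
move=> B C mB' mC; rewrite /m' /= /pushforward.
have -> : sh @^-1` (B `*` C) =
  ((fun x : Rm => x + w ord0 ord0) @^-1` B) `*` ((fun x => x + w') @^-1` C).
  by apply/seteqP; split.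
rewrite product_measure1E//.
- by congr (_ * _)%E; [exact: lebesgue_measure_shift|exact: ih].
- by rewrite -[X in measurable X]setTI; exact: measurable_shift.
- by rewrite -[X in measurable X]setTI; exact: measurable_shift_row.
Qed.

End translation.

(** * Borel measurability of open sets and of continuous functions *)

Section open_measurable.
Context {R : realType}.
Local Notation Rm := (measurableTypeR R).

(** An open set is the union of the countably many balls with centre in a dense family and radius
    1/(k+1) that it contains. The map [j] separates the measurable structure from the metric one: at
    both uses it is the identity on a common carrier. *)
Lemma open_measurable_dense d (V : measurableType d) (W : pseudoMetricType R)
    (j : V -> W) (I : countType) (c : I -> W) (U : set W) :
  (forall w e, 0 < e -> exists i, ball w e (c i)) ->
  (forall i k, measurable (j @^-1` ball (c i) k.+1%:R^-1)) ->
  open U -> measurable (j @^-1` U).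
Proof.
move=> cdense mball oU.
pose F (p : I * nat) : set V := if `[< ball (c p.1) p.2.+1%:R^-1 `<=` U >]
  then j @^-1` ball (c p.1) p.2.+1%:R^-1 else set0.
have -> : j @^-1` U = \bigcup_p F p.
  apply/seteqP; split => [x Ux|x [[i k] _]]; rewrite /F /=; last first.
    by case: asboolP => //= sub /sub.
  move: oU; rewrite openE => /(_ _ Ux) /nbhs_ballP[e /= e0 eU].
  (* Half of [e], because the chosen ball only contains [x] without being centred there. *)
  have [k ke] : exists k, k.+1%:R^-1 < e / 2.
    have e20 : 0 < e / 2 by rewrite divr_gt0.
    exists (Num.truncn (e / 2)^-1); rewrite invf_plt ?posrE//.
    by rewrite truncnS_gt.
  have [i ci] := cdense (j x) k.+1%:R^-1 ltac:(by rewrite invr_gt0 ltr0n).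
  exists (i, k) => //=; case: asboolP => /= [_|]; first exact: ball_sym.
  case=> y cy; apply: eU.
  rewrite [e]splitr; apply: ball_triangle (le_ball (ltW ke) ci) (le_ball (ltW ke) cy).
apply: countable_bigcupT_measurable; first exact: countableP.
by move=> p; rewrite /F; case: ifPn => // _; exact: mball.
Qed.

Let ratrow n (q : 'rV[rat]_n) : 'rV[R]_n := map_mx ratr q.

Let rat_dense (x e : R) : 0 < e -> exists q : rat, ball x e (ratr q).
Proof.
move=> e0; have /rat_in_itvoo[q] : x < x + e by rewrite ltrDl.
rewrite in_itv/= => /andP[xq qx]; exists q; rewrite /ball/= distrC.
by rewrite gtr0_norm ?subr_gt0// ltrBlDl.
Qed.

Let ratrow_dense n (x : 'rV[R]_n) e : 0 < e ->
  exists q : 'rV[rat]_n, ball x e (ratrow q).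
Proof.
move=> e0; have /choice[f fP] : forall i : 'I_n, exists q : rat,
  ball (x ord0 i) e (ratr q) by move=> i; exact: rat_dense.
exists (\row_i f i); split => // i j.
by rewrite !mxE (ord1 i).
Qed.

Let measurable_ballR (c e : R) : measurable (ball c e : set Rm).
Proof. by rewrite ball_itv. Qed.

Let measurable_ball_row n (c : 'rV[R]_n) e : 0 < e ->
  measurable (ball c e : set 'rV[R]_n).
Proof.
move=> e0.
have -> : ball c e = \bigcap_(i in [set: 'I_n])
    (fun x : 'rV[R]_n => x ord0 i) @^-1` (ball (c ord0 i) e).
  apply/seteqP; split => x /=; first by case=> _ + i _ => /(_ ord0 i).
  by move=> h; split => // i j; rewrite (ord1 i); exact: h.
apply: fin_bigcap_measurable => // i _.
rewrite -[X in measurable X]setTI; apply: measurable_coord => //.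
exact: measurable_ballR.
Qed.

Lemma open_measurable_row n (U : set 'rV[R]_n) : open U -> measurable U.
Proof.
apply: (@open_measurable_dense _ 'rV[R]_n 'rV[R]_n id 'rV[rat]_n (@ratrow n)).
  exact: ratrow_dense.
by move=> i k; apply: measurable_ball_row.
Qed.

Lemma open_measurable_spacetime n (U : set ('rV[R]_n * R)) :
  open U -> measurable (U : set ('rV[R]_n * Rm)).
Proof.
apply: (@open_measurable_dense _ ('rV[R]_n * Rm)%type ('rV[R]_n * R)%type id
  ('rV[rat]_n * rat)%type (fun p => (ratrow p.1, ratr p.2))).
  move=> [x t] e e0; have [q xq] := ratrow_dense x e0.
  by have [q' tq] := rat_dense t e0; exists (q, q').
move=> [q q'] k; rewrite preimage_id.
have -> : (ball (ratrow q, ratr q' : R) k.+1%:R^-1 : set ('rV[R]_n * R)) =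
  ball (ratrow q) k.+1%:R^-1 `*` ball (ratr q' : R) k.+1%:R^-1.
  by apply/seteqP; split => -[x t] [].
apply: measurableX; first exact: measurable_ball_row.
exact: measurable_ballR.
Qed.

Lemma continuous_measurable_row n (f : 'rV[R]_n -> R) :
  continuous f -> measurable_fun [set: 'rV[R]_n] f.
Proof.
move=> /continuousP cf; apply: (measurability _ (RGenOpens.measurableE R)).
move=> _ [_ [a [b ->] <-]]; rewrite setTI; apply: open_measurable_row.
exact/cf/interval_open.
Qed.

Lemma continuous_measurable_spacetime n (f : 'rV[R]_n * R -> R) :
  continuous f -> measurable_fun [set: 'rV[R]_n * Rm] f.
Proof.
move=> /continuousP cf; apply: (measurability _ (RGenOpens.measurableE R)).
move=> _ [_ [a [b ->] <-]]; rewrite setTI; apply: open_measurable_spacetime.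
exact/cf/interval_open.
Qed.

End open_measurable.

(** * Integrals under measure-preserving maps *)

Section measure_preserving.
Local Open Scope ereal_scope.
Context d (T : measurableType d) (R : realType).
Variable mu : {measure set T -> \bar R}.
Variable phi : T -> T.
Hypothesis mphi : measurable_fun setT phi.
Hypothesis phiP : forall A, measurable A -> mu (phi @^-1` A) = mu A.

Lemma ge0_integral_preserving (f : T -> \bar R) :
  measurable_fun setT f -> (forall x, 0 <= f x) ->
  \int[mu]_x f (phi x) = \int[mu]_x f x.
Proof.
move=> mf f0.
rewrite -[in LHS](preimage_setT phi) -[LHS](ge0_integral_pushforward mphi)//.
apply: (eq_measure_integral mu) => A mA _; exact: phiP.
Qed.

Lemma integral_preserving (f : T -> \bar R) :
  measurable_fun setT f -> \int[mu]_x f (phi x) = \int[mu]_x f x.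
Proof.
move=> mf; rewrite integralE [RHS]integralE; congr (_ - _).
- rewrite -[RHS]ge0_integral_preserving//; last exact: measurable_funepos.
  by apply: eq_integral => x _; rewrite !funeposE.
- rewrite -[RHS]ge0_integral_preserving//; last exact: measurable_funeneg.
  by apply: eq_integral => x _; rewrite !funenegE.
Qed.

End measure_preserving.

Section spacetime_measure.
Context {R : realType}.
Local Notation Rm := (measurableTypeR R).
Local Notation nu n := (lebesgue_row n \x @lebesgue_measure R)%E.

Definition shift_space n (w : 'rV[R]_n) (z : 'rV[R]_n * Rm) : 'rV[R]_n * Rm :=
  (z.1 + w, z.2).

Lemma measurable_shift_space n (w : 'rV[R]_n) :
  measurable_fun setT (shift_space w).
Proof.
apply/measurable_fun_pairP; split; last exact: measurable_snd.
apply: (@measurableT_comp _ _ _ _ _ _ (fun x : 'rV[R]_n => x + w)).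
  exact: measurable_shift_row.
exact: measurable_fst.
Qed.

Lemma spacetime_shift n (w : 'rV[R]_n) (A : set ('rV[R]_n * Rm)) :
  measurable A -> nu n (shift_space w @^-1` A) = nu n A.
Proof.
move=> mA; have mw := measurable_shift_space w.
pose m' : {measure set ('rV[R]_n * Rm) -> \bar R} :=
  @measure_function_pushforward__canonical__measure_function_Measure
    _ _ ('rV[R]_n * Rm)%type ('rV[R]_n * Rm)%type R (nu n) _ mw.
apply/esym.
apply: (@product_measure_unique _ _ _ _ _ (lebesgue_row n) lebesgue_measure m') => //.
move=> B C mB mC; rewrite /m' /= /pushforward.
have -> : shift_space w @^-1` (B `*` C) = ((fun x => x + w) @^-1` B) `*` C.
  by apply/seteqP; split.
rewrite product_measure1E//; last first.
  by rewrite -[X in measurable X]setTI; exact: measurable_shift_row.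
by congr (_ * _)%E; exact: lebesgue_row_shift.
Qed.

Lemma lebesgue_row_box n (a b : 'rV[R]_n) : (forall i, a ord0 i <= b ord0 i) ->
  measurable [set x : 'rV[R]_n | forall i, a ord0 i <= x ord0 i <= b ord0 i] /\
  lebesgue_row n [set x : 'rV[R]_n | forall i, a ord0 i <= x ord0 i <= b ord0 i]
  = (\prod_i (b ord0 i - a ord0 i))%:E.
Proof.
move=> ab; split.
  rewrite (_ : [set _ | _] = \bigcap_(i in [set: 'I_n])
    (fun x : 'rV[R]_n => x ord0 i) @^-1` `[a ord0 i, b ord0 i]); last first.
    apply/seteqP; split => x /=; first by move=> h i _; rewrite /= in_itv/=.
    by move=> h i; have := h i Logic.I; rewrite /= in_itv.
  apply: fin_bigcap_measurable => // i _.
  by rewrite -[X in measurable X]setTI; exact: measurable_coord.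
elim: n a b ab => [|n ih] a b ab.
  rewrite big_ord0 /= diracE mem_set//.
  by case.
pose a' : 'rV[R]_n := \row_j a ord0 (lift ord0 j).
pose b' : 'rV[R]_n := \row_j b ord0 (lift ord0 j).
have ab' i : a' ord0 i <= b' ord0 i by rewrite !mxE.
rewrite /= /lebesgue_row_step /pushforward.
rewrite (_ : _ @^-1` _ = `[a ord0 ord0, b ord0 ord0]%classic `*`
  [set x : 'rV[R]_n | forall i, a' ord0 i <= x ord0 i <= b' ord0 i]).
  rewrite product_measure1E//=; last first.
    rewrite (_ : [set _ | _] = \bigcap_(i in [set: 'I_n])
      (fun x : 'rV[R]_n => x ord0 i) @^-1` `[a' ord0 i, b' ord0 i]); last first.
      apply/seteqP; split => x /=; first by move=> h i _; rewrite /= in_itv/=.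
      by move=> h i; have := h i Logic.I; rewrite /= in_itv.
    apply: fin_bigcap_measurable => // i _.
    by rewrite -[X in measurable X]setTI; exact: measurable_coord.
  rewrite ih// lebesgue_measure_itv/= lte_fin big_ord_recl EFinM; congr (_ * _)%E.
    case: ltgtP (ab ord0) => // -> _; by rewrite subrr.
  by congr EFin; apply: eq_bigr => i _; rewrite !mxE.
apply/seteqP; split => -[s y] /=.
- move=> h; split.
    by have := h ord0; rewrite mxE unlift_none /= in_itv.
  by move=> i; have := h (lift ord0 i); rewrite !mxE liftK.
- rewrite in_itv/= => -[h1 h2] i; rewrite mxE.
  by have [j ->|->//] := unliftP ord0 i; rewrite /=; have := h2 j; rewrite !mxE.
Qed.

End spacetime_measure.

(** * Continuously differentiable cutoffs *)

Section C1_functions.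
Context {R : realType}.
Implicit Types V : normedModType R.

(** The regularity that [C1_c] demands of test functions, kept apart from the support condition so
    that it is stable under algebraic operations and compositions. *)
Definition C1 V (f : V -> R) : Prop :=
  (forall z, differentiable f z) /\ forall v, continuous ('D_v f).

Lemma C1_continuous V (f : V -> R) : C1 f -> continuous f.
Proof. by move=> [df _] z; exact: differentiable_continuous. Qed.

Lemma C1_cst V (c : R) : C1 (cst c : V -> R).
Proof.
split; first by move=> z; exact: differentiable_cst.
move=> v; rewrite (_ : 'D_v _ = cst 0); first exact: cst_continuous.
by apply/funext => z; rewrite derive_cst.
Qed.

Lemma C1D V (f g : V -> R) : C1 f -> C1 g -> C1 (f \+ g).
Proof.
move=> [df cf] [dg cg]; split; first by move=> z; exact: differentiableD.
move=> v; rewrite (_ : 'D_v _ = 'D_v f \+ 'D_v g).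
  by move=> z; apply: cvgD; [exact: cf|exact: cg].
by apply/funext => z; rewrite deriveD//; exact: diff_derivable.
Qed.

Lemma C1N V (f : V -> R) : C1 f -> C1 (fun x => - f x).
Proof.
move=> [df cf]; split; first by move=> z; exact: differentiableN.
move=> v; rewrite (_ : 'D_v _ = fun z => - 'D_v f z).
  by move=> z; apply: cvgN; exact: cf.
by apply/funext => z; rewrite deriveN//; exact: diff_derivable.
Qed.

Lemma C1_id : C1 (id : R -> R).
Proof.
split; first by move=> z; apply/derivable1_diffP.
move=> v; rewrite (_ : 'D_v _ = cst v); first exact: cst_continuous.
by apply/funext => z; rewrite derive_id.
Qed.

Lemma C1_sum V (I : Type) (s : seq I) (F : I -> V -> R) :
  (forall i, C1 (F i)) -> C1 (fun x => \sum_(i <- s) F i x).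
Proof.
move=> CF; elim: s => [|i s ih].
  rewrite (_ : (fun _ => _) = cst 0); first exact: C1_cst.
  by apply/funext => x; rewrite big_nil.
rewrite (_ : (fun _ => _) = F i \+ (fun x => \sum_(j <- s) F j x)).
  exact: C1D.
by apply/funext => x; rewrite big_cons.
Qed.

Lemma C1M V (f g : V -> R) : C1 f -> C1 g -> C1 (f \* g).
Proof.
move=> Cf Cg; have [df cf] := Cf; have [dg cg] := Cg.
split; first by move=> z; exact: differentiableM.
move=> v; rewrite (_ : 'D_v _ = f \* 'D_v g \+ g \* 'D_v f).
  move=> z; apply: cvgD.
    by apply: cvgM; [exact: C1_continuous|exact: cg].
  by apply: cvgM; [exact: C1_continuous|exact: cf].
by apply/funext => z; rewrite deriveM//; exact: diff_derivable.
Qed.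

Lemma derive_comp_real V (g : R -> R) (f : V -> R) z v :
  differentiable f z -> derivable g (f z) 1 ->
  'D_v (g \o f) z = derive1 g (f z) * 'D_v f z.
Proof.
move=> df dg; have /derivable1_diffP dg' := dg.
rewrite deriveE; last exact: differentiable_comp.
rewrite diff_comp//= deriveE// (deriv1E dg) /=.
by rewrite mulrC.
Qed.

Lemma C1_comp V (g g' : R -> R) (f : V -> R) :
  (forall y : R, is_derive y 1 g (g' y)) -> continuous g' -> C1 f -> C1 (g \o f).
Proof.
move=> dg cg Cf; have [df cf] := Cf.
have dg1 y : derivable g y 1 by have [] := dg y.
split.
  move=> z; apply: differentiable_comp => //.
  exact/derivable1_diffP.
move=> v; rewrite (_ : 'D_v _ = (g' \o f) \* 'D_v f).
  move=> z; apply: cvgM; last exact: cf.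
  by apply: continuous_comp; [exact: C1_continuous|exact: cg].
apply/funext => z; rewrite derive_comp_real// derive1E.
by have [_ ->] := dg (f z).
Qed.

Lemma differentiable_fst (U V : normedModType R) (z : U * V) :
  differentiable (fst : U * V -> U) z.
Proof. by apply: linear_differentiable => y; exact: cvg_fst. Qed.

Lemma differentiable_snd (U V : normedModType R) (z : U * V) :
  differentiable (snd : U * V -> V) z.
Proof. by apply: linear_differentiable => y; exact: cvg_snd. Qed.

Lemma C1_fst (U V : normedModType R) (f : U -> R) :
  C1 f -> C1 (fun z : U * V => f z.1).
Proof.
move=> [df cf]; split.
  by move=> z; apply: differentiable_comp => //; exact: differentiable_fst.
move=> v; rewrite (_ : 'D_v _ = 'D_(v.1) f \o fst)//.
by move=> z; apply: continuous_comp; [exact: cvg_fst|exact: cf].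
Qed.

Lemma C1_snd (U V : normedModType R) (f : V -> R) :
  C1 f -> C1 (fun z : U * V => f z.2).
Proof.
move=> [df cf]; split.
  by move=> z; apply: differentiable_comp => //; exact: differentiable_snd.
move=> v; rewrite (_ : 'D_v _ = 'D_(v.2) f \o snd)//.
by move=> z; apply: continuous_comp; [exact: cvg_snd|exact: cf].
Qed.

(** A quadratic remainder bound identifies the derivative; for the explicit functions used as
    cutoffs the remainder is computed at once. *)
Lemma is_derive_quadratic V (f : V -> R) (x v : V) (c K : R) :
  (forall h : R, `|f (h *: v + x) - f x - h * c| <= K * h ^+ 2) ->
  is_derive x v f c.
Proof.
move=> fK.
have K0 : 0 <= K by have := fK 1; rewrite expr1n mulr1; apply: le_trans.
have cv : (fun h : R => h^-1 *: (f (h *: v + x) - f x)) @ 0^' --> c.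
  apply/cvgrPdist_le => e e0; near=> h.
  have h0 : h != 0 by near: h; exact: nbhs_dnbhs_neq.
  rewrite -normrN opprB.
  have -> : h^-1 *: (f (h *: v + x) - f x) - c =
      h^-1 * (f (h *: v + x) - f x - h * c).
    by rewrite mulrBr mulrA mulVf// mul1r.
  rewrite normrM normfV ler_pdivrMl ?normr_gt0//.
  apply: (le_trans (fK h)).
  rewrite -real_normK ?num_real// expr2 mulrA mulrC ler_wpM2l//.
  have : `|h| <= e / (K + 1).
    near: h; apply: dnbhs0_le; rewrite divr_gt0//.
    by rewrite ltr_wpDl.
  rewrite ler_pdivlMr ?ltr_wpDl//; apply: le_trans.
  by rewrite mulrC ler_wpM2l// lerDl.
by apply: DeriveDef; [apply/cvg_ex; exists c|apply/cvg_lim].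
Unshelve. all: by end_near. Qed.

(** The squared positive part is of class C^1. It produces the cutoffs and turns a superlevel set {f
    > a} into the set where a C^1 function is nonzero. *)
Definition pos2 (y : R) : R := Num.max y 0 ^+ 2.

Lemma pos2_ge0 y : 0 <= pos2 y.
Proof. exact: sqr_ge0. Qed.

Lemma pos2_gt0 y : (0 < pos2 y) = (0 < y).
Proof.
by rewrite /pos2 exprn_even_gt0//=; case: ltgtP; rewrite ?eqxx// => /gt_eqF->.
Qed.

Lemma pos2_neq0 y : (pos2 y != 0) = (0 < y).
Proof. by rewrite -pos2_gt0 lt0r pos2_ge0 andbT. Qed.

Lemma is_derive_pos2 (y : R) : is_derive y 1 pos2 (2 * Num.max y 0).
Proof.
apply: (@is_derive_quadratic _ _ _ _ _ 1) => h.
rewrite [h *: _]mulr1 mul1r /pos2 ler_norml.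
by case: (leP (h + y) 0) => h1; case: (leP y 0) => h2; apply/andP; split; nra.
Qed.

Lemma C1_pos2_comp V (f : V -> R) : C1 f -> C1 (pos2 \o f).
Proof.
apply: C1_comp is_derive_pos2 _ => y; apply: cvgMr.
by apply: continuous_max; [exact: cvg_id|exact: cvg_cst].
Qed.

End C1_functions.

Lemma Rintegral_shift_itv (R : realType) (f : R -> R) (x a b : R) (p q : bool) :
  measurable_fun [set` Interval (BSide p (a + x)) (BSide q (b + x))] f ->
  \int[lebesgue_measure]_(s in [set` Interval (BSide p a) (BSide q b)]) f (s + x) =
  \int[lebesgue_measure]_(s in [set` Interval (BSide p (a + x)) (BSide q (b + x))]) f s.
Proof.
move=> mf; congr fine; rewrite integral_mkcond [RHS]integral_mkcond.
rewrite -[RHS](integral_preserving (measurable_shift x)).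
- apply: eq_integral => s _; rewrite !patchE !mem_setE.
  by case: p q {mf} => -[]; rewrite !in_itv/= !(lerD2r, ltrD2r).
- by move=> A mA; exact: lebesgue_measure_shift.
- by apply/(measurable_restrictT _ _).1 => //; exact/measurable_EFinP.
Qed.

Lemma measurable_ltr_set d (T : measurableType d) (R : realType)
    (f g : T -> R) : measurable_fun setT f -> measurable_fun setT g ->
  measurable [set x | f x < g x].
Proof.
move=> mf mg; have := measurable_fun_ltr mf mg.
by move=> /(_ measurableT [set true] Logic.I); rewrite setTI.
Qed.

Lemma normr_fine_le (R : realType) (x : \bar R) : (`|(fine x)%:E| <= `|x|)%E.
Proof. by case: x => [x| |] //=; rewrite normr0 leey. Qed.

(** * Lebesgue differentiation along the orbits of a measure-preserving flow *)

Section flow.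
Local Open Scope ereal_scope.
Context d (T : measurableType d) (R : realType).
Local Notation Rm := (measurableTypeR R).
Variable mu : {sigma_finite_measure set T -> \bar R}.
Variable flow : R -> T -> T.
Hypothesis mflow : measurable_fun [set: Rm * T] (fun p => flow p.1 p.2).
Hypothesis flow_mp : forall s A, measurable A -> mu (flow s @^-1` A) = mu A.
Hypothesis flowD : forall a b z, flow a (flow b z) = flow (a + b) z.

Let mflow1 (s : R) : measurable_fun setT (flow s).
Proof.
rewrite (_ : flow s = (fun p : Rm * T => flow p.1 p.2) \o pair (s : Rm))//.
exact: measurableT_comp.
Qed.

Let mflow2 (z : T) : measurable_fun [set: Rm] (flow^~ z).
Proof.
rewrite (_ : flow^~ z = (fun p : Rm * T => flow p.1 p.2) \o (pair^~ z : Rm -> _))//.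
exact: measurableT_comp.
Qed.

(** Restricting the parameter to [D] by truncation lets Tonelli be applied on the full product
    space. *)
Definition flow_restrict (f : T -> \bar R) (D : set Rm) (p : Rm * T) : \bar R :=
  ((fun p => f (flow p.1 p.2)) \_ (D `*` setT)) p.

Lemma flow_restrictE f D s z :
  flow_restrict f D (s, z) = ((fun s => f (flow s z)) \_ D) s.
Proof.
by rewrite /flow_restrict !patchE in_setX/= in_setT andbT.
Qed.

Lemma measurable_flow_restrict f D : measurable_fun setT f -> measurable D ->
  measurable_fun setT (flow_restrict f D).
Proof.
move=> mf mD; apply/(measurable_restrictT _ _).1; first exact: measurableX.
by apply: measurable_funTS; exact: measurableT_comp.
Qed.

Lemma measurable_flow_integral f D : measurable_fun setT f -> measurable D ->
  (forall z, 0 <= f z) ->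
  measurable_fun setT (fun z => \int[lebesgue_measure]_(s in D) f (flow s z)).
Proof.
move=> mf mD f0.
have mF := measurable_flow_restrict mf mD.
have := measurable_fun_fubini_tonelli_G (m1 := @lebesgue_measure R)
  (flow_restrict f D) mF.
rewrite (_ : fubini_G _ _ =
  fun z => \int[lebesgue_measure]_(s in D) f (flow s z)); last first.
  apply/funext => z; rewrite /fubini_G [RHS]integral_mkcond.
  by apply: eq_integral => s _; rewrite flow_restrictE.
by apply => -[s z]; rewrite flow_restrictE patchE; case: ifPn.
Qed.

(** Once the integrals are exchanged, the inner integral over z no longer depends on s, since
    [flow s] preserves the measure. *)
Lemma flow_tonelli f D : measurable_fun setT f -> measurable D ->
  (forall z, 0 <= f z) ->
  \int[mu]_z \int[lebesgue_measure]_(s in D) f (flow s z) =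
  lebesgue_measure D * \int[mu]_z f z.
Proof.
move=> mf mD f0.
have mF := measurable_flow_restrict mf mD.
have F0 p : 0 <= flow_restrict f D p.
  by case: p => s z; rewrite flow_restrictE patchE; case: ifPn.
transitivity (\int[mu]_z \int[lebesgue_measure]_s flow_restrict f D (s, z)).
  apply: eq_integral => z _; rewrite [LHS]integral_mkcond.
  by apply: eq_integral => s _; rewrite flow_restrictE.
rewrite -[LHS](fubini_tonelli (m1 := @lebesgue_measure R) (flow_restrict f D))//.
rewrite muleC -integral_cst// [RHS]integral_mkcond.
apply: eq_integral => s _; rewrite patchE.
under eq_integral do rewrite flow_restrictE patchE.
case: ifPn => [sD|sD]; last by rewrite integral0.
by rewrite (ge0_integral_preserving (mflow1 s))//; exact: flow_mp.
Qed.

Variable g : T -> R.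
Hypothesis mg : measurable_fun setT g.
Hypothesis ig : mu.-integrable setT (EFin \o g).

Let mgz z : measurable_fun [set: Rm] (fun s => g (flow s z)).
Proof. exact: measurableT_comp. Qed.

Lemma flow_abs_integral_fin (a b : R) :
  \int[mu]_z \int[lebesgue_measure]_(s in `[a, b]) `|(g (flow s z))%:E| < +oo.
Proof.
rewrite (@flow_tonelli (fun z => `|(g z)%:E|))//; last first.
  by apply: measurableT_comp => //; exact/measurable_EFinP.
rewrite lte_mul_pinfty//; last by case/integrableP: ig.
rewrite ge0_fin_numE//= lebesgue_measure_itv/=; case: ifPn => // _.
by rewrite -EFinB ltry.
Qed.

(** By Tonelli the integral of |g| over an orbit segment is an integrable function of the starting
    point, hence finite almost everywhere. *)
Lemma flow_ae_integrable (a b : R) :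
  {ae mu, forall z, lebesgue_measure.-integrable `[a, b]
    (fun s => (g (flow s z))%:E)}.
Proof.
pose k z := \int[lebesgue_measure]_(s in `[a, b]) `|(g (flow s z))%:E|.
have mk : measurable_fun setT k.
  apply: (@measurable_flow_integral (fun z => `|(g z)%:E|)) => //.
  by apply: measurableT_comp => //; exact/measurable_EFinP.
have ik : mu.-integrable setT k.
  apply/integrableP; split => //.
  rewrite (eq_integral k); last by move=> z _; rewrite gee0_abs// integral_ge0.
  exact: flow_abs_integral_fin.
have := integrable_ae measurableT ik.
apply: filterS => z /(_ Logic.I) kz; apply/integrableP; split.
  by apply/measurable_EFinP; apply: measurable_funTS; exact: mgz.
by move: kz; rewrite ge0_fin_numE// /k integral_ge0.
Qed.

Lemma measurable_flow_Rintegral (D : set Rm) : measurable D ->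
  measurable_fun setT (fun z => \int[lebesgue_measure]_(s in D) g (flow s z))%R.
Proof.
move=> mD; apply: measurableT_comp; first exact: fine_measurable.
rewrite (_ : (fun z => _) = fun z =>
    \int[lebesgue_measure]_(s in D) ((EFin \o g)^\+ (flow s z)) -
    \int[lebesgue_measure]_(s in D) ((EFin \o g)^\- (flow s z))).
  apply: emeasurable_funB; apply: measurable_flow_integral => //.
  - by apply: measurable_funepos; exact/measurable_EFinP.
  - by apply: measurable_funeneg; exact/measurable_EFinP.
apply/funext => z; rewrite integralE; congr (_ - _).
- by apply: eq_integral => s _; rewrite !funeposE.
- by apply: eq_integral => s _; rewrite !funenegE.
Qed.

Lemma flow_Rintegral_integrable (a b : R) : mu.-integrable setT
  (fun z => (\int[lebesgue_measure]_(s in `[a, b]) g (flow s z))%:E).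
Proof.
apply/integrableP; split.
  by apply/measurable_EFinP; exact: measurable_flow_Rintegral.
apply: le_lt_trans (flow_abs_integral_fin a b).
apply: ge0_le_integral => //.
- apply: measurableT_comp => //; apply/measurable_EFinP.
  exact: measurable_flow_Rintegral.
- apply: (@measurable_flow_integral (fun z => `|(g z)%:E|)) => //.
  by apply: measurableT_comp => //; exact/measurable_EFinP.
- move=> z _; apply: le_trans (normr_fine_le _) _.
  by apply: le_abse_integral => //; exact/measurable_EFinP/measurable_funTS.
Qed.

Definition flow_average (n : nat) (z : T) : R :=
  (n.+1%:R * \int[lebesgue_measure]_(s in `[0, n.+1%:R^-1]) g (flow s z))%R.

Lemma measurable_flow_average n : measurable_fun setT (flow_average n).
Proof. by apply: measurable_funM => //; exact: measurable_flow_Rintegral. Qed.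

(** Failure of convergence is written as a countable union of upper limits of sets, so that it is
    visibly measurable. *)
Let bad_flow : set T := \bigcup_m lim_sup_set
  (fun n => [set z | m.+1%:R^-1 < `|flow_average n z - g z|]%R).

Let measurable_bad_flow : measurable bad_flow.
Proof.
apply: bigcupT_measurable => m; apply: bigcapT_measurable => k.
apply: bigcup_measurable => n _.
apply: measurable_ltr_set => //.
apply: measurableT_comp => //; apply: measurable_funB => //.
exact: measurable_flow_average.
Qed.

Let not_bad_flow z : ~ bad_flow z -> flow_average n z @[n --> \oo] --> g z.
Proof.
move=> nb; apply/cvgrPdist_le => e e0.
have [m me] : exists m, (m.+1%:R^-1 < e)%R.
  exists (Num.truncn e^-1); rewrite invf_plt ?posrE//.
  by rewrite truncnS_gt.
have [k kP] : exists k, forall n, (k <= n)%N ->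
    (`|flow_average n z - g z| <= m.+1%:R^-1)%R.
  apply: contrapT => /forallNP h; apply: nb; exists m => // k _.
  have /existsNP[n /not_implyP[kn /negP]] := h k.
  by rewrite -ltNge => ?; exists n.
exists k => // n /= kn; rewrite distrC.
by rewrite (le_trans (kP n kn))// ltW.
Qed.

Let flow_average_shift n x z :
  flow_average n (flow x z) = (n.+1%:R *
    \int[lebesgue_measure]_(t in `[x, x + n.+1%:R^-1]) g (flow t z))%R.
Proof.
rewrite /flow_average; congr (_ * _)%R.
have := @Rintegral_shift_itv R (fun t => g (flow t z)) x 0 n.+1%:R^-1 true false
  (measurable_funTS (mgz z)).
rewrite add0r addrC => <-.
by apply: eq_Rintegral => s _; rewrite flowD.
Qed.

Let line_differentiation z :
  lebesgue_measure.-integrable `[0%R, 2%R] (fun s => (g (flow s z))%:E) ->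
  {ae lebesgue_measure, forall x, `]0%R, 1%R[%classic x -> ~ bad_flow (flow x z)}.
Proof.
move=> ifz.
(* The segment [0, 2] contains every averaging segment [x, x + 1/(n+1)] that starts in ]0, 1[. *)
pose f := (fun s => g (flow s z)) \_ `[0%R, 2%R].
have locf : locally_integrable setT f by exact: integrable_locally.
have if_ : lebesgue_measure.-integrable setT (EFin \o f).
  rewrite /f -restrict_EFin; apply/integrable_restrict => //.
  by rewrite setTI.
have ify y : lebesgue_measure.-integrable [set` Interval (BLeft 0%R) (BRight y)] (EFin \o f).
  exact: integrableS if_.
have := FTC1 ify locf.
apply: filterS; first exact: (ae_filter_ringOfSetsType lebesgue_measure).
move=> x /= H; rewrite in_itv/= => /andP[x0 x1].
have hx : (0%R)%:E < x%:E by rewrite lte_fin.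
pose F (y : R) := (\int[lebesgue_measure]_(t in `[0%R, y]) f t)%R.
have [dF F'] : derivable F x 1 /\ derive1 F x = f x := H hx.
have fx : f x = g (flow x z).
  rewrite /f patchE mem_set//= in_itv/= (ltW x0)/= (le_trans (ltW x1))//.
  by rewrite ler1n.
suff cv : flow_average n (flow x z) @[n --> \oo] --> g (flow x z).
  move=> [m _ bz].
  have /cvgrPdist_lt/(_ (m.+1%:R^-1)%R ltac:(by rewrite invr_gt0 ltr0n)) := cv.
  move=> [k _ kP]; have [n /= kn] := bz k Logic.I.
  by rewrite distrC ltNge ltW//; exact: kP.
(* By the group law, the average at [flow x z] is the difference quotient at [x] of the primitive
   [F], with step 1/(n+1). *)
have avgE n : flow_average n (flow x z) =
    ((n.+1%:R^-1)^-1 *: (F (n.+1%:R^-1 *: 1 + x) - F x))%R.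
  rewrite flow_average_shift invrK; congr (_ * _)%R.
  have n1 : (n.+1%:R^-1 <= 1 :> R)%R by rewrite invf_le1 ?ler1n.
  rewrite [(_ *: 1)%R]mulr1 [(_ + x)%R]addrC /F Rintegral_itvB//.
  - rewrite -Rintegral_itv_obnd_cbnd.
      apply: eq_Rintegral => t; rewrite inE/= in_itv/= => /andP[xt tx].
      rewrite /f patchE mem_set//= in_itv/= (le_trans (ltW x0) (ltW xt))/=.
      by rewrite (le_trans tx)// (_ : 2 = 1 + 1)%R// lerD// ltW.
    apply: integrableS ifz => //.
    apply: subset_itv; rewrite bnd_simp; first exact: ltW.
    by rewrite (_ : 2 = 1 + 1)%R// lerD// ltW.
  - by rewrite bnd_simp ltW.
  - by rewrite bnd_simp lerDl.
have := dF; rewrite /derivable => /cvgP cF.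
under eq_fun do rewrite avgE.
have dcv : (fun h => h^-1 *: (F (h *: 1 + x) - F x))%R @ (0%R : R)^' --> f x.
  by rewrite -F' derive1E; exact: cF.
rewrite -fx; apply: (cvgr_dnbhsP _ _ _).1 dcv (fun n => n.+1%:R^-1)%R _.
split; first by move=> n; rewrite invr_eq0 pnatr_eq0.
exact: cvg_harmonic.
Qed.

(* Lebesgue differentiation on each orbit, the exceptional sets being gathered by
   Tonelli since the flow preserves the measure. *)
Lemma flow_average_cvg :
  {ae mu, forall z, flow_average n z @[n --> \oo] --> g z}.
Proof.
suff mu0 : mu bad_flow = 0.
  exists bad_flow; split => // z /=; apply: contra_notP; exact: not_bad_flow.
have mi : measurable_fun setT (EFin \o (\1_bad_flow : T -> R)).
  by apply/measurable_EFinP; exact: measurable_indic.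
(* As ]0, 1[ has length one, Tonelli expresses [mu bad_flow] as the integral over z of the time its
   orbit spends in the bad set; that time is zero by differentiation on the line. *)
have := @flow_tonelli _ `]0%R, 1%R[ mi (measurable_itv _) (fun z => _).
rewrite integral_indic// setIT /= lebesgue_measure_itv/= lte_fin ltr01.
rewrite -EFinB subr0 mul1e => <-; last by move=> z; rewrite lee_fin.
rewrite -[RHS](integral0 mu setT); apply: integral_ae_congr.
have := flow_ae_integrable 0 2.
apply: filterS => z /line_differentiation nb _.
rewrite -[RHS](integral0 lebesgue_measure `]0%R, 1%R[).
apply: integral_ae_congr; move: nb.
apply: filterS; first exact: (ae_filter_ringOfSetsType lebesgue_measure).
by move=> x /[apply] xb; rewrite /= indicE memNset.
Qed.

End flow.

(** * Euclidean balls and space-time cylinders *)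

Section euclidean_balls.
Context {R : realType} {n : nat}.
Local Notation Rm := (measurableTypeR R).
Implicit Types (c x y v : 'rV[R]_n) (r h : R).

(** The squared distance is a polynomial in the coordinates, so cutoffs are built from it without
    differentiating a square root. *)
Definition dist2 c x : R := dotv (x - c) (x - c).

Lemma dist2E c x : dist2 c x = \sum_i (x ord0 i - c ord0 i) ^+ 2.
Proof. by apply: eq_bigr => i _; rewrite !mxE expr2. Qed.

Lemma dist2_ge0 c x : 0 <= dist2 c x.
Proof. by rewrite dist2E; apply: sumr_ge0 => i _; exact: sqr_ge0. Qed.

Lemma dist2_coord c x i : (x ord0 i - c ord0 i) ^+ 2 <= dist2 c x.
Proof.
rewrite dist2E (bigD1 i)//= lerDl; apply: sumr_ge0 => j _; exact: sqr_ge0.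
Qed.

Lemma eballE c r x : 0 < r -> eball c r x <-> dist2 c x < r ^+ 2.
Proof.
move=> r0; rewrite /eball/= /enorm -/(dist2 c x).
rewrite -(@ltr_pXn2r _ 2)// ?nnegrE ?sqrtr_ge0 ?(ltW r0)//.
by rewrite sqr_sqrtr// dist2_ge0.
Qed.

Lemma eball_le c r r' : r <= r' -> eball c r `<=` eball c r'.
Proof. by move=> rr' x /= /lt_le_trans; exact. Qed.

Definition unit_row (i : 'I_n) : 'rV[R]_n := delta_mx ord0 i.

Lemma dist2_shift c x i h :
  dist2 c (h *: unit_row i + x) =
  dist2 c x + 2 * h * (x ord0 i - c ord0 i) + h ^+ 2.
Proof.
rewrite !dist2E (bigD1 i)//= [in RHS](bigD1 i)//= !mxE !eqxx/=.
under eq_bigr => j ji do rewrite !mxE (negbTE ji) andbF mulr0 add0r.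
by ring.
Qed.

(** For a move parallel to an axis it is enough to expand the square and to bound a single
    coordinate of x - c by r. *)
Lemma eball_shift c x i r h : 0 < r -> eball c r x ->
  eball c (r + `|h|) (h *: unit_row i + x).
Proof.
move=> r0; rewrite !eballE//; last by rewrite ltr_wpDr.
move=> xr; rewrite dist2_shift.
have := le_lt_trans (dist2_coord c x i) xr.
have yr : `|x ord0 i - c ord0 i| < r.
  rewrite -(@ltr_pXn2r _ 2)// ?nnegrE ?(ltW r0)// real_normK ?num_real//.
  exact: le_lt_trans (dist2_coord c x i) xr.
have : h * (x ord0 i - c ord0 i) <= `|h| * r.
  by rewrite (le_trans (ler_norm _))// normrM ler_wpM2l// ltW.
have -> : h ^+ 2 = `|h| ^+ 2 by rewrite real_normK ?num_real.
by nra.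
Qed.

Lemma C1_coord i : C1 (fun x : 'rV[R]_n => x ord0 i).
Proof.
split; first by move=> x; exact: differentiable_coord.
move=> v; rewrite (_ : 'D_v _ = cst (v ord0 i)); first exact: cst_continuous.
apply/funext => x.
have [_ ->//] : is_derive x v (fun x : 'rV[R]_n => x ord0 i) (v ord0 i).
apply: (@is_derive_quadratic _ _ _ _ _ _ 0) => h.
by rewrite !mxE addrK subrr normr0 mul0r.
Qed.

Lemma C1_dist2 c : C1 (dist2 c).
Proof.
rewrite (_ : dist2 c = fun x => \sum_i (x ord0 i - c ord0 i) * (x ord0 i - c ord0 i)).
  have Ci i : C1 (fun x : 'rV[R]_n => x ord0 i - c ord0 i).
    exact: C1D (C1_coord i) (C1_cst _ _).
  by apply: C1_sum => i; exact: C1M.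
by apply/funext => x; apply: eq_bigr => i _; rewrite !mxE.
Qed.

Lemma is_derive_dist2 c x i :
  is_derive x (unit_row i) (dist2 c) (2 * (x ord0 i - c ord0 i)).
Proof.
apply: (@is_derive_quadratic _ _ _ _ _ _ 1) => h; rewrite dist2_shift.
rewrite mul1r (_ : _ - _ - _ = h ^+ 2); last by ring.
by rewrite ger0_norm// sqr_ge0.
Qed.

Lemma continuous_dist2 c : continuous (dist2 c).
Proof. by move=> x; apply: C1_continuous; exact: C1_dist2. Qed.

Lemma measurable_dist2 c : measurable_fun [set: 'rV[R]_n] (dist2 c).
Proof. by apply: continuous_measurable_row; exact: continuous_dist2. Qed.

Lemma measurable_eball c r : measurable (eball c r).
Proof.
have [r0|r0] := ltP 0 r.
  rewrite (_ : eball c r = [set x | dist2 c x < r ^+ 2]).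
    by apply: measurable_ltr_set => //; exact: measurable_dist2.
  by apply/seteqP; split => x; rewrite eballE.
rewrite (_ : eball c r = set0)//; apply/seteqP; split => // x /=.
by rewrite /eball/= ltNge (le_trans r0)// sqrtr_ge0.
Qed.

Lemma eball_in_box c r x : eball c r x ->
  forall i, (c - const_mx r) ord0 i <= x ord0 i <= (c + const_mx r) ord0 i.
Proof.
move=> xr i; have r0 : 0 < r by apply: le_lt_trans xr; exact: sqrtr_ge0.
move: xr; rewrite eballE// => xr; have := le_lt_trans (dist2_coord c x i) xr.
by rewrite !mxE => yr; apply/andP; split; nra.
Qed.

Lemma eball_fin c r : (lebesgue_row n (eball c r) < +oo)%E.
Proof.
have [r0|r0] := leP 0 r; last first.
  rewrite (_ : eball c r = set0) ?measure0//; apply/seteqP; split => // x /=.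
  by rewrite /eball/= ltNge (le_trans (ltW r0))// sqrtr_ge0.
have [] := @lebesgue_row_box R n (c - const_mx r) (c + const_mx r).
  by move=> i; rewrite !mxE lerD2l ge0_cp.
move=> mB BE; apply: (@le_lt_trans _ _ (lebesgue_row n [set x | forall i,
  (c - const_mx r) ord0 i <= x ord0 i <= (c + const_mx r) ord0 i])).
  apply: le_measure; rewrite ?inE//; first exact: measurable_eball.
  by move=> x; exact: eball_in_box.
by rewrite BE ltry.
Qed.

End euclidean_balls.

Section boxes.
Context {R : realType} {n : nat}.
Local Notation Rm := (measurableTypeR R).
Local Notation nu := (lebesgue_row n \x @lebesgue_measure R)%E.
Implicit Types (c : 'rV[R]_n) (r s t : R).

Definition box c r s t : set ('rV[R]_n * R) := eball c r `*` `]s, t[%classic.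

(** The compact companion of [box]: it contains the closed supports of the test functions, and local
    integrability hypotheses apply on it. *)
Definition cbox c r s t : set ('rV[R]_n * R) :=
  [set x | dist2 c x <= r ^+ 2] `*` `[s, t]%classic.

Lemma measurable_box c r s t : measurable (box c r s t : set ('rV[R]_n * Rm)).
Proof. by apply: measurableX => //; exact: measurable_eball. Qed.

Lemma box_fin c r s t : (nu (box c r s t) < +oo)%E.
Proof.
rewrite /box product_measure1E//; last exact: measurable_eball.
have itv_fin : (lebesgue_measure (`]s, t[ : set R) < +oo)%E.
  by rewrite lebesgue_measure_itv/=; case: ifPn => // _; rewrite -EFinB ltry.
apply: lte_mul_pinfty => //.
  by rewrite ge0_fin_numE// eball_fin.
Qed.

Lemma box_cbox c r s t : box c r s t `<=` cbox c r s t.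
Proof.
move=> [x a] [/= cx]; rewrite in_itv/= => /andP[sa at_].
have r0 : 0 < r by apply: le_lt_trans cx; exact: sqrtr_ge0.
split; first by apply: ltW; apply/eballE.
by rewrite /= in_itv/= !ltW.
Qed.

Lemma cbox_box c r r' s t s' t' : 0 <= r -> r < r' -> s' < s -> t < t' ->
  cbox c r s t `<=` box c r' s' t'.
Proof.
move=> r0 rr' ss tt [x a] [/= cx]; rewrite in_itv/= => /andP[sa at_].
split => /=; last by rewrite in_itv/= (lt_le_trans ss)// (le_lt_trans _ tt).
apply/eballE; first exact: le_lt_trans rr'.
by rewrite (le_lt_trans cx)// ltrXn2r// ?nnegrE// (le_trans r0)// ltW.
Qed.

Lemma compact_cball c r : compact [set x | dist2 c x <= r ^+ 2].
Proof.
apply: (@subclosed_compact _ _ [set v : 'rV[R]_n | forall i,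
    `[c ord0 i - `|r|, c ord0 i + `|r|]%classic (v ord0 i)]).
- have /continuous_closedP := @continuous_dist2 R n c.
  by move=> /(_ _ (@closed_le R (r ^+ 2))).
- apply: (@rV_compact R n (fun i => `[c ord0 i - `|r|, c ord0 i + `|r|]%classic)).
  by move=> i; exact: segment_compact.
- move=> x /= cx i; rewrite in_itv/=.
  have := le_trans (dist2_coord c x i) cx.
  rewrite -(real_normK (num_real r)) -(real_normK (num_real (_ - _))).
  rewrite ler_pXn2r// ?nnegrE// ler_norml => /andP[h1 h2].
  by apply/andP; split; lra.
Qed.

Lemma compact_cbox c r s t : compact (cbox c r s t).
Proof.
apply: compact_setX; first exact: compact_cball.
exact: segment_compact.
Qed.

Lemma closed_cbox c r s t : closed (cbox c r s t).
Proof.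
apply: compact_closed; last exact: compact_cbox.
exact: norm_hausdorff.
Qed.

Lemma measurable_cbox c r s t : measurable (cbox c r s t : set ('rV[R]_n * Rm)).
Proof.
rewrite -(setCK (cbox c r s t)).
apply: measurableC; apply: open_measurable_spacetime.
by apply: closed_openC; exact: closed_cbox.
Qed.

Lemma cbox_fin c r s t : 0 <= r -> (nu (cbox c r s t) < +oo)%E.
Proof.
move=> r0; apply: le_lt_trans (box_fin c (r + 1) (s - 1) (t + 1)).
apply: le_measure; rewrite ?inE; [exact: measurable_cbox|exact: measurable_box|].
by apply: cbox_box => //; rewrite ?ltrDl ?gtrDl ?ltrN10 ?ltr01.
Qed.

(** Multiplying by this C^1 function confines a test function to the open cylinder without changing
    its zero set inside; the factor (z.2 - s)(t - z.2) is positive exactly for times in ]s, t[. *)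
Definition boxcut c r s t (z : 'rV[R]_n * R) : R :=
  pos2 (r ^+ 2 - dist2 c z.1) * pos2 ((z.2 - s) * (t - z.2)).

Lemma boxcut_neq0 c r s t z : 0 < r -> s < t ->
  (boxcut c r s t z != 0) <-> box c r s t z.
Proof.
move=> r0 st; rewrite /boxcut mulf_eq0 negb_or !pos2_neq0 subr_gt0.
split=> [/andP[cz stz]|[/= cz]].
  split => /=; first exact/eballE.
  by rewrite in_itv/=; apply/andP; split; nra.
by move/eballE : cz => -> //; rewrite in_itv/= => /andP[sz zt]; rewrite mulr_gt0 ?subr_gt0.
Qed.

Lemma C1_boxcut c r s t : C1 (boxcut c r s t).
Proof.
apply: (@C1M _ _ (fun z => pos2 (r ^+ 2 - dist2 c z.1))
                 (fun z : 'rV[R]_n * R => pos2 ((z.2 - s) * (t - z.2)))).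
- apply: (@C1_fst _ _ _ (fun x => pos2 (r ^+ 2 - dist2 c x))).
  apply: (@C1_pos2_comp _ _ (fun x => r ^+ 2 - dist2 c x)).
  apply: (@C1D _ _ (cst (r ^+ 2)) (fun x => - dist2 c x)); first exact: C1_cst.
  exact/C1N/C1_dist2.
- apply: (@C1_snd _ _ _ (fun a : R => pos2 ((a - s) * (t - a)))).
  apply: (@C1_pos2_comp _ _ (fun a : R => (a - s) * (t - a))).
  apply: C1M; first exact: C1D (C1_id) (C1_cst _ _).
  apply: (@C1D _ _ (cst t) (fun a => - a)); first exact: C1_cst.
  exact/C1N/C1_id.
Qed.

(** Off the closed cylinder the function is locally zero, hence so is its derivative; on the
    cylinder the continuous derivative is bounded by compactness. *)
Lemma C1_supported_bound (phi : 'rV[R]_n * R -> R) c r s t v :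
  C1 phi -> (forall z, phi z != 0 -> box c r s t z) ->
  exists C, forall z, `|'D_v phi z| <= C * (\1_(cbox c r s t) z).
Proof.
move=> [dphi cphi] sphi.
have D0 z : ~ cbox c r s t z -> 'D_v phi z = 0.
  move=> nz; rewrite -[RHS](derive_cst (0 : R) z v).
  apply: near_eq_derive => //.
  have : open_nbhs z (~` cbox c r s t).
    by split => //; exact/closed_openC/closed_cbox.
  move/open_nbhs_nbhs; apply: filterS => y ny; apply/eqP; apply: contra_notT ny.
  by move=> /sphi /box_cbox.
have : compact ('D_v phi @` cbox c r s t).
  apply: continuous_compact; last exact: compact_cbox.
  by apply: continuous_subspaceT => z; exact: cphi.
move=> /compact_bounded[M [Mr MP]].
exists (`|M| + 1) => z.
have [cz|cz] := pselect (cbox c r s t z).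
  rewrite indicE mem_set// mulr1; apply: (MP (`|M| + 1)).
    by rewrite (le_lt_trans (ler_norm M))// ltrDl.
  by exists z.
by rewrite D0// indicE memNset// normr0 mulr0.
Qed.

End boxes.

Section step.
Context {R : realType}.

(* step m y increases to the indicator of y <> 0 as m grows *)
Definition step (m : nat) (y : R) : R := 1 - (1 + m%:R * y ^+ 2)^-1.

Let den_gt0 (m : nat) (y : R) : 0 < 1 + m%:R * y ^+ 2.
Proof. by rewrite ltr_wpDr// mulr_ge0// sqr_ge0. Qed.

Lemma step0 m : step m 0 = 0.
Proof. by rewrite /step expr0n mulr0 addr0 invr1 subrr. Qed.

Lemma step_ge0 m y : 0 <= step m y.
Proof.
by rewrite subr_ge0 invf_le1 ?den_gt0// lerDl mulr_ge0// sqr_ge0.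
Qed.

Lemma step_le1 m y : step m y <= 1.
Proof. by rewrite lerBlDr lerDl invr_ge0 ltW. Qed.

Lemma step_cvg y : step m y @[m --> \oo] --> ((y != 0)%:R : R).
Proof.
have [->|y0] := eqVneq y 0.
  rewrite (_ : (fun m => _) = cst 0); first exact: cvg_cst.
  by apply/funext => m; rewrite step0.
rewrite -[in X in _ --> X](subr0 1); apply: cvgB; first exact: cvg_cst.
have y20 : 0 < y ^+ 2 by rewrite exprn_even_gt0.
apply/cvgrPdist_le => e e0; near=> m.
rewrite sub0r normrN gtr0_norm ?invr_gt0// invf_ple ?posrE//.
apply: (@le_trans _ _ (m%:R * y ^+ 2)); last by rewrite lerDr.
rewrite -ler_pdivrMr//; near: m; exact: nbhs_infty_ger.
Unshelve. all: by end_near. Qed.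

Lemma C1_step (V : normedModType R) m (f : V -> R) : C1 f -> C1 (step m \o f).
Proof.
pose den (y : R) := 1 + m%:R * y ^+ 2.
apply: (@C1_comp _ _ _ (fun y => (den y)^-2 * (m%:R * (2 * y)))).
  move=> y; rewrite /step.
  have dden : is_derive y 1 den (m%:R * (2 * y)).
    apply: (@is_derive_quadratic _ _ _ _ _ _ m%:R) => h.
    rewrite [h *: _]mulr1 /den (_ : _ - _ - _ = m%:R * h ^+ 2); last by ring.
    by rewrite ger0_norm// mulr_ge0// sqr_ge0.
  have dn0 : den y != 0 by rewrite gt_eqF// den_gt0.
  have dV : is_derive y 1 (fun y => (den y)^-1) (- (den y) ^- 2 *: (m%:R * (2 * y))).
    exact: is_deriveV.
  have dC : is_derive y 1 (cst 1 : R -> R) 0 by exact: is_derive_cst.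
  have := is_deriveB dC dV; rewrite sub0r scaleNr opprK.
  by [].
move=> y; apply: cvgM; last first.
  by apply: cvgM; [exact: cvg_cst|apply: cvgM; [exact: cvg_cst|exact: cvg_id]].
apply: cvgV; first by rewrite expf_neq0// gt_eqF// den_gt0.
have cd : den y' @[y' --> y] --> den y.
  apply: cvgD; first exact: cvg_cst.
  by apply: cvgM; [exact: cvg_cst|exact: exprn_continuous].
by apply: cvgM.
Qed.

End step.

(** * Translates of functions with a weak derivative *)

Section integral_vanishing.
Local Open Scope ereal_scope.
Context d (T : measurableType d) (R : realType).
Variable mu : {measure set T -> \bar R}.
Variables (B : set T) (mB : measurable B) (k : T -> R).
Hypothesis ik : mu.-integrable B (EFin \o k).

Let mk : measurable_fun B k.
Proof. by apply/measurable_EFinP; exact: measurable_int ik. Qed.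

Let ikA A : measurable A -> mu.-integrable B (fun z => (k z * \1_A z)%:E).
Proof.
move=> mA; apply: le_integrable ik => //.
  by apply/measurable_EFinP; apply: measurable_funM.
move=> z _ /=; rewrite lee_fin normrM ler_piMr// indicE.
by case: (_ \in _); rewrite ?normr1 ?normr0.
Qed.

(** Proper differences are handled by linearity, increasing unions by dominated convergence with
    majorant |k|. *)
Lemma vanishing_lambda_system : \int[mu]_(z in B) (k z)%:E = 0 ->
  lambda_system setT [set A | measurable A /\
    \int[mu]_(z in B) (k z * \1_A z)%:E = 0].
Proof.
move=> k0; split => //.
- split => //; rewrite -[RHS]k0; apply: eq_integral => z _.
  by rewrite indicE in_setT mulr1.
- move=> A A' A'A [mA A0] [mA' A'0]; split; first exact: measurableD.
  under eq_integral => z _.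
    rewrite (_ : (k z * _)%R = (k z * \1_A z - k z * \1_A' z)%R).
      rewrite EFinB; over.
    rewrite !indicE -mulrBr; congr (_ * _)%R; rewrite in_setD.
    have [zA'|zA'] := boolP (z \in A').
      by rewrite andbF (mem_set (A'A _ (set_mem zA'))) subrr.
    by rewrite andbT subr0.
  rewrite integralB//; last 2 first.
    exact: ikA.
    exact: ikA.
  by rewrite A0 A'0 subee.
- move=> A ndA HA; have mA n : measurable (A n) by have [] := HA n.
  have mUA : measurable (\bigcup_n A n) by exact: bigcupT_measurable.
  split => //.
  have [|||||_ _] := @dominated_convergence _ _ _ mu B mB
    (fun n z => (k z * \1_(A n) z)%:E) (fun z => (k z * \1_(\bigcup_n A n) z)%:E)
    (fun z => `|(k z)%:E|).
  + by move=> n; exact: measurable_int (ikA (mA n)).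
  + exact: measurable_int (ikA mUA).
  + apply: aeW => z _; apply: cvg_near_cst.
    have [[m _ Amz]|nA] := pselect ((\bigcup_n A n) z).
      exists m => // p /= mp; congr EFin; congr (_ * _)%R.
      have Apz : A p z by move: (z) Amz; exact/subsetPset/ndA.
      by rewrite !indicE !mem_set//; exists m.
    apply: nearW => p; congr EFin; congr (_ * _)%R.
    by rewrite !indicE !memNset// => Ap; apply: nA; exists p.
  + exact: integrable_abse.
  + apply: aeW => z p _ /=; rewrite lee_fin normrM ler_piMr// indicE.
    by case: (_ \in _); rewrite ?normr1 ?normr0.
  + move=> /cvg_lim <-//; apply/cvg_lim => //.
    apply: cvg_near_cst; apply: nearW => p.
    by have [] := HA p.
Qed.

(** Dynkin's theorem spreads the vanishing from the pi-system [G] to all measurable sets, and a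
    function with zero integral over each of them is zero almost everywhere. *)
Lemma vanishing_ae (G : set (set T)) : setI_closed G -> G setT ->
  measurable `<=` <<s G >> -> G `<=` measurable ->
  (forall A, G A -> \int[mu]_(z in B) (k z * \1_A z)%:E = 0) ->
  {ae mu, forall z, B z -> k z = 0%R}.
Proof.
move=> GI GT Gm mG G0.
have k0 : \int[mu]_(z in B) (k z)%:E = 0.
  rewrite -[RHS](G0 _ GT); apply: eq_integral => z _.
  by rewrite indicE in_setT mulr1.
have sub : <<s G >> `<=` [set A | measurable A /\
    \int[mu]_(z in B) (k z * \1_A z)%:E = 0].
  apply: lambda_system_subset => //; first exact: vanishing_lambda_system.
  by move=> A GA; split; [exact: mG|exact: G0].
have := @integral_ae_eq _ _ _ mu B mB (cst 0) (EFin \o k) ik (measurable_cst _).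
case=> [E EB mE|Z [mZ Z0 ZP]].
  have [_ E0] := sub _ (Gm _ mE).
  rewrite integral0 -[RHS]E0.
  rewrite -[in LHS](setIidr EB) integral_mkcondr; apply: eq_integral => z _.
  by rewrite patchE indicE; case: ifPn => _; rewrite ?mulr1 ?mulr0.
exists Z; split => // z /= nk; apply: ZP => /= H; apply: nk => Bz.
by have [] := H Bz.
Qed.

End integral_vanishing.

(** * The fundamental lemma of the calculus of variations on a cylinder *)

Section fundamental_lemma.
Context {R : realType} {n : nat}.
Local Notation Rm := (measurableTypeR R).
Local Notation nu := (lebesgue_row n \x @lebesgue_measure R)%E.

Let G : set (set ('rV[R]_n * Rm)) :=
  [set A | exists2 q : 'rV[R]_n * R -> R, C1 q & A = [set z | q z != 0]].

Let GI : setI_closed G.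
Proof.
move=> _ _ [p Cp ->] [q Cq ->]; exists (p \* q); first exact: C1M.
by apply/seteqP; split => z /=; rewrite mulf_eq0 negb_or => /andP.
Qed.

Let GT : G setT.
Proof.
exists (cst 1); first exact: C1_cst.
by apply/seteqP; split => // z _ /=; exact: oner_neq0.
Qed.

Let G_measurable : G `<=` measurable.
Proof.
move=> _ [q Cq ->]; apply: open_measurable_spacetime.
have /continuousP cq := C1_continuous Cq.
have := cq [set y | y != 0] _; apply.
by have := @open_neq R 0.
Qed.

(** Applying [pos2] to f - a exhibits {f > a} as a member of [G]. Used for the coordinates, this
    shows that [G] generates the Borel sets. *)
Let G_coord (f : 'rV[R]_n * R -> R) : C1 f ->
  measurable_fun [set: g_sigma_algebraType G] (f : g_sigma_algebraType G -> Rm).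
Proof.
move=> Cf; apply: (measurability _ (RGenOInfty.measurableE R)).
move=> _ [_ [a ->] <-]; rewrite setTI; apply: sub_sigma_algebra.
exists (fun z => pos2 (f z - a)).
  apply: (@C1_pos2_comp _ _ (fun z => f z - a)).
  exact: C1D Cf (C1_cst _ _).
by apply/seteqP; split => z /=; rewrite pos2_neq0 subr_gt0 in_itv/= andbT.
Qed.

Let measurable_G : (measurable : set (set ('rV[R]_n * Rm))) `<=` <<s G >>.
Proof.
have mid : measurable_fun [set: g_sigma_algebraType G]
    (id : g_sigma_algebraType G -> 'rV[R]_n * Rm).
  apply/measurable_fun_pairP; split.
    apply: measurable_rowP => i.
    by apply: G_coord; apply: (@C1_fst _ _ _ (fun x : 'rV[R]_n => x ord0 i)); exact: C1_coord.
  by apply: G_coord; apply: (@C1_snd _ _ _ (fun x : R => x)); exact: C1_id.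
by move=> A mA; have := mid measurableT A mA; rewrite setTI.
Qed.

(* The sets {q > 0} with q of class C^1 form a pi-system generating the Borel
   sets, and their indicators are limits of C^1 functions with values in [0, 1]. *)
Lemma fundamental_lemma (k : 'rV[R]_n * R -> R) c r s t : 0 < r -> s < t ->
  nu.-integrable (box c r s t) (EFin \o k) ->
  (forall phi, C1 phi -> (forall z, phi z != 0 -> box c r s t z) ->
    (forall z, 0 <= phi z <= 1) ->
    (\int[nu]_(z in box c r s t) (k z * phi z)%:E = 0)%E) ->
  {ae nu, forall z, box c r s t z -> k z = 0}.
Proof.
move=> r0 st ik kphi.
have mB := @measurable_box R n c r s t.
have mk : measurable_fun (box c r s t : set ('rV[R]_n * Rm)) k.
  by apply/measurable_EFinP; exact: measurable_int ik.
apply: (vanishing_ae mB ik GI GT measurable_G G_measurable).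
move=> A GA; have mA := G_measurable GA; case: GA mA => q Cq -> mA.
(* On the cylinder [p] and [q] vanish at the same points, while [step m \o p] is an admissible test
   function: supported in the cylinder, with values in [0, 1]. *)
pose p z := boxcut c r s t z * q z.
have Cp : C1 p by apply: C1M => //; exact: C1_boxcut.
have p0 z : p z != 0 -> box c r s t z.
  by rewrite mulf_eq0 negb_or => /andP[/boxcut_neq0 + _]; apply.
have mp m : measurable_fun (box c r s t : set ('rV[R]_n * Rm)) (step m \o p).
  apply: measurable_funTS; apply: continuous_measurable_spacetime.
  exact/C1_continuous/C1_step.
have s01 m z : 0 <= (step m \o p) z <= 1 by rewrite step_ge0 step_le1.
have [|||||_ _] := @dominated_convergence _ _ _ nu _ mB
  (fun m z => (k z * (step m \o p) z)%:E)
  (fun z => (k z * \1_[set z | q z != 0] z)%:E)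
  (fun z => `|(k z)%:E|%E).
- by move=> m; apply/measurable_EFinP; exact: measurable_funM.
- by apply/measurable_EFinP; apply: measurable_funM.
- apply: aeW => z Bz; apply: cvg_EFin; first exact: nearW.
  apply: cvgM; first exact: cvg_cst.
  rewrite indicE (_ : (z \in _) = (p z != 0)); first exact: step_cvg.
  rewrite /p mulf_eq0 negb_or (_ : boxcut c r s t z != 0); last exact/boxcut_neq0.
  by apply/idP/idP => [/set_mem//|qz]; exact/mem_set.
- exact: integrable_abse.
- apply: aeW => z m _ /=; rewrite lee_fin normrM ler_piMr//.
  by have /andP[? ?] := s01 m z; rewrite ger0_norm.
- move=> /cvg_lim <-//; apply/cvg_lim => //.
  apply: cvg_near_cst; apply: nearW => m.
  apply: kphi => //; first exact: C1_step.
  by move=> z h; apply: p0; apply: contra_neq h => /= ->; rewrite step0.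
Qed.

End fundamental_lemma.

Lemma EFin_Rintegral d (T : measurableType d) (R : realType)
    (mu : {measure set T -> \bar R}) (D : set T) (f : T -> R) : measurable D ->
  mu.-integrable D (EFin \o f) ->
  (\int[mu]_(x in D) f x)%:E = (\int[mu]_(x in D) (f x)%:E)%E.
Proof. by move=> mD fi; rewrite /Rintegral fineK// integrable_fin_num. Qed.

Lemma bounded_support_integrable d (T : measurableType d) (R : realType)
    (mu : {measure set T -> \bar R}) (F : T -> R) C (B : set T) :
  measurable_fun setT F -> measurable B -> (mu B < +oo)%E ->
  (forall z, `|F z| <= C * \1_B z) -> mu.-integrable setT (EFin \o F).
Proof.
move=> mF mB Boo FC.
apply: (@le_integrable _ _ _ mu setT measurableT _ (fun z => (C * \1_B z)%:E)).
- exact/measurable_EFinP.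
- by move=> z _ /=; rewrite lee_fin (le_trans (FC z))// ler_norm.
- under eq_fun do rewrite EFinM.
  apply: integrableZl => //; apply/integrableP; split.
    exact/measurable_EFinP/measurable_indic.
  rewrite (eq_integral (EFin \o \1_B)); first by rewrite integral_indic// setIT.
  by move=> z _ /=; rewrite ger0_norm.
Qed.

Section fubini_restrict.
Local Open Scope ereal_scope.
Context d d' (S : measurableType d) (T : measurableType d') (R : realType).
Variable la : {sigma_finite_measure set S -> \bar R}.
Variable mu : {sigma_finite_measure set T -> \bar R}.
Variables (D : set S) (mD : measurable D) (A : S * T -> R).
Hypothesis mA : measurable_fun setT A.

Lemma Fubini_restrict (K : R) : la D < +oo ->
  (forall s, D s -> \int[mu]_z `|A (s, z)|%:E <= K%:E) ->
  \int[la]_(s in D) \int[mu]_z (A (s, z))%:E =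
  \int[mu]_z \int[la]_(s in D) (A (s, z))%:E.
Proof.
move=> Doo AK; pose F := (EFin \o A) \_ (D `*` setT).
have FE s z : F (s, z) = ((fun s => (A (s, z))%:E) \_ D) s.
  by rewrite /F !patchE in_setX/= in_setT andbT.
have mF : measurable_fun setT F.
  apply/(measurable_restrictT _ _).1; first exact: measurableX.
  by apply: measurable_funTS; exact/measurable_EFinP.
have iF : (la \x mu).-integrable setT F.
  apply/integrable12ltyP => //.
  apply: (@le_lt_trans _ _ (\int[la]_(s in D) (`|K|%R)%:E)); last first.
    by rewrite integral_cst// lte_mul_pinfty// lee_fin.
  rewrite [leRHS]integral_mkcond; apply: ge0_le_integral => //.
  - by move=> s _; exact: integral_ge0.
  - apply: (measurable_fun_fubini_tonelli_F (abse \o F)).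
      exact: measurableT_comp.
    by move=> p; exact: abse_ge0.
  - by apply/(measurable_restrictT _ _).1.
  - move=> s _; under eq_integral do rewrite FE patchE.
    rewrite patchE; case: ifPn => [/set_mem sD|_].
      by rewrite (le_trans (AK s sD))// lee_fin ler_norm.
    by under eq_integral do rewrite abse0; rewrite integral0.
transitivity (\int[la]_s \int[mu]_z F (s, z)).
  rewrite integral_mkcond; apply: eq_integral => s _.
  under [RHS]eq_integral do rewrite FE patchE.
  by rewrite patchE; case: ifPn => // _; rewrite integral0.
rewrite Fubini//; apply: eq_integral => z _.
rewrite [RHS]integral_mkcond; apply: eq_integral => s _; exact: FE.
Qed.

End fubini_restrict.

(** * Increments along coordinate lines as integrals of the weak derivative *)

Section representation.
Context {R : realType} {n : nat}.
Local Notation Rm := (measurableTypeR R).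
Local Notation nu := (lebesgue_row n \x @lebesgue_measure R)%E.
Variable i : 'I_n.

Definition translate (s : R) (z : 'rV[R]_n * R) : 'rV[R]_n * R :=
  shift_space (s *: unit_row i) z.

Let e : 'rV[R]_n * R := (unit_row i, 0).

Lemma translateE s z : translate s z = s *: e + z.
Proof.
case: z => x t; rewrite /translate /shift_space /=.
by congr pair; [exact: addrC|rewrite /= scaler0 add0r].
Qed.

Lemma translateD a b z : translate a (translate b z) = translate (a + b) z.
Proof. by rewrite !translateE addrA scalerDl. Qed.

Lemma translate0 z : translate 0 z = z.
Proof. by rewrite translateE scale0r add0r. Qed.

Lemma measurable_translate :
  measurable_fun [set: Rm * ('rV[R]_n * Rm)] (fun p => translate p.1 p.2 : 'rV[R]_n * Rm).
Proof.
apply/measurable_fun_pairP; split; last first.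
  exact: measurableT_comp measurable_snd measurable_snd.
apply: measurable_rowP => j.
rewrite (_ : (fun _ => _) = fun p : Rm * ('rV[R]_n * Rm) =>
    (p.2.1 ord0 j + p.1 * unit_row i ord0 j)%R); last first.
  by apply/funext => p; rewrite /= !mxE.
apply: measurable_funD.
  apply: (@measurableT_comp _ _ _ _ _ _ (fun x : 'rV[R]_n => x ord0 j)).
    exact: measurable_coord.
  exact: measurableT_comp measurable_fst measurable_snd.
apply: measurable_funM => //; exact: measurable_fst.
Qed.

Lemma translate_preserving s (A : set ('rV[R]_n * Rm)) : measurable A ->
  nu (translate s @^-1` A) = nu A.
Proof. exact: spacetime_shift. Qed.

Lemma box_translate c r s t z a b : 0 < r -> `|a| <= b -> box c r s t z ->
  box c (r + b) s t (translate a z).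
Proof.
move=> r0 ab [/= cz tz]; split => //=; rewrite (addrC z.1).
apply: (@eball_le _ _ _ (r + `|a|)); first by rewrite lerD2l.
exact: eball_shift.
Qed.

Lemma derive_translate (phi : 'rV[R]_n * R -> R) a v z :
  'D_v (fun z => phi (translate a z)) z = 'D_v phi (translate a z).
Proof.
have E : (fun h : R => h^-1 *: (phi (translate a (h *: v + z)) - phi (translate a z))) =
    (fun h => h^-1 *: (phi (h *: v + translate a z) - phi (translate a z))).
  by apply/funext => h; rewrite !translateE addrCA.
by rewrite /derive E.
Qed.

Lemma C1_translate (phi : 'rV[R]_n * R -> R) a : C1 phi ->
  C1 (fun z => phi (translate a z)).
Proof.
move=> [dphi cphi].
have dt z : differentiable (translate a) z.
  rewrite (_ : translate a = cst (a *: e) + id); last first.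
    by apply/funext => y; rewrite translateE.
  exact: differentiableD.
split; first by move=> z; apply: differentiable_comp.
move=> v; rewrite (_ : 'D_v _ = 'D_v phi \o translate a).
  by move=> z; apply: continuous_comp; [exact: differentiable_continuous|exact: cphi].
by apply/funext => z; exact: derive_translate.
Qed.

Lemma line_continuous (phi : 'rV[R]_n * R -> R) z : C1 phi ->
  continuous (fun s : R => 'D_e phi (translate (- s) z)).
Proof.
move=> [_ cphi] s.
apply: (@continuous_comp _ _ _ (fun s : R => translate (- s) z) ('D_e phi)); last exact: cphi.
rewrite (_ : (fun s => _) = fun s => (- s) *: e + z); last first.
  by apply/funext => y; rewrite translateE.
apply: differentiable_continuous.
apply: (@differentiableD _ _ _ (fun s : R => (- s) *: e) (cst z)) => //.
by apply: (@differentiableZl _ _ _ (fun s : R => - s)); exact: differentiableN.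
Qed.

(** The fundamental theorem of calculus on the backward line through z; the primitive carries a
    minus sign because the parameter s runs against the direction of differentiation. *)
Lemma translate_FTC (phi : 'rV[R]_n * R -> R) h z : C1 phi -> 0 < h ->
  \int[lebesgue_measure]_(s in `[0, h]) 'D_e phi (translate (- s) z) =
  phi z - phi (translate (- h) z).
Proof.
move=> Cphi h0; have [dphi cphi] := Cphi.
pose chi (s : R) := - phi (translate (- s) z).
have chi' (s : R) : is_derive s 1 chi ('D_e phi (translate (- s) z)).
  have dN : is_derive (translate (- s) z) (- e) phi (- 'D_e phi (translate (- s) z)).
    apply: DeriveDef; first exact: diff_derivable.
    by rewrite !deriveE// linearN.
  have dchi : is_derive s 1 (fun s => phi (translate (- s) z))
      (- 'D_e phi (translate (- s) z)).
    have E : (fun k : R => k^-1 *: (phi (translate (- (k *: 1 + s)) z) - phi (translate (- s) z)))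
        = (fun k => k^-1 *: (phi (k *: (- e) + translate (- s) z) - phi (translate (- s) z))).
      apply/funext => k; rewrite !translateE [k *: 1]mulr1 opprD scalerDl.
      by rewrite -addrA scaleNr scalerN.
    have [d1 d2] := dN.
    by apply: DeriveDef; [rewrite /derivable E|rewrite /derive E].
  by rewrite -['D_e _ _]opprK; exact: is_deriveN.
have cD := line_continuous Cphi (z := z).
have cchi : continuous chi.
  by move=> s; apply: differentiable_continuous; apply/derivable1_diffP; case: (chi' s).
have := @continuous_FTC2 R (fun s => 'D_e phi (translate (- s) z)) chi 0 h h0.
rewrite /Rintegral => ->.
- by rewrite /= /chi oppr0 translate0 opprK addrC.
- exact: continuous_subspaceT.
- split.
  + by move=> s _; case: (chi' s).
  + by apply: cvg_at_right_filter; exact: cchi.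
  + by apply: cvg_at_left_filter; exact: cchi.
- by move=> s _; rewrite derive1E; case: (chi' s).
Qed.

End representation.

Section spacetime.
Context {R : realType} (n : nat).
Local Notation Rm := (measurableTypeR R).
Local Open Scope ereal_scope.

(* A name for the product measure, to which its sigma-finiteness is attached. *)
Definition spacetime : set ('rV[R]_n * Rm) -> \bar R :=
  (lebesgue_row n \x lebesgue_measure).

HB.instance Definition _ := Measure.on spacetime.

Let spacetime_sigma_finite : sigma_finite setT spacetime.
Proof.
have /sigma_finiteP[F [TF ndF Foo]] := sigma_finiteT (lebesgue_row n : {sigma_finite_measure set 'rV[R]_n -> \bar R}).
have /sigma_finiteP[G [TG ndG Goo]] := sigma_finiteT (@lebesgue_measure R).
exists (fun k => F k `*` G k).
  rewrite -setXTT TF TG predeqE => -[x y]; split.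
    move=> [/= [i _ Fix] [j _ Gjy]]; exists (maxn i j) => //; split.
    - by move: x Fix; exact/subsetPset/ndF/leq_maxl.
    - by move: y Gjy; exact/subsetPset/ndG/leq_maxr.
  by move=> [i _ []/= ? ?]; split; exists i.
move=> k; have [mF Fk] := Foo k; have [mG Gk] := Goo k; split.
  exact: measurableX.
by rewrite /spacetime product_measure1E// lte_mul_pinfty// ge0_fin_numE.
Qed.

HB.instance Definition _ := Measure_isSigmaFinite.Build _ _ _ spacetime
  spacetime_sigma_finite.

End spacetime.
Arguments spacetime {R} n _.

Section translate_flow.
Context {R : realType} {n : nat}.
Local Notation Rm := (measurableTypeR R).
Local Notation nu := (lebesgue_row n \x @lebesgue_measure R)%E.

Variable i : 'I_n.
Let tr (a : R) : 'rV[R]_n * Rm -> 'rV[R]_n * Rm := translate i a.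
Let tr_measurable : measurable_fun [set: Rm * ('rV[R]_n * Rm)] (fun p => tr p.1 p.2).
Proof. exact: measurable_translate. Qed.
Let tr_preserving a A : measurable A ->
  spacetime n (tr a @^-1` A) = spacetime n A.
Proof. exact: translate_preserving. Qed.
Let trD a b z : tr a (tr b z) = tr (a + b) z.
Proof. exact: translateD. Qed.

Lemma translate_tonelli (f : 'rV[R]_n * Rm -> \bar R) (D : set Rm) :
  measurable_fun setT f -> measurable D -> (forall z, 0 <= f z)%E ->
  (\int[nu]_z \int[lebesgue_measure]_(a in D) f (translate i a z) =
  lebesgue_measure D * \int[nu]_z f z)%E.
Proof. exact: (@flow_tonelli _ _ _ (spacetime n) tr). Qed.

Variable g : 'rV[R]_n * Rm -> R.
Hypothesis mg : measurable_fun setT g.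
Hypothesis ig : nu.-integrable setT (EFin \o g).

Lemma translate_ae_integrable a b :
  {ae nu, forall z, lebesgue_measure.-integrable `[a, b]
    (fun s => (g (translate i s z))%:E)}.
Proof. exact: (@flow_ae_integrable _ _ _ (spacetime n) tr). Qed.

Lemma translate_Rintegral_integrable a b : nu.-integrable setT
  (fun z => (\int[lebesgue_measure]_(s in `[a, b]) g (translate i s z))%:E).
Proof. exact: (@flow_Rintegral_integrable _ _ _ (spacetime n) tr). Qed.

Lemma translate_average_cvg : {ae nu, forall z,
  p.+1%:R * \int[lebesgue_measure]_(s in `[0, p.+1%:R^-1]) g (translate i s z)
    @[p --> \oo] --> g z}.
Proof. exact: (@flow_average_cvg _ _ _ (spacetime n) tr). Qed.

End translate_flow.

Section weak_derivative_translate.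
Context {R : realType} {n : nat}.
Local Notation Rm := (measurableTypeR R).
Local Notation nu := (lebesgue_row n \x @lebesgue_measure R)%E.
Variables (i : 'I_n) (f g : 'rV[R]_n * R -> R) (K : R).
Hypothesis mf : measurable_fun [set: 'rV[R]_n * Rm] f.
Hypothesis mg : measurable_fun [set: 'rV[R]_n * Rm] g.
Hypothesis fK : forall z, `|f z| <= K.
Hypothesis ig : nu.-integrable [set: 'rV[R]_n * Rm] (EFin \o g).
Variables (c : 'rV[R]_n) (r s t h : R).
Hypotheses (r0 : 0 < r) (st : s < t) (h0 : 0 < h).
Let e : 'rV[R]_n * R := (unit_row i, 0).
Hypothesis weak : forall phi, C1 phi ->
  (forall z, phi z != 0 -> box c (r + h) s t z) ->
  \int[nu]_z (f z * 'D_e phi z) = - \int[nu]_z (g z * phi z).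

Let translate := @translate R n i.

Let mtr (a : R) : measurable_fun setT (translate a : 'rV[R]_n * Rm -> 'rV[R]_n * Rm).
Proof. exact: measurable_shift_space. Qed.

Let trK a z : translate a (translate (- a) z) = z.
Proof. by rewrite /translate translateD subrr translate0. Qed.

Let trNK a z : translate (- a) (translate a z) = z.
Proof. by rewrite /translate translateD addNr translate0. Qed.

Let tr_mp a (A : set ('rV[R]_n * Rm)) : measurable A ->
  nu (translate a @^-1` A) = nu A.
Proof. exact: translate_preserving. Qed.

Let tr_integral a (F : 'rV[R]_n * Rm -> \bar R) : measurable_fun setT F ->
  (\int[nu]_z F (translate a z) = \int[nu]_z F z)%E.
Proof.
move=> mF; exact: (integral_preserving (mtr a) (@translate_preserving R n i a) mF).
Qed.

Let w z := \int[lebesgue_measure]_(a in `[0, h]) g (translate a z).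

Let iw : nu.-integrable [set: 'rV[R]_n * Rm] (EFin \o w).
Proof.
exact: translate_Rintegral_integrable.
Qed.

Let ae_ig : {ae nu, forall z, lebesgue_measure.-integrable `[0, h]
    (fun a => (g (translate a z))%:E)}.
Proof.
exact: translate_ae_integrable.
Qed.

Section test.
Variable phi : 'rV[R]_n * R -> R.
Hypothesis Cphi : C1 phi.
Hypothesis sphi : forall z, phi z != 0 -> box c r s t z.
Hypothesis phi01 : forall z, 0 <= phi z <= 1.

Let mphi : measurable_fun [set: 'rV[R]_n * Rm] phi.
Proof. by apply: continuous_measurable_spacetime; exact: C1_continuous. Qed.

Let phi_le1 z : `|phi z| <= 1.
Proof. by have /andP[p0 p1] := phi01 z; rewrite ger0_norm. Qed.

Let mDphi : measurable_fun [set: 'rV[R]_n * Rm] ('D_e phi).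
Proof. by apply: continuous_measurable_spacetime; have [_] := Cphi; exact. Qed.

Let if_phi : nu.-integrable setT (fun z : 'rV[R]_n * Rm => (f z * phi z)%:E).
Proof.
have := @bounded_support_integrable _ _ R _ (fun z : 'rV[R]_n * Rm => f z * phi z) K (box c r s t).
apply.
- exact: measurable_funM.
- exact: measurable_box.
- exact: box_fin.
- move=> z; rewrite normrM; have [pz|/sphi bz] := eqVneq (phi z) 0.
    by rewrite pz normr0 mulr0 mulr_ge0// (le_trans _ (fK z)).
  by rewrite indicE mem_set// mulr1 (le_trans _ (fK z))// ler_piMr.
Qed.

Let if_phi_tr a : nu.-integrable setT
  (fun z : 'rV[R]_n * Rm => (f z * phi (translate a z))%:E).
Proof.
have := @bounded_support_integrable _ _ R _ (fun z : 'rV[R]_n * Rm => f z * phi (translate a z)) K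
  (translate a @^-1` box c r s t).
apply.
- apply: measurable_funM => //.
  exact: measurableT_comp mphi (mtr a).
- by rewrite -[X in measurable X]setTI; apply: mtr => //; exact: measurable_box.
- by have := box_fin c r s t; rewrite -(tr_mp a (@measurable_box R n c r s t)).
- move=> z; rewrite normrM; have [pz|/sphi bz] := eqVneq (phi (translate a z)) 0.
    by rewrite pz normr0 mulr0 mulr_ge0// (le_trans _ (fK z)).
  by rewrite indicE mem_set// mulr1 (le_trans _ (fK z))// ler_piMr.
Qed.

Let Dbound : exists2 C, 0 <= C & forall z, `|'D_e phi z| <= C * (\1_(cbox c r s t) z).
Proof.
have [C CP] := C1_supported_bound e Cphi sphi.
by exists `|C| => // z; rewrite (le_trans (CP z))// ler_wpM2r// ler_norm.
Qed.

Let if_Dphi a : nu.-integrable setT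
  (fun z : 'rV[R]_n * Rm => (f z * 'D_e phi (translate a z))%:E).
Proof.
have [C C0 CP] := Dbound.
have := @bounded_support_integrable _ _ R _ (fun z : 'rV[R]_n * Rm => f z * 'D_e phi (translate a z)) (K * C)
  (translate a @^-1` cbox c r s t).
apply.
- apply: measurable_funM => //.
  exact: measurableT_comp mDphi (mtr a).
- by rewrite -[X in measurable X]setTI; apply: mtr => //; exact: measurable_cbox.
- by have := @cbox_fin R n c r s t (ltW r0); rewrite -(tr_mp a (@measurable_cbox R n c r s t)).
- by move=> z; rewrite normrM -mulrA ler_pM.
Qed.

Let ig_phi a b : nu.-integrable setT
  (fun z : 'rV[R]_n * Rm => (g (translate a z) * phi (translate b z))%:E).
Proof.
have iga : nu.-integrable setT (fun z : 'rV[R]_n * Rm => (g (translate a z))%:E).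
  apply/integrableP; split.
    by apply/measurable_EFinP; exact: measurableT_comp mg (mtr a).
  rewrite (tr_integral a (F := fun z => `|(g z)%:E|%E)).
    by case/integrableP: ig.
  by apply: measurableT_comp => //; exact/measurable_EFinP.
apply: le_integrable iga => //.
  apply/measurable_EFinP; apply: measurable_funM.
    exact: measurableT_comp mg (mtr a).
  exact: measurableT_comp mphi (mtr b).
by move=> z _ /=; rewrite lee_fin normrM ler_piMr.
Qed.

(** The weak identity is applied to the test function translated by [a], still supported in the
    cylinder of radius r + h; translating back moves the shift onto [g]. *)
Let slice a : a \in `[0, h] ->
  (\int[nu]_z (f z * 'D_e phi (translate (- a) z))%:E =
   \int[nu]_z (- g (translate a z) * phi z)%:E)%E.
Proof.
rewrite in_itv/= => /andP[a0 ah].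
have sphia z : phi (translate (- a) z) != 0 -> box c (r + h) s t z.
  move=> /sphi bz; rewrite -(trK a z).
  by apply: box_translate => //; rewrite ger0_norm.
have ig0 : nu.-integrable setT
    (fun z : 'rV[R]_n * Rm => (g z * phi (translate (- a) z))%:E).
  have := ig_phi 0 (- a); under eq_fun do rewrite {1}/translate translate0.
  by [].
have igN : nu.-integrable setT
    (fun z : 'rV[R]_n * Rm => (- g z * phi (translate (- a) z))%:E).
  by under eq_fun do rewrite mulNr EFinN; exact: integrableN.
have H : \int[nu]_z (f z * 'D_e phi (translate (- a) z)) =
    \int[nu]_z (- g z * phi (translate (- a) z)).
  transitivity (- \int[nu]_z (g z * phi (translate (- a) z))).
    rewrite -(weak (C1_translate i (- a) Cphi) sphia).
    by apply: eq_Rintegral => z _; rewrite derive_translate.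
  rewrite -mulN1r -RintegralZl//.
  by apply: eq_Rintegral => z _; rewrite mulN1r mulNr.
rewrite -(EFin_Rintegral measurableT (if_Dphi (- a))) H.
rewrite (EFin_Rintegral measurableT igN).
rewrite -(tr_integral a (F := fun z => (- g z * phi (translate (- a) z))%:E)).
  by apply: eq_integral => z _; rewrite trNK.
exact: measurable_int igN.
Qed.

Let iwphi : nu.-integrable setT (fun z : 'rV[R]_n * Rm => (w z * phi z)%:E).
Proof.
apply: le_integrable iw => //.
  apply/measurable_EFinP; apply: measurable_funM => //.
  by apply/measurable_EFinP; exact: measurable_int iw.
by move=> z _ /=; rewrite lee_fin normrM ler_piMr.
Qed.

Let mtr2N : measurable_fun setT
  (fun p : Rm * ('rV[R]_n * Rm) => translate (- p.1) p.2 : 'rV[R]_n * Rm).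
Proof.
have mN : measurable_fun setT
    (fun p : Rm * ('rV[R]_n * Rm) => (- p.1 : Rm, p.2 : 'rV[R]_n * Rm)).
  apply: measurable_fun_pair; last exact: measurable_snd.
  apply: (@measurableT_comp _ _ _ _ _ _ (fun x : Rm => - x : Rm)).
    exact: oppr_measurable.
  exact: measurable_fst.
exact: (measurableT_comp (@measurable_translate R n i) mN).
Qed.

Let segment_fin : (lebesgue_measure (`[0%R, h]%classic : set R) < +oo)%E.
Proof. by rewrite lebesgue_measure_itv/= lte_fin h0 -EFinB ltry. Qed.

Let int_norm_fin (F : 'rV[R]_n * Rm -> \bar R) : nu.-integrable setT F ->
  (\int[nu]_z `|F z| <= (fine (\int[nu]_z `|F z|))%:E)%E.
Proof.
move=> /integrableP[_ Foo]; rewrite fineK// ge0_fin_numE//.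
exact: integral_ge0.
Qed.

Let tr_cbox a := translate a @^-1` cbox c r s t.

Let m_tr_cbox a : measurable (tr_cbox a : set ('rV[R]_n * Rm)).
Proof.
by rewrite -[X in measurable X]setTI; apply: mtr => //; exact: measurable_cbox.
Qed.

Let mu_tr_cbox a : nu (tr_cbox a) = nu (cbox c r s t).
Proof. by apply: tr_mp; exact: measurable_cbox. Qed.

Let mi_tr_cbox a :
  measurable_fun setT (EFin \o \1_(tr_cbox a) : 'rV[R]_n * Rm -> \bar R).
Proof. by apply/measurable_EFinP; apply: measurable_indic; exact: m_tr_cbox. Qed.

(** The bound is the supremum of |f| times that of the derivative times the volume of the support;
    translation invariance makes it independent of [a], as Fubini requires. *)
Let f_slice_bound : exists M : R, forall a,
  (\int[nu]_z `|f z * 'D_e phi (translate (- a) z)|%:E <= M%:E)%E.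
Proof.
have [C C0 CP] := Dbound; exists (K * C * fine (nu (cbox c r s t))) => a.
have KC : 0 <= K * C by rewrite mulr_ge0// (le_trans _ (fK point)).
apply: (@le_trans _ _ (\int[nu]_z ((K * C)%:E * (\1_(tr_cbox (- a)) z)%:E))%E).
  apply: ge0_le_integral => //.
  + apply/measurable_EFinP; apply: measurableT_comp => //.
    by apply/measurable_EFinP; exact: measurable_int (if_Dphi (- a)).
  + by apply: measurable_funeM; exact: mi_tr_cbox.
  + by move=> z _; rewrite -EFinM lee_fin normrM -mulrA ler_pM.
rewrite ge0_integralZl_EFin//; last exact: mi_tr_cbox.
rewrite (integral_indic _ measurableT (m_tr_cbox (- a))).
have nufin : nu (cbox c r s t) \is a fin_num.
  by rewrite ge0_fin_numE; [exact: (cbox_fin _ _ _ (ltW r0))|exact: measure_ge0].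
by rewrite setIT [X in (_ * X <= _)%E]mu_tr_cbox -(fineK nufin) -EFinM.
Qed.

Let swapf :
  (\int[nu]_z \int[lebesgue_measure]_(a in `[0%R, h]) (f z * 'D_e phi (translate (- a) z))%:E =
   \int[lebesgue_measure]_(a in `[0%R, h]) \int[nu]_z (f z * 'D_e phi (translate (- a) z))%:E)%E.
Proof.
have [M MP] := f_slice_bound.
have mA : measurable_fun [set: Rm * ('rV[R]_n * Rm)]
    (fun p => f p.2 * 'D_e phi (translate (- p.1) p.2)).
  apply: measurable_funM.
    exact: measurableT_comp mf measurable_snd.
  exact: measurableT_comp mDphi mtr2N.
apply/esym.
exact: (@Fubini_restrict _ _ Rm ('rV[R]_n * Rm)%type R (@lebesgue_measure R) (spacetime n) `[0%R, h]
  (measurable_itv _) _ mA M segment_fin (fun a _ => MP a)).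
Qed.

Let g_slice_bound a :
  (\int[nu]_z `|- g (translate a z) * phi z|%:E <= (fine (\int[nu]_z `|(g z)%:E|))%:E)%E.
Proof.
apply: le_trans (int_norm_fin ig) => /=.
have mg1 : measurable_fun setT (fun z : 'rV[R]_n * Rm => `|(g z)%:E|%E).
  by apply: measurableT_comp => //; exact/measurable_EFinP.
have mga : measurable_fun setT (fun z : 'rV[R]_n * Rm => g (translate a z)).
  exact: measurableT_comp mg (mtr a).
rewrite -(tr_integral a mg1).
apply: ge0_le_integral => //.
+ apply/measurable_EFinP; apply: measurableT_comp => //.
  by apply: measurable_funM => //; exact: measurable_funN.
+ by apply/measurable_EFinP; exact: measurableT_comp.
+ by move=> z _; rewrite lee_fin normrM normrN ler_piMr.
Qed.

Let swapg :
  (\int[lebesgue_measure]_(a in `[0%R, h]) \int[nu]_z (- g (translate a z) * phi z)%:E =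
   \int[nu]_z \int[lebesgue_measure]_(a in `[0%R, h]) (- g (translate a z) * phi z)%:E)%E.
Proof.
have mA : measurable_fun [set: Rm * ('rV[R]_n * Rm)]
    (fun p => - g (translate p.1 p.2) * phi p.2).
  apply: measurable_funM.
    apply: measurable_funN.
    exact: measurableT_comp mg (@measurable_translate R n i).
  exact: measurableT_comp mphi measurable_snd.
exact: (@Fubini_restrict _ _ Rm ('rV[R]_n * Rm)%type R (@lebesgue_measure R) (spacetime n) `[0%R, h]
  (measurable_itv _) _ mA _ segment_fin (fun a _ => g_slice_bound a)).
Qed.

(** The shift of [f] by h is moved onto the test function, whose increment is the integral of its
    derivative along the line. Fubini and the weak identity, used for each a in [0, h], turn this
    into the integral of the translates of [g]. *)
Lemma weak_derivative_translate_test : (\int[nu]_z ((f (translate h z) - f z - w z) * phi z)%:E = 0)%E.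
Proof.
have E1 : (\int[nu]_z (f z * (phi z - phi (translate (- h) z)))%:E =
    \int[nu]_z (- (w z * phi z))%:E)%E.
  transitivity (\int[nu]_z \int[lebesgue_measure]_(a in `[0%R, h])
      (f z * 'D_e phi (translate (- a) z))%:E)%E.
    apply: eq_integral => z _; rewrite -translate_FTC//.
    have ic : lebesgue_measure.-integrable `[0, h]
        (EFin \o (fun a => 'D_e phi (translate (- a) z))).
      apply: continuous_compact_integrable; first exact: segment_compact.
      by apply: continuous_subspaceT; exact: line_continuous.
    rewrite -RintegralZl// EFin_Rintegral//.
    have : lebesgue_measure.-integrable `[0, h]
        (fun a => (f z)%:E * ('D_e phi (translate (- a) z))%:E)%E.
      exact: integrableZl.
    by apply: eq_integrable => // a _; rewrite /= EFinM.
  rewrite swapf.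
  transitivity (\int[lebesgue_measure]_(a in `[0%R, h])
      (\int[nu]_z (- g (translate a z) * phi z)%:E))%E.
    by apply: eq_integral => a ah; apply: slice; move: ah; rewrite inE.
  rewrite swapg; apply: integral_ae_congr.
  apply: ae_imply ae_ig => z igz _.
  rewrite -mulrN -RintegralZr// EFin_Rintegral//.
    by apply: eq_integral => a _; rewrite mulrN mulNr.
  have : lebesgue_measure.-integrable `[0, h]
      (fun a => (g (translate a z))%:E * (- phi z)%:E)%E.
    exact: integrableZr.
  by apply: eq_integrable => // a _; rewrite /= EFinM.
have E2 : (\int[nu]_z (f (translate h z) * phi z)%:E =
    \int[nu]_z (f z * phi (translate (- h) z))%:E)%E.
  rewrite -(tr_integral h (F := fun z => (f z * phi (translate (- h) z))%:E)).
    by apply: eq_integral => z _; rewrite trNK.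
  apply/measurable_EFinP; apply: measurable_funM => //.
  exact: measurableT_comp mphi (mtr (- h)).
have i1 : nu.-integrable setT
    (fun z : 'rV[R]_n * Rm => (f (translate h z) * phi z)%:E).
  have := @bounded_support_integrable _ _ R _
    (fun z : 'rV[R]_n * Rm => f (translate h z) * phi z) K (box c r s t).
  apply.
  - by apply: measurable_funM => //; exact: measurableT_comp mf (mtr h).
  - exact: measurable_box.
  - exact: box_fin.
  - move=> z; rewrite normrM; have [pz|/sphi bz] := eqVneq (phi z) 0.
      by rewrite pz normr0 mulr0 mulr_ge0// (le_trans _ (fK z)).
    by rewrite indicE mem_set// mulr1 (le_trans _ (fK (translate h z)))// ler_piMr.
have i2 := if_phi_tr (- h).
have E1' : \int[nu]_z (f z * phi z) - \int[nu]_z (f z * phi (translate (- h) z)) =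
    - \int[nu]_z (w z * phi z).
  rewrite -RintegralB// -[RHS]mulN1r -RintegralZl//; congr fine.
  under eq_integral do rewrite -mulrBr.
  by rewrite E1; apply: eq_integral => z _; rewrite mulN1r.
have E2' : \int[nu]_z (f (translate h z) * phi z) =
  \int[nu]_z (f z * phi (translate (- h) z)) by congr fine.
have i12 : nu.-integrable setT
    (fun z : 'rV[R]_n * Rm => (f (translate h z) * phi z - f z * phi z)%:E).
  by under eq_fun do rewrite EFinB; exact: integrableB.
have i123 : nu.-integrable setT (fun z : 'rV[R]_n * Rm =>
    ((f (translate h z) - f z - w z) * phi z)%:E).
  by under eq_fun do rewrite !mulrBl EFinB; exact: integrableB.
have E3 : \int[nu]_z ((f (translate h z) - f z - w z) * phi z) = 0.
  under eq_Rintegral do rewrite !mulrBl.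
  rewrite RintegralB//.
  rewrite RintegralB// E2'.
  by rewrite -[X in X - _]opprB E1' opprK subrr.
by rewrite -EFin_Rintegral// E3.
Qed.

End test.

(** The difference of the two sides integrates to zero against every test function with values in
    [0, 1], so the fundamental lemma applies. *)
Theorem weak_derivative_translate : {ae nu, forall z, box c r s t z ->
  f (translate h z) - f z = \int[lebesgue_measure]_(a in `[0, h]) g (translate a z)}.
Proof.
pose k z := f (translate h z) - f z - w z.
have mk : measurable_fun [set: 'rV[R]_n * Rm] k.
  apply: measurable_funB.
    by apply: measurable_funB => //; exact: measurableT_comp mf (mtr h).
  by apply/measurable_EFinP; exact: measurable_int iw.
have ik : nu.-integrable (box c r s t) (EFin \o k).
  have -> : EFin \o k = (fun z : 'rV[R]_n * Rm => (f (translate h z) - f z)%:E - (w z)%:E)%E by [].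
  apply: integrableB; first exact: measurable_box.
    apply: measurable_bounded_integrable.
    - exact: measurable_box.
    - exact: box_fin.
    - apply: measurable_funTS; apply: measurable_funB => //.
      exact: measurableT_comp mf (mtr h).
    - exists (K + K); split => [|M KM z _ /=]; first exact: num_real.
      apply: le_trans (ltW KM); rewrite (le_trans (ler_normB _ _))//.
      by rewrite lerD.
  by apply: integrableS iw => //; exact: measurable_box.
have : {ae nu, forall z, box c r s t z -> k z = 0}.
  apply: fundamental_lemma => // phi Cphi sphi phi01.
  have := weak_derivative_translate_test Cphi sphi phi01; rewrite -[RHS]/0%E => <-.
  rewrite integral_mkcond; apply: eq_integral => z _; rewrite patchE.
  case: ifPn => // /negP nz; have [->|/sphi bz] := eqVneq (phi z) 0.
    by rewrite mulr0.
  by exfalso; apply: nz; exact/mem_set.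
by apply: ae_imply => z kz /kz /eqP; rewrite subr_eq0 => /eqP.
Qed.
End weak_derivative_translate.

(** * The nonlinearities *)

Section fatou_bound.
Local Open Scope ereal_scope.
Context d (T : measurableType d) (R : realType).
Variable mu : {measure set T -> \bar R}.

Lemma limn_einf_le (u : (\bar R)^nat) (c : R^nat) (l : R) :
  (forall n, u n <= (c n)%:E) -> c @ \oo --> l -> limn_einf u <= l%:E.
Proof.
move=> uc cl; apply/lee_addgt0Pr => e e0; rewrite limn_einf_lim.
apply: lime_le; first exact: is_cvg_einfs.
apply: nearW => n.
have /cvgrPdist_le/(_ e e0)[m _ mP] := cl.
apply: (@le_trans _ _ (u (maxn n m))).
  by apply: ereal_inf_lbound; exists (maxn n m) => //=; exact: leq_maxl.
apply: le_trans (uc _) _; rewrite -EFinD lee_fin.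
have := mP (maxn n m) (leq_maxr _ _); rewrite distrC => H.
by rewrite -lerBlDl (le_trans (ler_norm _)).
Qed.

Lemma fatou_le (D : set T) (f_ : (T -> R)^nat) (f : T -> R) (c : R^nat) (l : R) :
  measurable D -> (forall n, measurable_fun D (f_ n)) ->
  (forall n x, D x -> (0 <= f_ n x)%R) ->
  (forall x, D x -> f_ ^~ x @ \oo --> f x) ->
  (forall n, \int[mu]_(x in D) (f_ n x)%:E <= (c n)%:E) -> c @ \oo --> l ->
  \int[mu]_(x in D) (f x)%:E <= l%:E.
Proof.
move=> mD mf f0 ff fc cl.
have := @fatou _ _ _ mu D mD (fun n x => (f_ n x)%:E).
have -> : \int[mu]_(x in D) limn_einf (fun n => (f_ n x)%:E) =
    \int[mu]_(x in D) (f x)%:E.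
  apply: eq_integral => x /set_mem Dx.
  have cx : (f_ n x)%:E @[n --> \oo] --> (f x)%:E.
    by apply: cvg_EFin; [exact: nearW|exact: ff].
  by rewrite is_cvg_limn_einfE; [apply/cvg_lim|apply/cvg_ex; exists (f x)%:E].
move=> H; apply: le_trans (H _ _) _.
- by move=> n; exact/measurable_EFinP.
- by move=> n x Dx; rewrite lee_fin f0.
- exact: limn_einf_le fc cl.
Qed.

End fatou_bound.

Lemma lebesgue_measure_oc_fin (R : realType) (a b : R) :
  (lebesgue_measure (`]a, b]%classic : set R) < +oo)%E.
Proof.
by rewrite lebesgue_measure_itv/=; case: ifPn => // _; rewrite -EFinB ltry.
Qed.

Lemma integrable_cst_fin d (T : measurableType d) (R : realType)
    (mu : {measure set T -> \bar R}) (D : set T) (k : R) : measurable D ->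
  (mu D < +oo)%E -> mu.-integrable D (fun=> k%:E).
Proof.
move=> mD Doo; apply/integrableP; split; first exact: measurable_cst.
by rewrite integral_cst// lte_mul_pinfty.
Qed.

Lemma ndecr_measurable (R : realType) (f : R -> R) (D : set R) :
  is_interval D -> (forall x y, D x -> D y -> x <= y -> f x <= f y) ->
  measurable_fun D f.
Proof.
move=> iD fD; apply: (measurability _ (RGenOInfty.measurableE R)).
move=> _ [_ [a ->] <-]; apply: is_interval_measurable.
move=> x y [Dx /= fx] [Dy _] z /andP[xz zy].
have Dz : D z by apply: (iD x y) => //; rewrite xz zy.
split => //=; move: fx; rewrite !in_itv/= !andbT => /lt_le_trans; apply.
exact: fD.
Qed.

(** Expand (sqrt y - c)^2 >= 0. The free weight c is optimised when G is estimated by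
    Cauchy-Schwarz. *)
Lemma sqrt_le_amgm (R : realType) (y c : R) : 0 <= y -> 0 < c ->
  Num.sqrt y <= (c + y / c) / 2.
Proof.
move=> y0 c0; rewrite -[in leRHS](sqr_sqrtr y0); set q := Num.sqrt y.
rewrite ler_pdivlMr// -(ler_pM2r c0) mulrDl divfK ?gt_eqF//.
have := sqr_ge0 (q - c); rewrite sqrrB !expr2; lra.
Qed.

Section nonlinearity.
Context {R : realType}.
Local Notation mu := (@lebesgue_measure R).
Variables (h P : R -> R) (M : R).
Hypothesis hP : nonlinearities h P.
Local Notation F := (F_of h P).
Local Notation dG := (dG_of h P).
Local Notation G := (G_of h P).
Local Notation H := (H_of h).

Lemma F_of_gt0 s : 0 < s -> 0 < F s.
Proof.
move=> s0; rewrite mulr_gt0//; first exact: h_gt0 hP _ s0.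
by have [c3 /(_ s s0) /andP[]] := P_bounds hP.
Qed.

Lemma F_of_ge0 s : 0 <= s -> 0 <= F s.
Proof.
rewrite le_eqVlt => /predU1P[<-|/F_of_gt0/ltW//].
by rewrite (F_at0 hP).
Qed.

Lemma F_of_continuous s : 0 < s -> {for s, continuous F}.
Proof.
move=> s0; apply: differentiable_continuous; apply/derivable1_diffP.
exact: F_derivable hP _ s0.
Qed.

Lemma F_of_le a b : 0 < a -> a <= b -> F a <= F b.
Proof.
move=> a0 ab; have xgt0 x : x \in `]a, b[ -> 0 < x.
  by rewrite in_itv/= => /andP[ax _]; exact: lt_trans ax.
apply: (@ger0_derive1_ndecr R F a b) => //.
- by move=> x /xgt0; exact: F_derivable hP _.
- by move=> x /xgt0 x0; apply: ltW; exact: F_derivative_gt0 hP _ x0.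
- apply: derivable_within_continuous => x; rewrite in_itv/= => /andP[ax _].
  exact: F_derivable hP _ (lt_le_trans a0 ax).
Qed.

Lemma F_of_ndecr a b : 0 <= a -> a <= b -> F a <= F b.
Proof.
rewrite le_eqVlt => /predU1P[<-|]; last exact: F_of_le.
by move=> b0; rewrite (F_at0 hP) F_of_ge0.
Qed.

Lemma measurable_F_shift (c : R) : 0 <= c ->
  measurable_fun (`]0, +oo[ : set R) (fun x => F (x + c)).
Proof.
move=> c0; apply: open_continuous_measurable_fun; first exact: interval_open.
move=> x; rewrite inE/= in_itv/= andbT => x0.
apply: (@continuous_comp _ _ _ (fun x => x + c) F).
  by apply: cvgD; [exact: cvg_id|exact: cvg_cst].
by apply: F_of_continuous; rewrite ltr_pwDl.
Qed.

Let quot n x : R := n.+1%:R * (F (x + n.+1%:R^-1) - F x).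

Let quot_cvg x : 0 < x -> quot n x @[n --> \oo] --> derive1 F x.
Proof.
move=> x0; have dF : derivable F x 1 by exact: F_derivable hP _ x0.
have dcv : (fun k => k^-1 *: (F (k *: 1 + x) - F x)) @ (0 : R)^' --> derive1 F x.
  by rewrite derive1E; exact: dF.
have := (cvgr_dnbhsP _ _ _).1 dcv (fun n => n.+1%:R^-1) _.
have -> : (fun n => (n.+1%:R^-1)^-1 *: (F (n.+1%:R^-1 *: 1 + x) - F x)) = quot^~ x.
  by apply/funext => n; rewrite /quot invrK [_ *: 1]mulr1 (addrC x).
apply; split; first by move=> n; rewrite invr_eq0 pnatr_eq0.
exact: cvg_harmonic.
Qed.

Let measurable_quot n : measurable_fun (`]0, +oo[ : set R) (quot n).
Proof.
apply: measurable_funM => //; apply: measurable_funB.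
  by apply: measurable_F_shift; rewrite invr_ge0.
have := @measurable_F_shift 0 (lexx 0).
by rewrite (_ : (fun x => F (x + 0)) = F)//; apply/funext => x; rewrite addr0.
Qed.

(** No continuity of F' is assumed; it is measurable as the pointwise limit of difference
    quotients. *)
Lemma measurable_dF : measurable_fun (`]0, +oo[ : set R) (derive1 F).
Proof.
apply: measurable_fun_cvg; first exact: measurable_quot.
by move=> x /=; rewrite in_itv/= andbT; exact: quot_cvg.
Qed.

Let itv0y s : `]0, s] `<=` (`]0, +oo[ : set R).
Proof. by apply: subset_itvl; rewrite bnd_simp. Qed.

Let F_integrable s c : 0 <= s -> 0 <= c ->
  mu.-integrable `]0, s] (EFin \o (fun x => F (x + c))).
Proof.
move=> s0 c0; apply: measurable_bounded_integrable => //.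
- exact: lebesgue_measure_oc_fin.
- exact: measurable_funS (@itv0y s) (measurable_F_shift c0).
- exists (F (s + c)); split; first exact: num_real.
  move=> K FK x /=; rewrite in_itv/= => /andP[x0 xs].
  have xc0 : 0 < x + c by rewrite ltr_pwDl.
  rewrite ger0_norm; last exact/F_of_ge0/ltW.
  by apply: le_trans (ltW FK); apply: F_of_le => //; rewrite lerD2r.
Qed.

(** The integral of the difference quotient telescopes: with e = 1/(n+1) it is the mean of F over
    ]s, s + e] minus its mean over ]0, e]. Monotonicity bounds the former by F(s + e), and the
    latter is nonnegative. *)
Let quot_integral s n : 0 < s ->
  (\int[mu]_(x in `]0%R, s]) (quot n x)%:E <= (F (s + n.+1%:R^-1))%:E)%E.
Proof.
move=> s0; set e := n.+1%:R^-1 : R; have e0 : 0 < e by rewrite invr_gt0.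
have F0E : (fun x => F (x + 0)) = F by apply/funext => x; rewrite addr0.
have i0 t : 0 <= t -> mu.-integrable `]0, t] (EFin \o F).
  by move=> t0; have := F_integrable t0 (lexx 0); rewrite F0E.
have ie := F_integrable (ltW s0) (ltW e0).
have se : 0 <= s + e by rewrite addr_ge0// ltW.
have shift : \int[mu]_(x in `]0, s]) F (x + e) = \int[mu]_(x in `]e, s + e]) F x.
  have mFe : measurable_fun (`]0 + e, s + e]%classic : set R) F.
    have := measurable_F_shift (lexx 0); rewrite F0E; apply: measurable_funS => //.
    by apply: subset_trans (@itv0y (s + e)); apply: subset_itvr; rewrite bnd_simp add0r ltW.
  by have := Rintegral_shift_itv mFe; rewrite add0r.
have split1 : \int[mu]_(x in `]0, s + e]) F x - \int[mu]_(x in `]0, e]) F x =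
    \int[mu]_(x in `]e, s + e]) F x.
  by apply: Rintegral_itvB; [exact: i0|rewrite bnd_simp ltW|rewrite bnd_simp lerDr ltW].
have split2 : \int[mu]_(x in `]0, s + e]) F x - \int[mu]_(x in `]0, s]) F x =
    \int[mu]_(x in `]s, s + e]) F x.
  by apply: Rintegral_itvB; [exact: i0|rewrite bnd_simp ltW|rewrite bnd_simp lerDl ltW].
have pos : 0 <= \int[mu]_(x in `]0, e]) F x.
  apply: Rintegral_ge0 => x /=; rewrite in_itv/= => /andP[x0 _].
  by rewrite F_of_ge0// ltW.
have top : \int[mu]_(x in `]s, s + e]) F x <= e * F (s + e).
  have iS : mu.-integrable `]s, s + e] (EFin \o F).
    apply: integrableS (i0 _ se) => //.
    by apply: subset_itvr; rewrite bnd_simp ltW.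
  apply: (@le_trans _ _ (\int[mu]_(x in `]s, s + e]) F (s + e))).
    apply: le_Rintegral => //.
      by apply: integrable_cst_fin => //; exact: lebesgue_measure_oc_fin.
    move=> x /=; rewrite in_itv/= => /andP[sx xe].
    by apply: F_of_le => //; exact: lt_trans sx.
  rewrite Rintegral_cst//= lebesgue_measure_itv/= lte_fin ltrDl e0 -EFinB/=.
  by rewrite mulrC (_ : s + e - s = e)//; ring.
have iq : mu.-integrable `]0, s] (fun x => (F (x + e) - F x)%:E).
  rewrite (_ : (fun _ => _) =
    (EFin \o (fun x => F (x + e))) \- (EFin \o F))%E//.
  by apply: integrableB => //; exact: i0 (ltW s0).
have iqn : mu.-integrable `]0, s] (EFin \o quot n).
  rewrite (_ : (EFin \o _) = (fun x => n.+1%:R%:E * (F (x + e) - F x)%:E)%E)//.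
  exact: integrableZl.
rewrite -EFin_Rintegral//.
rewrite lee_fin /quot RintegralZl// RintegralB//; last exact: i0 (ltW s0).
rewrite shift -split1; have -> : n.+1%:R = e^-1 by rewrite invrK.
rewrite ler_pdivrMl// addrAC split2 lerBlDr (le_trans top)// lerDl.
exact: pos.
Qed.

(** Fatou's lemma on the nonnegative difference quotients. One inequality suffices for what follows,
    and it demands no bound on F' near 0. *)
Lemma integral_dF s : 0 < s ->
  (\int[mu]_(x in `]0%R, s]) (derive1 F x)%:E <= (F s)%:E)%E.
Proof.
move=> s0.
apply: (@fatou_le _ _ R mu `]0%R, s]%classic quot (derive1 F) (fun n => F (s + n.+1%:R^-1))) => //.
- by move=> n; exact: measurable_funS (@itv0y s) (measurable_quot n).
- move=> n x /=; rewrite in_itv/= => /andP[x0 _].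
  by rewrite mulr_ge0// subr_ge0 F_of_le// lerDl.
- by move=> x /=; rewrite in_itv/= => /andP[x0 _]; exact: quot_cvg.
- by move=> n; exact: quot_integral.
- have h0 : s + n.+1%:R^-1 @[n --> \oo] --> s.
    rewrite -[X in _ --> X]addr0; apply: cvgD; first exact: cvg_cst.
    exact: cvg_harmonic.
  exact: (continuous_cvg _ (F_of_continuous s0) h0).
Qed.

Let dF_integrable s : 0 < s -> mu.-integrable `]0, s] (EFin \o derive1 F).
Proof.
move=> s0; apply/integrableP; split.
  by apply/measurable_EFinP; exact: measurable_funS (@itv0y s) measurable_dF.
apply: le_lt_trans (ltry (F s)); apply: le_trans (integral_dF s0).
rewrite le_eqVlt; apply/orP; left; apply/eqP; apply: eq_integral => x.
rewrite inE/= in_itv/= => /andP[x0 _].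
by rewrite /= ger0_norm// ltW// (F_derivative_gt0 hP).
Qed.

Lemma measurable_dG : measurable_fun (`]0, +oo[ : set R) dG.
Proof.
apply: measurableT_comp measurable_dF; apply: continuous_measurable_fun.
exact: sqrt_continuous.
Qed.

(** Near 0 the function F' may be unbounded, but it is integrable and sqrt F' <= 1 + F'. *)
Lemma dG_integrable s : 0 <= s -> mu.-integrable `]0, s] (EFin \o dG).
Proof.
rewrite le_eqVlt => /predU1P[<-|s0].
  by rewrite set_itv_ge ?bnd_simp//; exact: integrable_set0.
have i1 : mu.-integrable `]0, s] (EFin \o (fun x => 1 + derive1 F x)).
  rewrite (_ : (EFin \o _) = (fun x => 1%:E + (derive1 F x)%:E)%E)//.
  apply: integrableD => //; last exact: dF_integrable.
  by apply: integrable_cst_fin => //; exact: lebesgue_measure_oc_fin.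
apply: le_integrable i1 => //.
  by apply/measurable_EFinP; exact: measurable_funS (@itv0y s) measurable_dG.
move=> x /=; rewrite in_itv/= => /andP[x0 _].
have dF0 := ltW (F_derivative_gt0 hP x0).
rewrite lee_fin ger0_norm ?sqrtr_ge0// ger0_norm ?addr_ge0//.
apply: le_trans (sqrt_le_amgm dF0 ltr01) _; rewrite divr1; lra.
Qed.

Lemma G_ofB a b : 0 <= a -> a <= b ->
  G b - G a = \int[mu]_(x in `]a, b]) dG x.
Proof.
move=> a0 ab; apply: Rintegral_itvB; rewrite ?bnd_simp//.
by apply: dG_integrable; exact: le_trans ab.
Qed.

Lemma G_of_le a b : 0 <= a -> a <= b -> G a <= G b.
Proof.
move=> a0 ab; rewrite -subr_ge0 G_ofB//; apply: Rintegral_ge0 => x _.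
exact: sqrtr_ge0.
Qed.

Lemma G_of0 : G 0 = 0.
Proof. by rewrite /G_of set_itv_ge ?bnd_simp// Rintegral_set0. Qed.

Lemma G_of_ge0 s : 0 <= s -> 0 <= G s.
Proof. by move=> s0; rewrite -G_of0 G_of_le. Qed.

Lemma measurable_G_of : measurable_fun (`[0, +oo[ : set R) G.
Proof.
apply: ndecr_measurable; first exact: interval_is_interval.
by move=> x y /=; rewrite in_itv/= andbT => x0 _; exact: G_of_le.
Qed.

(* Cauchy-Schwarz *)
Lemma G_of_le_sqrt s : 0 <= s -> G s <= Num.sqrt (s * F s).
Proof.
rewrite le_eqVlt => /predU1P[<-|s0]; first by rewrite G_of0 sqrtr_ge0.
have Fs0 := F_of_gt0 s0.
set a := Num.sqrt s; set b := Num.sqrt (F s).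
have a0 : 0 < a by rewrite sqrtr_gt0.
have b0 : 0 < b by rewrite sqrtr_gt0.
(* The weight b / a = sqrt (F s / s) is the optimal one: both halves of the weighted mean then
   integrate to at most sqrt (s F s) / 2. *)
have ba0 : 0 < b / a by rewrite divr_gt0.
have aa : a ^+ 2 = s by rewrite sqr_sqrtr// ltW.
have bb : b ^+ 2 = F s by rewrite sqr_sqrtr// ltW.
have ic : mu.-integrable `]0, s] (fun=> (b / a)%:E).
  by apply: integrable_cst_fin => //; exact: lebesgue_measure_oc_fin.
have idF : mu.-integrable `]0, s] (fun x => (derive1 F x / (b / a))%:E).
  rewrite (_ : (fun _ => _) = (fun x => (derive1 F x)%:E * ((b / a)^-1)%:E)%E)//.
  by apply: integrableZr => //; exact: dF_integrable.
have isum : mu.-integrable `]0, s] (fun x => (b / a + derive1 F x / (b / a))%:E).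
  rewrite (_ : (fun _ => _) = (fun x => (b / a)%:E + (derive1 F x / (b / a))%:E)%E)//.
  exact: integrableD.
have ihalf : mu.-integrable `]0, s] (fun x => ((b / a + derive1 F x / (b / a)) / 2)%:E).
  rewrite (_ : (fun _ => _) = (fun x => (b / a + derive1 F x / (b / a))%:E * (2^-1)%:E)%E)//.
  exact: integrableZr.
have dFle : \int[mu]_(x in `]0, s]) derive1 F x <= F s.
  rewrite -lee_fin EFin_Rintegral//; first exact: integral_dF.
  exact: dF_integrable.
apply: (@le_trans _ _ (\int[mu]_(x in `]0, s]) ((b / a + derive1 F x / (b / a)) / 2))).
  apply: le_Rintegral => //; first by apply: dG_integrable; exact: ltW.
  move=> x /=; rewrite in_itv/= => /andP[x0 _].
  by apply: sqrt_le_amgm => //; apply: ltW; exact: (F_derivative_gt0 hP).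
have E1 : \int[mu]_(x in `]0, s]) ((b / a + derive1 F x / (b / a)) / 2) =
    (\int[mu]_(x in `]0, s]) (b / a + derive1 F x / (b / a))) / 2.
  exact: RintegralZr.
have E2 : \int[mu]_(x in `]0, s]) (b / a + derive1 F x / (b / a)) =
    \int[mu]_(x in `]0, s]) (b / a) + \int[mu]_(x in `]0, s]) (derive1 F x / (b / a)).
  exact: RintegralD.
have E3 : \int[mu]_(x in `]0, s]) (derive1 F x / (b / a)) =
    (\int[mu]_(x in `]0, s]) derive1 F x) / (b / a).
  by apply: RintegralZr => //; exact: dF_integrable.
rewrite E1 E2 E3.
rewrite Rintegral_cst//= lebesgue_measure_itv/= lte_fin s0 -EFinB/= subr0.
rewrite (sqrtrM _ (ltW s0)) -/a -/b.
apply: (@le_trans _ _ ((b / a * s + F s / (b / a)) / 2)).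
  by rewrite ler_wpM2r ?invr_ge0// lerD2l ler_wpM2r// invr_ge0 ltW.
rewrite -bb -aa le_eqVlt; apply/orP; left; apply/eqP; field.
by rewrite !gt_eqF.
Qed.

Section A1.
Variable C1 : R.
Hypothesis C10 : 0 < C1.
Hypothesis A1 : forall s, 0 < s <= M -> F s <= C1 * dG s * G s.

(** Were [G s] zero, (A-1) would force F(s) <= 0. This is how u = 0 is recovered from G(u) = 0 at
    the end. *)
Lemma G_of_gt0 s : 0 < s <= M -> 0 < G s.
Proof.
move=> sM; have /andP[s0 _] := sM.
rewrite lt0r G_of_ge0 ?ltW// andbT; apply/negP => /eqP G0.
by have := A1 sM; rewrite G0 mulr0 leNgt F_of_gt0.
Qed.

(** The integrated form of (A-1): on ]a, b] one has F(a) <= F(x) <= C1 G(b) G'(x), and G' integrates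
    to the increment of G. No differentiability of G is involved. *)
Lemma F_of_increment a b : 0 <= a -> a <= b -> b <= M ->
  F a * (b - a) <= C1 * G b * (G b - G a).
Proof.
rewrite le_eqVlt => /predU1P[<- b0 bM|a0 ab bM].
  by rewrite (F_at0 hP) mul0r G_of0 subr0 -mulrA mulr_ge0 ?(ltW C10)// -expr2 sqr_ge0.
rewrite G_ofB ?(ltW a0)//.
have idG : mu.-integrable `]a, b] (EFin \o dG).
  apply: integrableS (dG_integrable (le_trans (ltW a0) ab)) => //.
  by apply: subset_itvr; rewrite bnd_simp ltW.
rewrite -RintegralZl//.
have <- : \int[mu]_(x in `]a, b]) F a = F a * (b - a).
  rewrite Rintegral_cst//= lebesgue_measure_itv/= lte_fin.
  case: ltP ab => [_ _|ba ab]; first by rewrite -EFinB.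
  by rewrite (@le_anti _ _ a b) ?ab ?ba// subrr.
apply: le_Rintegral => //.
- by apply: integrable_cst_fin => //; exact: lebesgue_measure_oc_fin.
- rewrite (_ : (EFin \o _) = (fun x => (C1 * G b)%:E * (dG x)%:E)%E)//.
  exact: integrableZl.
- move=> x /=; rewrite in_itv/= => /andP[ax xb].
  have x0 := lt_trans a0 ax.
  apply: le_trans (F_of_le a0 (ltW ax)) _.
  have xM : 0 < x <= M by rewrite x0 (le_trans xb).
  apply: le_trans (A1 xM) _.
  rewrite -!mulrA ler_wpM2l ?(ltW C10)// [leRHS]mulrC.
  rewrite ler_wpM2l ?sqrtr_ge0//; exact: G_of_le (ltW x0) xb.
Qed.

End A1.

End nonlinearity.

Section H_of_facts.
Context {R : realType}.
Local Notation mu := (@lebesgue_measure R).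
Variables (h P : R -> R) (M : R).
Hypothesis hP : nonlinearities h P.
Hypothesis M0 : 0 < M.
Local Notation F := (F_of h P).
Local Notation G := (G_of h P).
Local Notation H := (H_of h).

Lemma h_integrable_oc s : mu.-integrable `]0, s] (EFin \o h).
Proof.
have [s1|s1] := leP s 1.
  apply: integrableS (h_integrable hP) => //.
  by apply: subset_itvl; rewrite bnd_simp.
have i1s : mu.-integrable `[1, s] (EFin \o h).
  apply: continuous_compact_integrable; first exact: segment_compact.
  apply: continuous_subspaceW (h_continuous hP) => x /=.
  by rewrite !in_itv/= andbT => /andP[x1 _]; exact: lt_le_trans x1.
have i1s' : mu.-integrable `]1, s] (EFin \o h).
  by apply: integrableS i1s => //; apply: subset_itvr; rewrite bnd_simp.
have -> : `]0, s]%classic = `]0, 1]%classic `|` (`]1, s]%classic : set R).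
  by rewrite -itv_bndbnd_setU// bnd_simp// ltW.
have [m1 f1] := integrableP _ _ _ (h_integrable hP).
have [m2 f2] := integrableP _ _ _ i1s'.
apply/integrableP; split; first by apply/measurable_funU.
rewrite ge0_integral_setU//.
- exact: lte_add_pinfty.
- by apply: measurableT_comp => //; exact/measurable_funU.
- apply/disj_setPS => x [/=]; rewrite !in_itv/= => /andP[_ x1] /andP[].
  by rewrite ltNge x1.
Qed.

Lemma H_of_ge0 s : 0 <= H s.
Proof.
apply: Rintegral_ge0 => x /=; rewrite in_itv/= => /andP[x0 _].
exact/ltW/(h_gt0 hP).
Qed.

Lemma H_of_le a b : 0 <= a -> a <= b -> H a <= H b.
Proof.
move=> a0 ab; rewrite -subr_ge0 /H_of Rintegral_itvB; last 3 first.
- exact: h_integrable_oc.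
- by rewrite bnd_simp.
- by rewrite bnd_simp.
apply: Rintegral_ge0 => x /=; rewrite in_itv/= => /andP[ax _].
exact/ltW/(h_gt0 hP)/(le_lt_trans a0).
Qed.

Lemma measurable_H_of : measurable_fun (`[0, +oo[ : set R) H.
Proof.
apply: ndecr_measurable; first exact: interval_is_interval.
by move=> x y /=; rewrite in_itv/= andbT => x0 _; exact: H_of_le.
Qed.

Lemma H_of_small e : 0 < e -> exists2 s, 0 < s & H s <= e.
Proof.
move=> e0.
have ih : mu.-integrable setT (EFin \o (h \_ `]0, 1])).
  rewrite -restrict_EFin; apply/integrable_restrict => //.
  by rewrite setTI; exact: h_integrable hP.
have [d [d0 dP]] := @integral_normr_continuous _ _ _ mu _ ih e e0.
(* Half of [d] makes the length of ]0, s] strictly less than [d]; the bound 1 keeps it in the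
   interval where h is known to be integrable. *)
pose s := Num.min (d / 2) 1.
have s0 : 0 < s by rewrite lt_min ltr01 divr_gt0.
exists s => //; apply: ltW.
have s1 : s <= 1 by rewrite ge_min lexx orbT.
have -> : H s = \int[mu]_(x in `]0, s]) `|(h \_ `]0, 1]) x|.
  apply: eq_Rintegral => x; rewrite inE/= in_itv/= => /andP[x0 xs].
  rewrite patchE mem_set/=; last by rewrite in_itv/= x0 (le_trans xs).
  by rewrite ger0_norm// ltW// (h_gt0 hP).
apply: dP => //=; rewrite lebesgue_measure_itv/= lte_fin s0 -EFinB subr0 lte_fin.
by rewrite gt_min ltr_pdivrMr// ltr_pMr// ltr1n.
Qed.

Section A2.
Variables C2 lam : R.
Hypothesis C20 : 0 < C2.
Hypothesis lam02 : 0 < lam < 2.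
Hypothesis A2 : forall s, 0 <= s <= M -> Num.sqrt (s * F s) `^ lam <= C2 * H s.

Lemma G_of_powR s : 0 <= s <= M -> G s `^ lam <= C2 * H s.
Proof.
move=> sM; apply: le_trans (A2 sM); have /andP[s0 _] := sM.
have /andP[l0 _] := lam02.
apply: ge0_ler_powR; rewrite ?nnegrE ?sqrtr_ge0 ?(ltW l0)//.
  exact: (G_of_ge0 hP).
exact: (G_of_le_sqrt hP).
Qed.

(** Young's inequality below requires an exponent at least 1. When [lam] is smaller, the missing
    power 1 - [lam] is paid by the bound G(s) <= G(M); the added 1 keeps the constant positive. *)
Lemma G_of_powR_ge1 : exists C3 p, [/\ 0 < C3, 1 <= p < 2 &
  forall s, 0 <= s <= M -> G s `^ p <= C3 * H s].
Proof.
have /andP[l0 l2] := lam02.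
have [l1|l1] := leP 1 lam.
  by exists C2, lam; split => //; [rewrite l1|exact: G_of_powR].
have GM0 : 0 <= G M by apply: (G_of_ge0 hP); exact: ltW.
exists (C2 * (G M + 1) `^ (1 - lam)), 1; split.
- by rewrite mulr_gt0// powR_gt0// ltr_pwDr.
- by rewrite lexx ltr1n.
move=> s sM; have /andP[s0 sM'] := sM.
have Gs0 : 0 <= G s by exact: (G_of_ge0 hP).
rewrite [X in G s `^ X](_ : 1 = lam + (1 - lam)); last by ring.
have [->|Gn0] := eqVneq (G s) 0.
  rewrite powR0 ?mulr_ge0 ?powR_ge0 ?H_of_ge0 ?(ltW C20)//.
  by rewrite addrC subrK oner_neq0.
rewrite powRD; last by rewrite Gn0 implybT.
rewrite [leRHS]mulrAC.
apply: ler_pM; rewrite ?powR_ge0//; first exact: G_of_powR.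
apply: ge0_ler_powR; [by rewrite subr_ge0 ltW|by rewrite nnegrE|
  by rewrite nnegrE; exact: addr_ge0 GM0 ler01|].
by apply: (@le_trans _ _ (G M)); [exact: (G_of_le hP)|rewrite lerDl].
Qed.

End A2.
End H_of_facts.

(** If x exceeds d, then (x / d)^(p - 1) >= 1 and the second term alone dominates x. *)
Lemma young_powR (R : realType) (x d p : R) : 0 <= x -> 0 < d -> 1 <= p ->
  x <= d + d `^ (1 - p) * x `^ p.
Proof.
move=> x0 d0 p1; have [xd|dx] := leP x d.
  by rewrite (le_trans xd)// lerDl mulr_ge0// powR_ge0.
have xgt0 := lt_trans d0 dx.
rewrite [X in x `^ X](_ : p = 1 + (p - 1)); last by ring.
rewrite [x `^ _]powRD; last by rewrite (gt_eqF xgt0) implybT.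
rewrite powRr1// mulrCA (_ : 1 - p = - (p - 1)); last by ring.
rewrite powRN ler_wpDl ?(ltW d0)// ler_peMr// ler_pdivlMl ?powR_gt0// mulr1.
by apply: ge0_ler_powR; rewrite ?nnegrE ?subr_ge0// ltW.
Qed.

(** * Comparison of the gradients of u and G(u) *)

Section chain_pointwise.
Context {R : realType}.
Variables (F G : R -> R) (M C : R).
Hypothesis C0 : 0 <= C.
Hypothesis F0 : F 0 = 0.
Hypothesis F_continuous : forall a, 0 < a -> {for a, continuous F}.
Hypothesis G_ge0 : forall a, 0 <= a -> 0 <= G a.
Hypothesis G_le : forall a b, 0 <= a -> a <= b -> G a <= G b.
Hypothesis FG : forall a b, 0 <= a -> a <= b -> b <= M ->
  F a * (b - a) <= C * G b * (G b - G a).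

Lemma increment_le a b : 0 <= a <= M -> 0 <= b <= M ->
  F (Num.min a b) * `|b - a| <= C * Num.max (G a) (G b) * `|G b - G a|.
Proof.
move=> /andP[a0 aM] /andP[b0 bM].
have [ab|/ltW ba] := leP a b.
  have Gab := G_le a0 ab.
  by rewrite (max_idPr Gab) !ger0_norm ?subr_ge0//; exact: FG.
have Gba := G_le b0 ba.
by rewrite (max_idPl Gba) (distrC b) (distrC (G b)) !ger0_norm ?subr_ge0//; exact: FG.
Qed.

(** [b] samples u at nearby points of a line, so d and D stand for the derivatives of u and G(u) at
    the point. The increment inequality, multiplied by n + 1, passes to the limit; at a = 0 the left
    side vanishes, so F has to be continuous only at positive points. *)
Lemma chain_pointwise (a d D : R) (b : R^nat) : 0 <= a <= M ->
  (forall n, 0 <= b n <= M) ->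
  n.+1%:R * (b n - a) @[n --> \oo] --> d ->
  n.+1%:R * (G (b n) - G a) @[n --> \oo] --> D ->
  F a * `|d| <= C * G a * `|D|.
Proof.
move=> aM bM pd qD; have /andP[a0 _] := aM.
move: a0; rewrite le_eqVlt => /predU1P[a0|a0].
  by rewrite -a0 F0 mul0r !mulr_ge0// G_ge0.
(* Convergence of the difference quotients already forces the increments to 0, so that continuity of
   neither u nor G is used. *)
have recover (x : R^nat) (y l : R) :
    n.+1%:R * (x n - y) @[n --> \oo] --> l -> x n @[n --> \oo] --> y.
  move=> xl; have xy : x n - y @[n --> \oo] --> 0.
    rewrite -[X in _ --> X](mulr0 l).
    rewrite (_ : (fun n => x n - y) = (fun n => n.+1%:R * (x n - y)) \* harmonic).
      by apply: cvgM => //; exact: cvg_harmonic.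
    by apply/funext => n; rewrite /= mulrAC divff ?mul1r// pnatr_eq0.
  rewrite -[X in _ --> X]add0r (_ : x = (fun n => x n - y) \+ cst y).
    by apply: cvgD => //; exact: cvg_cst.
  by apply/funext => n; rewrite /= subrK.
have ba := recover _ _ _ pd; have Gba := recover _ _ _ qD.
have lhs : F (Num.min a (b n)) * `|n.+1%:R * (b n - a)| @[n --> \oo] --> F a * `|d|.
  apply: cvgM; last exact: cvg_norm.
  apply: continuous_cvg; first exact: F_continuous.
  have cm : {for a, continuous (fun y => Num.min a y)}.
    by apply: continuous_min; [exact: cst_continuous|exact: cvg_id].
  have H : Num.min a (b n) @[n --> \oo] --> Num.min a a by apply: (continuous_cvg _ cm ba).
  by rewrite minxx in H.
have rhs : C * Num.max (G a) (G (b n)) * `|n.+1%:R * (G (b n) - G a)| @[n --> \oo]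
    --> C * G a * `|D|.
  apply: cvgM; last exact: cvg_norm.
  apply: cvgM; first exact: cvg_cst.
  have cm : {for (G a), continuous (fun y => Num.max (G a) y)}.
    by apply: continuous_max; [exact: cst_continuous|exact: cvg_id].
  have H : Num.max (G a) (G (b n)) @[n --> \oo] --> Num.max (G a) (G a) by apply: (continuous_cvg _ cm Gba).
  by rewrite maxxx in H.
apply: ler_cvg_to lhs rhs _; apply: nearW => n.
rewrite !normrM ![F _ * _]mulrCA ![C * _ * _]mulrCA ler_wpM2l//.
exact: increment_le.
Qed.

End chain_pointwise.

(** Cauchy-Schwarz against the constant 1, from |f| <= a/2 + f^2/(2a) with the optimal a = |I| / m.
    Square integrability is not assumed: the right side may be infinite. *)
Lemma sqr_Rintegral_le d (T : measurableType d) (R : realType)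
    (mu : {measure set T -> \bar R}) (D : set T) (f : T -> R) (m : R) :
  measurable D -> mu D = m%:E -> 0 < m -> mu.-integrable D (EFin \o f) ->
  (((\int[mu]_(x in D) f x) ^+ 2)%:E <= m%:E * \int[mu]_(x in D) (f x ^+ 2)%:E)%E.
Proof.
move=> mD muD m0 fi; set I := \int[mu]_(x in D) f x.
have mf : measurable_fun D f by apply/measurable_EFinP; exact: measurable_int fi.
have mf2 : measurable_fun D (fun x => (f x ^+ 2)%:E).
  by apply/measurable_EFinP; exact: measurable_funX.
have J0 : (0 <= \int[mu]_(x in D) (f x ^+ 2)%:E)%E.
  by apply: integral_ge0 => x _; rewrite lee_fin sqr_ge0.
have [->|I0] := eqVneq I 0; first by rewrite expr0n/= mule_ge0// lee_fin ltW.
pose a := `|I| / m; have a0 : 0 < a by rewrite divr_gt0// normr_gt0.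
have bound : (`|I|%:E <= (a / 2 * m)%:E + (a^-1 / 2)%:E * \int[mu]_(x in D) (f x ^+ 2)%:E)%E.
  apply: (@le_trans _ _ (\int[mu]_(x in D) `|(f x)%:E|)%E).
    apply: le_trans (normr_fine_le _) _; apply: le_abse_integral => //.
    exact/measurable_EFinP.
  apply: (@le_trans _ _ (\int[mu]_(x in D) ((a / 2)%:E + (a^-1 / 2)%:E * (f x ^+ 2)%:E))%E).
    apply: ge0_le_integral => //.
    - by apply: measurableT_comp => //; exact/measurable_EFinP.
    - by apply: emeasurable_funD => //; exact: measurable_funeM.
    - move=> x _; rewrite -EFinM -EFinD lee_fin.
      rewrite -(real_normK (num_real (f x))) -subr_ge0.
      rewrite (_ : _ - _ = (`|f x| - a) ^+ 2 / (2 * a)); last first.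
        by field; rewrite gt_eqF.
      by rewrite divr_ge0 ?sqr_ge0// mulr_ge0// ltW.
  rewrite ge0_integralD//; last 3 first.
  - by move=> x _; rewrite lee_fin divr_ge0// ltW.
  - by move=> x _; rewrite -EFinM lee_fin mulr_ge0 ?sqr_ge0// divr_ge0// invr_ge0 ltW.
  - exact: measurable_funeM.
  rewrite integral_cst// muD -EFinM leeD2l// ge0_integralZl_EFin//.
    by move=> x _; rewrite lee_fin sqr_ge0.
  by rewrite divr_ge0// invr_ge0 ltW.
case: (\int[mu]_(x in D) (f x ^+ 2)%:E)%E J0 bound => [j||]//=; last first.
  by move=> _ _; rewrite gt0_muley ?lte_fin// leey.
rewrite -!EFinM -EFinD !lee_fin => j0 bound.
move: bound; rewrite /a -(@ler_pM2r _ `|I|) ?normr_gt0// -expr2 real_normK ?num_real//.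
have nI : `|I| != 0 by rewrite normr_eq0.
have -> : (`|I| / m / 2 * m + (`|I| / m)^-1 / 2 * j) * `|I| = (`|I| ^+ 2 + m * j) / 2.
  by field; rewrite nI gt_eqF.
rewrite real_normK ?num_real//; lra.
Qed.

Section partial_derivatives.
Context {R : realType} {n : nat}.
Local Notation Rm := (measurableTypeR R).
Local Notation nu := (lebesgue_row n \x @lebesgue_measure R)%E.
Implicit Types (c : 'rV[R]_n) (r s t : R) (f g : 'rV[R]_n * R -> R).

Lemma box_le c r r' s t : r <= r' -> box c r s t `<=` box c r' s t.
Proof. by move=> rr z [/(eball_le rr) ? ?]; split. Qed.

(** A weak derivative in one coordinate direction for functions defined everywhere, tested on a
    cylinder only; integrals over the whole space keep translations simple. *)
Definition weak_partial (i : 'I_n) f g c r s t : Prop :=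
  forall phi, C1 phi -> (forall z, phi z != 0 -> box c r s t z) ->
  \int[nu]_z (f z * 'D_(unit_row i, 0) phi z) = - \int[nu]_z (g z * phi z).

Lemma weak_partial_translate i f g K c r r1 s t h :
  measurable_fun [set: 'rV[R]_n * Rm] f -> measurable_fun [set: 'rV[R]_n * Rm] g ->
  (forall z, `|f z| <= K) ->
  nu.-integrable [set: 'rV[R]_n * Rm] (EFin \o g) ->
  weak_partial i f g c r1 s t -> 0 < r -> s < t -> 0 < h -> r + h <= r1 ->
  {ae nu, forall z, box c r s t z -> f (translate i h z) - f z =
    \int[lebesgue_measure]_(a in `[0, h]) g (translate i a z)}.
Proof.
move=> mf mg fK ig w r0 st h0 rh.
apply: (weak_derivative_translate mf mg fK ig r0 st h0) => phi Cphi sphi.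
by apply: w => // z /sphi; exact: box_le.
Qed.

(** Outside a null set, the increments with steps 1/(p+1) are integrals of [gU] and [gV] for all
    large p, and the averages of these integrals converge to [gU] and [gV]. The difference quotients
    of U and G(U) therefore converge at that point. *)
Lemma chain_inequality i (F G : R -> R) (M C K : R) (U V gU gV : 'rV[R]_n * R -> R) c r r1 s t :
  0 <= C -> F 0 = 0 -> (forall a, 0 < a -> {for a, continuous F}) ->
  (forall a, 0 <= a -> 0 <= G a) ->
  (forall a b, 0 <= a -> a <= b -> G a <= G b) ->
  (forall a b, 0 <= a -> a <= b -> b <= M ->
    F a * (b - a) <= C * G b * (G b - G a)) ->
  (forall z, 0 <= U z <= M) -> (forall z, V z = G (U z)) -> (forall z, `|V z| <= K) ->
  measurable_fun [set: 'rV[R]_n * Rm] U -> measurable_fun [set: 'rV[R]_n * Rm] V ->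
  measurable_fun [set: 'rV[R]_n * Rm] gU -> measurable_fun [set: 'rV[R]_n * Rm] gV ->
  nu.-integrable [set: 'rV[R]_n * Rm] (EFin \o gU) ->
  nu.-integrable [set: 'rV[R]_n * Rm] (EFin \o gV) ->
  weak_partial i U gU c r1 s t -> weak_partial i V gV c r1 s t ->
  0 < r -> r < r1 -> s < t ->
  {ae nu, forall z, box c r s t z -> F (U z) * `|gU z| <= C * V z * `|gV z|}.
Proof.
move=> C0 F0 Fc G0 Gle FG UM VG VK mU mV mgU mgV igU igV wU wV r0 rr1 st.
have rn0 : 0 < r1 - r by rewrite subr_gt0.
have [k kP] : exists k, forall p, (k <= p)%N -> r + p.+1%:R^-1 <= r1.
  exists (Num.truncn (r1 - r)^-1) => p kp.
  rewrite -lerBrDl invf_ple ?posrE//.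
  by rewrite (le_trans (ltW (truncnS_gt _)))// ler_nat.
have h0 p : 0 < p.+1%:R^-1 :> R by rewrite invr_gt0.
have UK z : `|U z| <= M by have /andP[? ?] := UM z; rewrite ger0_norm.
have aeU : {ae nu, forall z p, (k <= p)%N -> box c r s t z ->
    U (translate i p.+1%:R^-1 z) - U z =
    \int[lebesgue_measure]_(a in `[0, p.+1%:R^-1]) gU (translate i a z)}.
  apply: ae_all_nat => p; have [kp|kp] := pselect (is_true (k <= p)%N).
    by apply: ae_imply (weak_partial_translate mU mgU UK igU wU r0 st (h0 p) (kP _ kp)).
  by apply: aeW.
have aeV : {ae nu, forall z p, (k <= p)%N -> box c r s t z ->
    V (translate i p.+1%:R^-1 z) - V z =
    \int[lebesgue_measure]_(a in `[0, p.+1%:R^-1]) gV (translate i a z)}.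
  apply: ae_all_nat => p; have [kp|kp] := pselect (is_true (k <= p)%N).
    by apply: ae_imply (weak_partial_translate mV mgV VK igV wV r0 st (h0 p) (kP _ kp)).
  by apply: aeW.
have avU := translate_average_cvg i mgU igU.
have avV := translate_average_cvg i mgV igV.
apply: ae_imply (ae_and (ae_and aeU aeV) (ae_and avU avV)) => z [[zU zV] [zavU zavV]] Bz.
rewrite VG; apply: (@chain_pointwise R F G M C C0 F0 Fc G0 Gle FG (U z) (gU z) (gV z)
  (fun p => U (translate i p.+1%:R^-1 z))) => //.
- apply: cvg_trans zavU; apply: near_eq_cvg; exists k => // p /= kp.
  by rewrite zU.
- apply: cvg_trans zavV; apply: near_eq_cvg; exists k => // p /= kp.
  by rewrite -!VG zV.
Qed.

End partial_derivatives.

(** * Averaging over small translations *)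

Section translation_L2.
Context {R : realType} {n : nat}.
Local Notation Rm := (measurableTypeR R).
Local Notation nu := (lebesgue_row n \x @lebesgue_measure R)%E.
Variables (c : 'rV[R]_n) (r1 s t K : R).
Hypothesis st : s < t.
Variables (V : 'rV[R]_n * R -> R) (g : 'I_n -> 'rV[R]_n * R -> R).
Hypothesis mV : measurable_fun [set: 'rV[R]_n * Rm] V.
Hypothesis VK : forall z, `|V z| <= K.
Hypothesis mg : forall i, measurable_fun [set: 'rV[R]_n * Rm] (g i).
Hypothesis ig : forall i, nu.-integrable [set: 'rV[R]_n * Rm] (EFin \o g i).
Hypothesis wV : forall i, weak_partial i V (g i) c r1 s t.

Let mtr i (a : R) : measurable_fun setT (translate i a : 'rV[R]_n * Rm -> 'rV[R]_n * Rm).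
Proof. exact: measurable_shift_space. Qed.

Let mbox r : measurable (box c r s t : set ('rV[R]_n * Rm)).
Proof. exact: measurable_box. Qed.

Let mrestr r (psi : 'rV[R]_n * Rm -> \bar R) : measurable_fun setT psi ->
  measurable_fun setT (psi \_ (box c r s t)).
Proof.
move=> mpsi; apply/(measurable_restrictT _ _).1; first exact: mbox.
exact: measurable_funTS.
Qed.

Lemma translate_le_integral i a r b (psi : 'rV[R]_n * Rm -> \bar R) :
  0 < r -> `|a| <= b -> measurable_fun setT psi -> (forall z, 0 <= psi z)%E ->
  (\int[nu]_(z in box c r s t) psi (translate i a z) <=
   \int[nu]_(z in box c (r + b) s t) psi z)%E.
Proof.
move=> r0 ab mpsi psi0.
have mp : measurable_fun setT (psi \_ (box c (r + b) s t) : 'rV[R]_n * Rm -> \bar R).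
  exact: mrestr.
rewrite [leRHS]integral_mkcond.
rewrite -(integral_preserving (mtr i a) (translate_preserving i a) mp).
rewrite [leLHS]integral_mkcond; apply: ge0_le_integral => //.
- by move=> z _; rewrite patchE; case: ifPn.
- by apply: mrestr; exact: measurableT_comp mpsi (mtr i a).
- exact: measurableT_comp mp (mtr i a).
- move=> z _; rewrite !patchE; case: ifPn => [/set_mem Bz|_]; last by case: ifPn.
  by rewrite mem_set//; exact: box_translate.
Qed.

Let mg2 i : measurable_fun [set: 'rV[R]_n * Rm] (fun z => (g i z ^+ 2)%:E).
Proof. by apply/measurable_EFinP; exact: measurable_funX. Qed.

Let mgbox i r : measurable_fun [set: 'rV[R]_n * Rm]
  ((fun z => (g i z ^+ 2)%:E) \_ (box c r s t)).
Proof. by apply: mrestr; exact: mg2. Qed.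

Let g2_ge0 i z : (0 <= (g i z ^+ 2)%:E)%E.
Proof. by rewrite lee_fin sqr_ge0. Qed.

Let gbox_ge0 i r z : (0 <= ((fun z => (g i z ^+ 2)%:E) \_ (box c r s t)) z)%E.
Proof. by rewrite patchE; case: ifPn => // _; exact: g2_ge0. Qed.

Let measurable_inner i r h : measurable_fun [set: 'rV[R]_n * Rm] (fun z =>
  (\int[lebesgue_measure]_(a in `[0%R, h])
    ((fun z => (g i z ^+ 2)%:E) \_ (box c r s t)) (translate i a z)))%E.
Proof.
apply: (@measurable_flow_integral _ ('rV[R]_n * Rm)%type R (translate i)
  (@measurable_translate R n i)) => //.
Qed.

(** The increment is an integral over [0, h]: Cauchy-Schwarz gives one factor h and Tonelli, with
    invariance under translation, the other. The ball grows by h because the points of the segment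
    leave it. *)
Lemma translation_L2 i r h : 0 < r -> 0 < h -> r + h <= r1 ->
  (\int[nu]_(z in box c r s t) ((V (translate i h z) - V z) ^+ 2)%:E <=
   (h ^+ 2)%:E * \int[nu]_(z in box c (r + h) s t) (g i z ^+ 2)%:E)%E.
Proof.
move=> r0 h0 rh.
pose Phi := ((fun z => (g i z ^+ 2)%:E) \_ (box c (r + h) s t)) : 'rV[R]_n * Rm -> \bar R.
have rep := weak_partial_translate mV (mg i) VK (ig i) (@wV i) r0 st h0 rh.
have lint := translate_ae_integrable i (mg i) (ig i) 0 h.
have muh : lebesgue_measure (`[0, h]%classic : set R) = h%:E.
  by rewrite lebesgue_measure_itv/= lte_fin h0 -EFinB subr0.
apply: (@le_trans _ _ (\int[nu]_(z in box c r s t) (h%:E *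
    \int[lebesgue_measure]_(a in `[0%R, h]) Phi (translate i a z)))%E).
  apply: ae_ge0_le_integral => //.
  - by move=> z _; rewrite lee_fin sqr_ge0.
  - apply: measurable_funTS; apply/measurable_EFinP; apply: measurable_funX.
    by apply: measurable_funB => //; exact: measurableT_comp mV (mtr i h).
  - move=> z _; apply: mule_ge0; first by rewrite lee_fin ltW.
    by apply: integral_ge0 => a _; exact: gbox_ge0.
  - by apply: measurable_funTS; apply: measurable_funeM; exact: measurable_inner.
  - apply: ae_imply (ae_and rep lint) => z [repz intz] Bz.
    rewrite repz//; apply: le_trans (sqr_Rintegral_le _ muh h0 intz) _ => //.
    rewrite le_eqVlt; apply/orP; left; apply/eqP; congr (_ * _)%E.
    apply: eq_integral => a; rewrite inE/= in_itv/= => /andP[a0 ah].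
    rewrite /Phi patchE mem_set//; apply: box_translate => //.
    by rewrite ger0_norm.
apply: (@le_trans _ _ (\int[nu]_z (h%:E *
    \int[lebesgue_measure]_(a in `[0%R, h]) Phi (translate i a z)))%E).
  apply: ge0_subset_integral => //.
  - by apply: measurable_funeM; exact: measurable_inner.
  - move=> z _; apply: mule_ge0; first by rewrite lee_fin ltW.
    by apply: integral_ge0 => a _; exact: gbox_ge0.
rewrite ge0_integralZl_EFin//; last 3 first.
- by move=> z _; apply: integral_ge0 => a _; exact: gbox_ge0.
- exact: measurable_inner.
- exact: ltW.
rewrite (translate_tonelli i (mgbox i (r + h)))//.
rewrite [X in (_ * (X * _) <= _)%E]muh muleA -EFinM -expr2 le_eqVlt; apply/orP; left.
by apply/eqP; congr (_ * _)%E; rewrite [RHS]integral_mkcond.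
Qed.

Variables (E e : R).
Hypothesis gE : forall i, (\int[nu]_(z in box c r1 s t) (g i z ^+ 2)%:E <= E%:E)%E.
Hypothesis e0 : 0 < e.

(** A shift by [w] is split into successive moves along the axes, since increments are controlled
    only in coordinate directions. *)
Definition path_translate (w : 'rV[R]_n) (l : seq 'I_n) (z : 'rV[R]_n * R) :=
  foldl (fun z i => translate i (w ord0 i) z) z l.

Let E0 : (0 < n)%N -> 0 <= E.
Proof.
move=> n0; rewrite -lee_fin; apply: le_trans (gE (Ordinal n0)).
by apply: integral_ge0 => z _; exact: g2_ge0.
Qed.

Lemma measurable_path_translate w l : measurable_fun setT
  (path_translate w l : 'rV[R]_n * Rm -> 'rV[R]_n * Rm).
Proof.
elim: l => [|i l ih]; first exact: measurable_id.
exact: (measurableT_comp ih (mtr i (w ord0 i))).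
Qed.

Let mdiff (phi psi : 'rV[R]_n * Rm -> 'rV[R]_n * Rm) :
  measurable_fun setT phi -> measurable_fun setT psi ->
  measurable_fun setT (fun z => ((V (phi z) - V (psi z)) ^+ 2)%:E).
Proof.
move=> mphi mpsi; apply/measurable_EFinP; apply: measurable_funX.
by apply: measurable_funB; exact: measurableT_comp.
Qed.

(** Each further move costs the factor 2 of (a + b)^2 <= 2 a^2 + 2 b^2; the crude constant 4^l
    closes the induction since 2 X 4^l + 2 X <= X 4^(l+1). The radius grows by at most e per
    move. *)
Lemma path_translate_L2 (w : 'rV[R]_n) (l : seq 'I_n) (r : R) : (0 < n)%N -> (forall i, 0 <= w ord0 i <= e) ->
  0 < r -> r + e * (size l)%:R <= r1 ->
  (\int[nu]_(z in box c r s t) ((V (path_translate w l z) - V z) ^+ 2)%:E <=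
   (4 ^+ size l * (e ^+ 2 * E))%:E)%E.
Proof.
move=> n0 we; have En := E0 n0.
have mid : measurable_fun setT (id : 'rV[R]_n * Rm -> 'rV[R]_n * Rm) by exact: measurable_id.
elim: l r => [|i l ih] r r0 rl.
  rewrite integral0_eq ?lee_fin; first by rewrite mul1r mulr_ge0// sqr_ge0.
  by move=> z _; rewrite /= subrr expr0n.
have re0 : 0 < r + e by rewrite addr_gt0.
have rel : r + e + e * (size l)%:R <= r1.
  by apply: le_trans rl; rewrite /= -addrA lerD2l -natr1 mulrDr mulr1 addrC.
have re1 : r + e <= r1.
  by apply: le_trans rel; rewrite lerDl mulr_ge0// ltW.
have /andP[wi0 wie] := we i.
have mp := measurable_path_translate w l.
have mt := mtr i (w ord0 i).
have mpt := measurableT_comp mp mt.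
have step1 : (\int[nu]_(z in box c r s t)
    ((V (path_translate w l (translate i (w ord0 i) z)) - V (translate i (w ord0 i) z)) ^+ 2)%:E <=
    (4 ^+ size l * (e ^+ 2 * E))%:E)%E.
  apply: le_trans (ih _ re0 rel).
  apply: (translate_le_integral i (psi := fun z => ((V (path_translate w l z) - V z) ^+ 2)%:E)) => //.
  - by rewrite ger0_norm.
  - exact: mdiff.
  - by move=> z; rewrite lee_fin sqr_ge0.
have step2 : (\int[nu]_(z in box c r s t)
    ((V (translate i (w ord0 i) z) - V z) ^+ 2)%:E <= (e ^+ 2 * E)%:E)%E.
  move: wi0; rewrite le_eqVlt => /predU1P[<-|wi0].
    rewrite integral0_eq ?lee_fin; first by rewrite mulr_ge0// sqr_ge0.
    by move=> z _; rewrite translate0 subrr expr0n.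
  apply: le_trans (translation_L2 i r0 wi0 _) _.
    by apply: le_trans re1; rewrite lerD2l.
  rewrite [leRHS]EFinM; apply: lee_pmul.
  - by rewrite lee_fin sqr_ge0.
  - by apply: integral_ge0 => z _; exact: g2_ge0.
  - by rewrite lee_fin ler_pXn2r// nnegrE ?ltW.
  - apply: le_trans (gE i); apply: ge0_subset_integral => //.
    + exact: measurable_funTS (mg2 i).
    + by move=> z; apply: box_le; apply: le_trans re1; rewrite lerD2l.
apply: (@le_trans _ _ (\int[nu]_(z in box c r s t)
  (2%:E * ((V (path_translate w l (translate i (w ord0 i) z)) - V (translate i (w ord0 i) z)) ^+ 2)%:E +
   2%:E * ((V (translate i (w ord0 i) z) - V z) ^+ 2)%:E))%E).
  apply: ge0_le_integral => //.
  - by move=> z _; rewrite lee_fin sqr_ge0.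
  - by apply: measurable_funTS; exact: (mdiff (measurable_path_translate w (i :: l)) mid).
  - apply: measurable_funTS; apply: emeasurable_funD; apply: measurable_funeM.
    + exact: (mdiff mpt mt).
    + exact: (mdiff mt mid).
  - move=> z _; rewrite -!EFinM -EFinD lee_fin /=.
    set a := V (path_translate _ _ _); set b := V (translate _ _ _).
    have := sqr_ge0 (a - b - (b - V z)); rewrite !expr2; lra.
rewrite ge0_integralD//; last 4 first.
- by move=> z _; rewrite -EFinM lee_fin mulr_ge0// sqr_ge0.
- by apply: measurable_funTS; apply: measurable_funeM; exact: (mdiff mpt mt).
- by move=> z _; rewrite -EFinM lee_fin mulr_ge0// sqr_ge0.
- by apply: measurable_funTS; apply: measurable_funeM; exact: (mdiff mt mid).
rewrite !ge0_integralZl_EFin//.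
- apply: (@le_trans _ _ (2%:E * (4 ^+ size l * (e ^+ 2 * E))%:E + 2%:E * (e ^+ 2 * E)%:E)%E).
    by apply: leeD; apply: lee_wpmul2l => //; rewrite lee_fin.
  rewrite -!EFinM -EFinD lee_fin [size (_ :: _)]/= (exprS 4).
  have e2E : 0 <= e ^+ 2 * E by rewrite mulr_ge0// sqr_ge0.
  have p1 : 1 <= 4 ^+ size l :> R by rewrite exprn_ege1// ler1n.
  move: e2E p1; move: (e ^+ 2 * E) (4 ^+ size l) => X p X0 p1.
  have : 0 <= (p - 1) * X by rewrite mulr_ge0 ?subr_ge0.
  by rewrite mulrBl mul1r; lra.
- by move=> z _; rewrite lee_fin sqr_ge0.
- by apply: measurable_funTS; exact: (mdiff mt mid).
- by move=> z _; rewrite lee_fin sqr_ge0.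
- by apply: measurable_funTS; exact: (mdiff mpt mt).
Qed.

End translation_L2.

Section average.
Context {R : realType} {n : nat}.
Local Notation Rm := (measurableTypeR R).
Local Notation nu := (lebesgue_row n \x @lebesgue_measure R)%E.

Lemma path_translate_enum (w : 'rV[R]_n) z :
  path_translate w (enum 'I_n) z = shift_space w z.
Proof.
have E l : forall z, path_translate w l z =
    (z.1 + \sum_(i <- l) w ord0 i *: unit_row i, z.2).
  elim: l => [|i l ih] [x a]; first by rewrite big_nil addr0.
  by rewrite /= ih big_cons /= addrA.
by rewrite E big_enum/= /shift_space; congr (_ + _, _); rewrite -row_sum_delta.
Qed.

Variables (c : 'rV[R]_n) (r r1 s t K e A : R).
Hypothesis r0 : 0 < r.
Hypothesis e0 : 0 < e.
Hypothesis re1 : r + e * n%:R <= r1.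
Variable V : 'rV[R]_n * R -> R.
Hypothesis mV : measurable_fun [set: 'rV[R]_n * Rm] V.
Hypothesis V0 : forall z, 0 <= V z.

(** A corner cube rather than a centred one: increments are represented for positive steps. *)
Definition cube : set 'rV[R]_n := [set w | forall i, 0 <= w ord0 i <= e].

Lemma box_shift_cube w z : cube w -> box c r s t z -> box c r1 s t (shift_space w z).
Proof.
move=> Qw; rewrite -path_translate_enum => Bz.
have E l : forall a z, 0 < a -> box c a s t z ->
    box c (a + e * (size l)%:R) s t (path_translate w l z).
  elim: l => [|i l ih] a y a0 By; first by rewrite mulr0 addr0.
  rewrite (_ : a + _ = (a + e) + e * (size l)%:R); last first.
    by rewrite -natr1; ring.
  apply: ih; first by rewrite addr_gt0.
  apply: box_translate => //; have /andP[wi0 wie] := Qw i.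
  by rewrite ger0_norm.
apply: box_le re1 _ _; have := E (enum 'I_n) r z r0 Bz.
by rewrite size_enum_ord.
Qed.

Lemma measurable_cube : measurable cube /\ lebesgue_row n cube = (e ^+ n)%:E.
Proof.
have [|mQ muQ] := @lebesgue_row_box R n 0 (const_mx e); first by move=> i; rewrite !mxE ltW.
rewrite (_ : cube = [set w | forall i, (0 : 'rV[R]_n) ord0 i <= w ord0 i <= (const_mx e : 'rV[R]_n) ord0 i]).
  split => //; rewrite muQ; congr EFin.
  under eq_bigr do rewrite !mxE subr0.
  by rewrite prodr_const card_ord.
by apply/seteqP; split => w wQ i; have := wQ i; rewrite !mxE.
Qed.

Let cut a z := V z * \1_(box c a s t) z.
Let m (tau : R) : \bar R := (\int[lebesgue_row n]_x (cut r1 (x, tau))%:E)%E.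

Let cut0 a z : 0 <= cut a z.
Proof. by rewrite mulr_ge0. Qed.

Let cut_le a b z : a <= b -> cut a z <= cut b z.
Proof.
move=> ab; rewrite ler_wpM2l//; rewrite !indicE; case: (boolP (z \in box c a s t)) => //.
by move=> /set_mem/(box_le ab) zb; rewrite mem_set.
Qed.

Let mcut a : measurable_fun [set: 'rV[R]_n * Rm] (cut a).
Proof.
apply: measurable_funM => //; apply: measurable_indic.
exact: measurable_box.
Qed.

Let mEcut a : measurable_fun [set: 'rV[R]_n * Rm] (EFin \o cut a).
Proof. by apply/measurable_EFinP; exact: mcut. Qed.

Lemma measurable_shift_pair : measurable_fun [set: 'rV[R]_n * ('rV[R]_n * Rm)]
  (fun p => shift_space p.1 p.2 : 'rV[R]_n * Rm).
Proof.
apply/measurable_fun_pairP; split; last first.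
  exact: measurableT_comp measurable_snd measurable_snd.
apply: measurable_rowP => j.
rewrite (_ : (fun _ => _) = fun p : 'rV[R]_n * ('rV[R]_n * Rm) =>
    (p.2.1 ord0 j + p.1 ord0 j)%R); last first.
  by apply/funext => p; rewrite /= !mxE.
apply: measurable_funD.
- have mj : measurable_fun setT (fun x : 'rV[R]_n => x ord0 j : Rm) by exact: measurable_coord.
  exact: measurableT_comp mj (measurableT_comp measurable_fst measurable_snd).
- have mj : measurable_fun setT (fun x : 'rV[R]_n => x ord0 j : Rm) by exact: measurable_coord.
  exact: measurableT_comp mj measurable_fst.
Qed.

Let f2 (p : 'rV[R]_n * ('rV[R]_n * R)) : \bar R :=
  (cut r p.2 * cut r1 (shift_space p.1 p.2))%:E.

Let mf2 : measurable_fun [set: 'rV[R]_n * ('rV[R]_n * Rm)] f2.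
Proof.
apply/measurable_EFinP; apply: measurable_funM.
- exact: measurableT_comp (mcut r) measurable_snd.
- exact: measurableT_comp (mcut r1) measurable_shift_pair.
Qed.

Let f20 p : (0 <= f2 p)%E.
Proof. by rewrite lee_fin mulr_ge0. Qed.

Let mf2w w : measurable_fun [set: 'rV[R]_n * Rm] (fun z => f2 (w, z)).
Proof.
apply: measurableT_comp mf2 _.
exact: measurable_pair1.
Qed.

Hypothesis hA : forall w, cube w ->
  (\int[nu]_(z in box c r s t) ((V (shift_space w z) - V z) ^+ 2)%:E <= A%:E)%E.

Let step1 w : cube w -> (\int[nu]_(z in box c r s t) (V z ^+ 2)%:E <=
  A%:E + 2%:E * \int[nu]_z f2 (w, z))%E.
Proof.
move=> Qw.
have mB := @measurable_box R n c r s t.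
have md : measurable_fun [set: 'rV[R]_n * Rm] (fun z => ((V (shift_space w z) - V z) ^+ 2)%:E).
  apply/measurable_EFinP; apply: measurable_funX; apply: measurable_funB => //.
  exact: measurableT_comp mV (measurable_shift_space w).
apply: (@le_trans _ _ (\int[nu]_(z in box c r s t)
   (((V (shift_space w z) - V z) ^+ 2)%:E + 2%:E * f2 (w, z)))%E).
  apply: ge0_le_integral => //.
  - by move=> z _; rewrite lee_fin sqr_ge0.
  - by apply: measurable_funTS; apply/measurable_EFinP; exact: measurable_funX.
  - by apply: measurable_funTS; apply: emeasurable_funD => //; exact: measurable_funeM.
  - move=> z Bz; rewrite -EFinM -EFinD lee_fin /cut /=.
    rewrite !indicE mem_set// mem_set; last exact: box_shift_cube.
    (* The two sides differ exactly by the square of the shifted value. *)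
    have := sqr_ge0 (V (shift_space w z)).
    by move: (V _) (V z) => a b; rewrite !mulr1 !expr2; lra.
rewrite ge0_integralD//; last 4 first.
- by move=> z _; rewrite lee_fin sqr_ge0.
- exact: measurable_funTS.
- by move=> z _; rewrite mule_ge0.
- by apply: measurable_funTS; exact: measurable_funeM.
apply: leeD; first exact: hA.
rewrite ge0_integralZl_EFin//; last exact: measurable_funTS.
apply: lee_wpmul2l => //.
exact: ge0_subset_integral.
Qed.

(** The pointwise inequality is integrated over [w] in the cube, of volume e^n. The cross term is
    then extended to all [w], where it factors at each time into a product of two masses, both
    bounded by the mass on the larger ball. *)
Lemma average_L2 : ((e ^+ n)%:E * \int[nu]_(z in box c r s t) (V z ^+ 2)%:E <=
  (e ^+ n * A)%:E + 2%:E * \int[lebesgue_measure]_tau (m tau * m tau))%E.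
Proof.
have [mQ muQ] := measurable_cube.
have mg : measurable_fun setT (fun w => \int[spacetime n]_z f2 (w, z))%E.
  exact: (@measurable_fun_fubini_tonelli_F _ _ 'rV[R]_n ('rV[R]_n * Rm)%type R (spacetime n) f2 mf2 f20).
have g0 w : (0 <= \int[spacetime n]_z f2 (w, z))%E by apply: integral_ge0.
set X := (\int[nu]_(z in box c r s t) (V z ^+ 2)%:E)%E.
have X0 : (0 <= X)%E by apply: integral_ge0 => z _; rewrite lee_fin sqr_ge0.
have A0 : 0 <= A.
  have Q0 : cube 0 by move=> i; rewrite mxE lexx ltW.
  rewrite -lee_fin; apply: le_trans (hA Q0).
  by apply: integral_ge0 => z _; rewrite lee_fin sqr_ge0.
have L1 : ((e ^+ n)%:E * X <=
    (e ^+ n * A)%:E + 2%:E * \int[lebesgue_row n]_w \int[spacetime n]_z f2 (w, z))%E.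
  rewrite muleC -muQ -integral_cst//.
  apply: (@le_trans _ _ (\int[lebesgue_row n]_(w in cube)
      (A%:E + 2%:E * \int[spacetime n]_z f2 (w, z)))%E).
    apply: ge0_le_integral => //.
    by apply: measurable_funTS; apply: emeasurable_funD => //; exact: measurable_funeM.
  rewrite ge0_integralD//; last 2 first.
  - by move=> w _; rewrite mule_ge0.
  - by apply: measurable_funTS; exact: measurable_funeM.
  apply: leeD.
    by rewrite integral_cst// [X in (_ * X <= _)%E]muQ -EFinM mulrC.
  rewrite ge0_integralZl_EFin//; last exact: measurable_funTS.
  apply: lee_wpmul2l => //.
  exact: ge0_subset_integral.
apply: le_trans L1 _; apply: leeD => //; apply: lee_wpmul2l => //.
rewrite (@fubini_tonelli _ _ 'rV[R]_n ('rV[R]_n * Rm)%type R (lebesgue_row n) (spacetime n) f2 mf2 f20).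
have mm : measurable_fun setT (m : Rm -> \bar R).
  apply: (@measurable_fun_fubini_tonelli_G _ _ 'rV[R]_n Rm R (lebesgue_row n) (EFin \o cut r1)) => //.
  by move=> z; rewrite lee_fin.
have m0 tau : (0 <= m tau)%E by apply: integral_ge0 => x _; rewrite lee_fin.
have mcx tau : measurable_fun [set: 'rV[R]_n] (fun x => (cut r1 (x, tau))%:E).
  by apply: (measurableT_comp (mEcut r1)); exact: measurable_pair2.
(* For fixed z, integrating the shifted truncation over all [w] gives the mass of the whole slice,
   by translation invariance. *)
have L2 z : (\int[lebesgue_row n]_w f2 (w, z) = (cut r1 z)%:E * 0 + (cut r z)%:E * m z.2)%E.
  rewrite mule0 add0e; under eq_integral do rewrite /f2/= EFinM.
  rewrite ge0_integralZl_EFin//; last 2 first.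
  - by move=> x _; rewrite lee_fin.
  - have mp : measurable_fun [set: 'rV[R]_n] (fun w : 'rV[R]_n => (w, z) : 'rV[R]_n * ('rV[R]_n * Rm)).
      exact: measurable_pair2.
    exact: measurableT_comp (mEcut r1) (measurableT_comp measurable_shift_pair mp).
  congr (_ * _)%E; transitivity (\int[lebesgue_row n]_x (cut r1 (x + z.1, z.2))%:E)%E.
    by apply: eq_integral => w _; rewrite /shift_space addrC.
  have c0 x : (0 <= (cut r1 (x, z.2))%:E)%E by rewrite lee_fin.
  exact: (ge0_integral_preserving (measurable_shift_row z.1) (lebesgue_row_shift z.1) (mcx z.2) c0).
under eq_integral do rewrite L2 mule0 add0e.
have mcm : measurable_fun [set: 'rV[R]_n * Rm] (fun z => (cut r z)%:E * m z.2)%E.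
  apply: emeasurable_funM; first exact: mEcut.
  exact: measurableT_comp mm measurable_snd.
rewrite (@fubini_tonelli2 _ _ 'rV[R]_n Rm R (lebesgue_row n) lebesgue_measure _ mcm); last first.
  by move=> z; rewrite mule_ge0// lee_fin.
apply: ge0_le_integral => //.
- by move=> tau _; apply: integral_ge0 => x _; rewrite mule_ge0// lee_fin.
- apply: (@measurable_fun_fubini_tonelli_G _ _ 'rV[R]_n Rm R (lebesgue_row n) _ mcm).
  by move=> z; rewrite mule_ge0// lee_fin.
- exact: emeasurable_funM.
move=> tau _; rewrite /fubini_G/= ge0_integralZr//.
- apply: lee_wpmul2r => //; apply: ge0_le_integral => //.
  + by move=> x _; rewrite lee_fin.
  + by apply: (measurableT_comp (mEcut r)); exact: measurable_pair2.
  + move=> x _; rewrite lee_fin; apply: cut_le; apply: le_trans re1.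
    by rewrite lerDl mulr_ge0// ltW.
- by apply: (measurableT_comp (mEcut r)); exact: measurable_pair2.
- by move=> x _; rewrite lee_fin.
Qed.

End average.

(** * The energy inequality *)

Section cutoff.
Context {R : realType} {n : nat}.
Implicit Types (c x y : 'rV[R]_n) (rho : R).

(** The square matters: the gradient is proportional to the square root of the cutoff, which lets
    Young's inequality absorb the convection term in the weighted dissipation. *)
Definition cutoff c rho x : R := pos2 (rho ^+ 2 - dist2 c x).

Lemma cutoff_ge0 c rho x : 0 <= cutoff c rho x.
Proof. exact: pos2_ge0. Qed.

Lemma cutoff_le c rho x : cutoff c rho x <= (rho ^+ 2) ^+ 2.
Proof.
rewrite /cutoff /pos2; have := dist2_ge0 c x.
have := sqr_ge0 rho; move: (rho ^+ 2) (dist2 c x) => a b a0 b0.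
by case: (leP (a - b) 0) => ab; nra.
Qed.

Lemma cutoff_eq0 c rho x : 0 < rho -> ~ eball c rho x -> cutoff c rho x = 0.
Proof.
move=> r0 /(contra_not (eballE c x r0).2)/negP; rewrite -leNgt => rx.
by rewrite /cutoff /pos2 max_r ?subr_le0// expr0n.
Qed.

Lemma cutoff_neq0 c rho x : 0 < rho -> cutoff c rho x != 0 -> eball c rho x.
Proof. by move=> r0; apply: contra_neqP; exact: cutoff_eq0. Qed.

Lemma cutoff_ge c rho rho' x : 0 < rho' -> rho' < rho -> eball c rho' x ->
  (rho ^+ 2 - rho' ^+ 2) ^+ 2 <= cutoff c rho x.
Proof.
move=> r0 rr /(eballE _ _ r0); rewrite /cutoff /pos2.
have : rho' ^+ 2 < rho ^+ 2 by rewrite !expr2; nra.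
move: (rho ^+ 2) (rho' ^+ 2) (dist2 c x) => a b d ba db.
by rewrite max_l; nra.
Qed.

Lemma continuous_cutoff c rho : continuous (cutoff c rho).
Proof.
apply: C1_continuous; apply: (@C1_pos2_comp _ _ (fun x => rho ^+ 2 - dist2 c x)).
exact: (C1D (C1_cst _ _) (C1N (C1_dist2 c))).
Qed.

Lemma measurable_cutoff c rho : measurable_fun [set: 'rV[R]_n] (cutoff c rho).
Proof. by apply: continuous_measurable_row; exact: continuous_cutoff. Qed.

Lemma grad_cutoff c rho x i : grad (cutoff c rho) x ord0 i =
  - (4 * Num.max (rho ^+ 2 - dist2 c x) 0 * (x ord0 i - c ord0 i)).
Proof.
rewrite mxE; pose f x := rho ^+ 2 - dist2 c x.
have [df _] : C1 f by exact: (C1D (C1_cst _ _) (C1N (C1_dist2 c))).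
have [dp pE] := is_derive_pos2 (f x).
rewrite -/(unit_row i) (_ : cutoff c rho = pos2 \o f)// derive_comp_real//.
rewrite derive1E pE.
have [_ ->] : is_derive x (unit_row i) f (0 - 2 * (x ord0 i - c ord0 i)).
  by apply: (@is_deriveB _ _ _ (cst (rho ^+ 2)) (dist2 c)); exact: is_derive_dist2.
by rewrite /f; ring.
Qed.

Lemma measurable_grad_cutoff c rho i :
  measurable_fun [set: 'rV[R]_n] (fun x => grad (cutoff c rho) x ord0 i).
Proof.
rewrite (_ : (fun _ => _) = fun x : 'rV[R]_n =>
    -4 * (Num.max (rho ^+ 2 - dist2 c x) 0 * (x ord0 i - c ord0 i))); last first.
  by apply/funext => x; rewrite grad_cutoff; ring.
apply: measurable_funM => //; apply: measurable_funM.
- by apply: measurable_maxr => //; apply: measurable_funB => //; exact: measurable_dist2.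
- apply: measurable_funB => //.
  by apply: continuous_measurable_row; exact: (C1_continuous (C1_coord i)).
Qed.

Lemma coord_le_norm (x : 'rV[R]_n) i : `|x ord0 i| <= `|x|.
Proof.
rewrite [leRHS]mx_normrE.
exact: (@le_bigmax _ _ _ _ (fun ij : 'I_1 * 'I_n => `|x ij.1 ij.2|) (ord0, i)).
Qed.

Let dist2_lip c rho x y : 0 < rho -> eball c rho x -> `|x - y| < rho ->
  `|dist2 c x - dist2 c y| <= n%:R * (3 * rho) * `|x - y|.
Proof.
move=> r0 /(eballE _ _ r0) xr xy; rewrite !dist2E -sumrB.
apply: le_trans (ler_norm_sum _ _ _) _.
apply: (@le_trans _ _ (\sum_(i < n) 3 * rho * `|x - y|)); last first.
  by rewrite sumr_const card_ord -[leLHS]mulr_natl !mulrA.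
apply: ler_sum => i _.
have := coord_le_norm (x - y) i; rewrite !mxE => xyi.
have xci : `|x ord0 i - c ord0 i| < rho.
  rewrite -(@ltr_pXn2r _ 2)// ?nnegrE ?(ltW r0)// real_normK ?num_real//.
  exact: le_lt_trans (dist2_coord c x i) xr.
rewrite (_ : _ - _ = (x ord0 i - y ord0 i) *
    ((x ord0 i - c ord0 i) + ((x ord0 i - c ord0 i) - (x ord0 i - y ord0 i)))); last by ring.
rewrite normrM mulrC; apply: ler_pM => //.
have := ler_normD (x ord0 i - c ord0 i) ((x ord0 i - c ord0 i) - (x ord0 i - y ord0 i)).
have := ler_normB (x ord0 i - c ord0 i) (x ord0 i - y ord0 i).
by lra.
Qed.

Lemma max0_lip (a b : R) : `|Num.max a 0 - Num.max b 0| <= `|a - b|.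
Proof.
rewrite ler_norml; have := ler_norm (a - b); have := ler_norm (- (a - b)).
rewrite normrN; move: `|a - b| => z.
by case: (leP a 0) => ?; case: (leP b 0) => ? ? ?; apply/andP; split; lra.
Qed.

(** The positive part [eta] of rho^2 - |x - c|^2 is Lipschitz: points at distance at least rho are
    covered by its bound rho^2, closer ones by the estimate for [dist2] if one lies in the ball, and
    otherwise both values vanish. Squaring costs the factor 2 rho^2. *)
Lemma lipschitz_cutoff c rho : 0 < rho -> lipschitz (cutoff c rho).
Proof.
move=> r0.
have PF : ProperFilter (globally ([set: 'rV[R]_n] `*` [set: 'rV[R]_n])).
  exact: (@globally_properfilter _ _ (0, 0)).
apply: (@klipschitzW _ _ _ ((2 * rho ^+ 2) * ((1 + 3 * n%:R) * rho))).
move=> [x y] _ /=; pose eta x := Num.max (rho ^+ 2 - dist2 c x) 0.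
have eta0 z : 0 <= eta z by rewrite /eta le_max lexx orbT.
have etale z : eta z <= rho ^+ 2.
  by rewrite /eta ge_max sqr_ge0 andbT lerBlDr lerDl dist2_ge0.
have n0 : 0 <= n%:R :> R by [].
have L : `|eta x - eta y| <= (1 + 3 * n%:R) * rho * `|x - y|.
  have [xy|xy] := ltP `|x - y| rho; last first.
    apply: (@le_trans _ _ (rho ^+ 2)).
      by rewrite ler_norml; have := eta0 x; have := eta0 y; have := etale x;
         have := etale y; move=> *; apply/andP; split; lra.
    rewrite expr2 -mulrA [leRHS]mulrDl mul1r ler_wpDr// ?ler_pM2l//.
    by rewrite !mulr_ge0// ltW.
  have xy0 : 0 <= rho * `|x - y| by rewrite mulr_ge0// ltW.
  have H a b : eball c rho a -> `|a - b| < rho ->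
      `|eta a - eta b| <= (1 + 3 * n%:R) * rho * `|a - b|.
    move=> ar ab; apply: le_trans (max0_lip _ _) _.
    rewrite (_ : _ - _ = dist2 c b - dist2 c a); last by ring.
    rewrite distrC; apply: le_trans (dist2_lip r0 ar ab) _.
    rewrite (_ : n%:R * _ = 3 * n%:R * rho); last by ring.
    by rewrite ler_wpM2r// ler_wpM2r ?lerDr// ltW.
  have [xr|xr] := pselect (eball c rho x); first exact: H.
  have [yr|yr] := pselect (eball c rho y); first by rewrite distrC (distrC x); apply: H; rewrite // distrC.
  have eta_out z : ~ eball c rho z -> eta z = 0.
    move=> /(contra_not (eballE c z r0).2)/negP; rewrite -leNgt => rz.
    by rewrite /eta max_r// subr_le0.
  rewrite !eta_out// subrr normr0 -mulrA mulr_ge0// addr_ge0// mulr_ge0//.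
have -> : cutoff c rho x - cutoff c rho y = (eta x + eta y) * (eta x - eta y).
  by rewrite /cutoff /pos2 -/(eta x) -/(eta y); ring.
rewrite normrM -[leRHS]mulrA; apply: ler_pM => //.
by rewrite ger0_norm ?addr_ge0// mulr_natl mulr2n lerD.
Qed.

Lemma Lip_c_cutoff c rho (Omega : set 'rV[R]_n) : 0 < rho ->
  [set x | dist2 c x <= rho ^+ 2] `<=` Omega -> Lip_c Omega (cutoff c rho).
Proof.
move=> r0 sO; split; first exact: lipschitz_cutoff.
have cl : closure [set x | cutoff c rho x != 0] `<=` [set x | dist2 c x <= rho ^+ 2].
  have cK : closed [set x | dist2 c x <= rho ^+ 2].
    by apply: compact_closed; [exact: norm_hausdorff|exact: compact_cball].
  rewrite [X in _ `<=` X](closure_id _).1//; apply: closureS => x /= /(cutoff_neq0 r0).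
  by move=> /(eballE _ _ r0)/ltW.
split; last exact: subset_trans sO.
apply: subclosed_compact cl; [exact: closed_closure|exact: compact_cball].
Qed.

(* Pointwise Young inequality absorbing the convection term into half of the
   dissipation, via F(u)|D_i u| <= C v|D_i v|. *)
Lemma diffusion_ge c rho (a C v : R) (p q : 'I_n -> R) x : 0 < rho -> 0 <= v -> 0 <= C ->
  eball c rho x -> 0 <= a -> (forall i, a * `|p i| <= C * v * `|q i|) ->
  2^-1 * (cutoff c rho x * \sum_i q i ^+ 2) - 8 * C ^+ 2 * rho ^+ 2 * v ^+ 2 <=
  a * (\sum_i p i * grad (cutoff c rho) x ord0 i) + (\sum_i q i ^+ 2) * cutoff c rho x.
Proof.
move=> r0 v0 C0 xr a0 apq.
pose eta := Num.max (rho ^+ 2 - dist2 c x) 0.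
have eta0 : 0 <= eta by rewrite /eta le_max lexx orbT.
have -> : cutoff c rho x = eta ^+ 2 by [].
have D : - (2^-1 * (eta ^+ 2 * \sum_i q i ^+ 2) + 8 * C ^+ 2 * v ^+ 2 * dist2 c x) <=
    a * \sum_i p i * grad (cutoff c rho) x ord0 i.
  rewrite dist2E !mulr_sumr -big_split -sumrN/=; apply: ler_sum => i _.
  rewrite grad_cutoff -/eta; set d := x ord0 i - c ord0 i.
  have H : a * (p i * (4 * eta * d)) <= C * v * `|q i| * (4 * eta * `|d|).
    apply: le_trans (ler_norm _) _; rewrite mulrA normrM [`|a * _|]normrM (ger0_norm a0).
    apply: ler_pM => //; first by rewrite mulr_ge0.
    by rewrite normrM ger0_norm// mulr_ge0.
  (* Half the square of eta |q_i| - 4 C v |d|, the 4 being that of the gradient of the cutoff; hence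
     the constant 8 = 4^2 / 2. *)
  have K : C * v * `|q i| * (4 * eta * `|d|) <=
      2^-1 * (eta ^+ 2 * q i ^+ 2) + 8 * C ^+ 2 * v ^+ 2 * d ^+ 2.
    rewrite -[q i ^+ 2]real_normK ?num_real// -[d ^+ 2]real_normK ?num_real//.
    have := sqr_ge0 (eta * `|q i| - 4 * C * v * `|d|).
    move: `|q i| `|d| => q' d'; rewrite -subr_ge0 => S; rewrite -subr_ge0.
    rewrite (_ : _ - _ = 2^-1 * (eta * q' - 4 * C * v * d') ^+ 2); last by field.
    by rewrite mulr_ge0// ?invr_ge0// sqr_ge0.
  by rewrite mulrN mulrN lerN2; exact: le_trans K.
have /ltW := (eballE _ _ r0).1 xr => dr.
have : 8 * C ^+ 2 * v ^+ 2 * dist2 c x <= 8 * C ^+ 2 * rho ^+ 2 * v ^+ 2.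
  rewrite [leRHS]mulrAC ler_wpM2l// !mulr_ge0// sqr_ge0.
rewrite (mulrC (\sum_i q i ^+ 2)).
by move: D; move: (eta ^+ 2 * _) (a * _) => X Y; lra.
Qed.

End cutoff.

(** * Time slices and Borel representatives *)

Section slices.
Context {R : realType} {n : nat}.
Local Notation Rm := (measurableTypeR R).
Local Notation nu := (lebesgue_row n \x @lebesgue_measure R)%E.

Lemma slice_measure (Z : set ('rV[R]_n * Rm)) : measurable Z ->
  nu Z = (\int[lebesgue_measure]_tau lebesgue_row n [set x | Z (x, tau)])%E /\
  measurable_fun [set: Rm] (fun tau => lebesgue_row n [set x | Z (x, tau)]).
Proof.
move=> mZ.
have -> : (fun tau => lebesgue_row n [set x | Z (x, tau)]) = lebesgue_row n \o ysection Z.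
  apply/funext => tau; rewrite /= /ysection; congr (lebesgue_row n _).
  by apply/seteqP; split => x /=; rewrite inE.
split; last exact: measurable_fun_ysection.
transitivity (\int[nu]_z (\1_Z z)%:E)%E; first by rewrite integral_indic// setIT.
rewrite indic_fubini_tonelli1//.
rewrite (@indic_fubini_tonelli _ _ 'rV[R]_n Rm R (lebesgue_row n) lebesgue_measure)//.
by rewrite indic_fubini_tonelli_GE.
Qed.

Lemma ae_slice (P : 'rV[R]_n * R -> Prop) : {ae nu, forall z, P z} ->
  {ae @lebesgue_measure R, forall tau, {ae lebesgue_row n, forall x, P (x, tau)}}.
Proof.
move=> [Z [mZ Z0 PZ]]; have [ZE mZE] := slice_measure mZ.
have : ae_eq lebesgue_measure setT (fun tau => lebesgue_row n [set x | Z (x, tau)]) (cst 0%E).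
  apply/(ae_eq_integral_abs _ measurableT mZE); rewrite -[RHS]Z0 ZE.
  by apply: eq_integral => tau _; rewrite gee0_abs.
apply: ae_imply => tau /(_ I) Zt; exists [set x | Z (x, tau)]; split => //.
- have := measurable_ysection tau mZ; rewrite (_ : ysection Z tau = [set x | Z (x, tau)])//.
  by apply/seteqP; split => x /=; rewrite /ysection/= inE.
- by move=> x /= Px; exact: PZ.
Qed.

(** The converse of slicing: a Borel set whose complement has null slices at almost every time has a
    null complement, by Tonelli. *)
Lemma ae_of_slice (S : set ('rV[R]_n * Rm)) : measurable S ->
  {ae @lebesgue_measure R, forall tau, {ae lebesgue_row n, forall x, S (x, tau)}} ->
  {ae nu, forall z, S z}.
Proof.
move=> mS H; exists (~` S); split => //; first exact: measurableC.
have [-> mE] := slice_measure (measurableC mS).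
rewrite (integral_ae_congr (g := cst 0%E)) ?integral0//.
apply: ae_imply H => tau [Z [mZ Z0 SZ]] _; apply/eqP; rewrite eq_le measure_ge0 andbT -Z0.
apply: le_measure; rewrite ?inE//.
have := measurable_ysection tau (measurableC mS).
rewrite (_ : ysection _ tau = [set x | (~` S) (x, tau)])//.
by apply/seteqP; split => x /=; rewrite /ysection/= inE.
Qed.

End slices.

Section representatives.
Context {R : realType} {n : nat}.
Local Notation Rm := (measurableTypeR R).
Local Notation nu := (lebesgue_row n \x @lebesgue_measure R)%E.
Variables (Omega : set 'rV[R]_n) (T : R).
Hypothesis oOmega : open Omega.

Let D : set ('rV[R]_n * R) := Omega `*` `]0, T[.

Lemma measurable_cylinder : measurable (D : set ('rV[R]_n * Rm)).
Proof. by apply: measurableX => //; exact: open_measurable_row. Qed.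

(** The bounds on u are given time by time, so they are first carried to the Borel version [g] on
    almost every slice, then to space-time; there [g] agrees almost everywhere with its truncation
    to [0, M]. *)
Lemma bounded_representative (M : R) (u : 'rV[R]_n * R -> R) : 0 <= M ->
  ae_measurable (lebesgue_spacetime n) (Omega `*` `[0, T]) u ->
  (forall t, 0 <= t <= T -> {ae lebesgue_row n, forall x, Omega x -> 0 <= u (x, t) <= M}) ->
  exists2 U : 'rV[R]_n * R -> R, measurable_fun [set: 'rV[R]_n * Rm] U &
    (forall z, 0 <= U z <= M) /\ {ae nu, forall z, D z -> u z = U z}.
Proof.
move=> M0 [g mg ug] ub; exists (fun z => Num.min (Num.max (g z) 0) M).
  by apply: measurable_minr => //; exact: measurable_maxr.
split.
  move=> z; rewrite le_min M0 andbT le_max lexx orbT/=.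
  by rewrite ge_min lexx orbT.
have mg' : measurable_fun [set: 'rV[R]_n * Rm] g by [].
(* The condition is stated as a set together with the complement of the cylinder so that it is Borel
   in the whole of space-time. *)
have mS : measurable (~` D `|` ([set z | 0 <= g z] `&` [set z | g z <= M]) : set ('rV[R]_n * Rm)).
  apply: measurableU; first by apply: measurableC; exact: measurable_cylinder.
  apply: measurableI.
  - rewrite -[X in measurable X]setTI (_ : [set z | 0 <= g z] = g @^-1` `[0, +oo[%classic).
      exact: mg'.
    by apply/seteqP; split => z /=; rewrite in_itv/= andbT.
  - rewrite -[X in measurable X]setTI (_ : [set z | g z <= M] = g @^-1` `]-oo, M]%classic).
      exact: mg'.
    by apply/seteqP; split => z /=; rewrite in_itv.
have gb : {ae nu, forall z, (~` D `|` ([set z | 0 <= g z] `&` [set z | g z <= M])) z}.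
  apply: ae_of_slice mS _; apply: ae_imply (ae_slice ug) => tau ugt.
  have [tT|tT] := boolP (0 <= tau <= T); last first.
    apply: filterS (filterT : {ae lebesgue_row n, forall x, True}) => x _; left => -[_ /=].
    by rewrite in_itv/= => /andP[t0 tT']; move: tT; rewrite !ltW.
  apply: ae_imply (ae_and ugt (ub _ tT)) => x [ugx ubx].
  have [Ox|Ox] := pselect (Omega x); last by left => -[].
  have uv : u (x, tau) = g (x, tau) by apply: ugx; split => //=; rewrite in_itv.
  by right; split; rewrite /= -uv; have /andP[] := ubx Ox.
apply: ae_imply (ae_and ug gb) => z [ugz gz] Dz.
have [|[/= g0 gM]] := gz; first by case.
rewrite max_l// min_l// ugz//; case: Dz => ? /=; rewrite in_itv/= => /andP[? ?].
by split => //=; rewrite in_itv/= !ltW.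
Qed.

Lemma L2_representative (f : 'rV[R]_n * R -> R) :
  Lp_loc 2 (Omega `*` `]0, T]) f ->
  exists g : 'rV[R]_n * R -> R, [/\ measurable_fun [set: 'rV[R]_n * Rm] g,
    {ae nu, forall z, D z -> f z = g z} &
    forall K, compact K -> K `<=` Omega `*` `]0, T] ->
      (\int[nu]_(z in K) (g z ^+ 2)%:E < +oo)%E].
Proof.
move=> [[g mg fg] fK]; exists g; split => //.
  apply: ae_imply fg => z fgz [Oz /=]; rewrite in_itv/= => /andP[z0 zT].
  by apply: fgz; split => //=; rewrite in_itv/= z0 ltW.
move=> K cK KO; apply: le_lt_trans (fK K cK KO).
rewrite le_eqVlt; apply/orP; left; apply/eqP; apply: integral_ae_congr.
apply: ae_imply fg => z fgz Kz; rewrite fgz; last exact: KO.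
by rewrite powR_mulrn// real_normK// num_real.
Qed.

(** Test functions supported in the inner cylinder do not see the truncation of the gradient to its
    closure, and the truncation makes a locally integrable gradient integrable on the whole
    space. *)
Lemma weak_partial_of (i : 'I_n) (f g U G : 'rV[R]_n * R -> R) c r s t : 0 < r -> s < t ->
  cbox c r s t `<=` D ->
  weak_derivative D (unit_row i, 0) f g ->
  {ae nu, forall z, D z -> f z = U z} -> {ae nu, forall z, D z -> g z = G z} ->
  weak_partial i U (fun z => G z * \1_(cbox c r s t) z) c r s t.
Proof.
move=> r0 st KD w fU gG phi [dphi cphi] sphi.
have cl : closure [set z | phi z != 0] `<=` cbox c r s t.
  rewrite [X in _ `<=` X](closure_id _).1; last exact: closed_cbox.
  by apply: closureS => z /= /sphi; exact: box_cbox.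
have /w wphi : C1_c D phi.
  split => //; split; last exact: subset_trans KD.
  by apply: subclosed_compact cl; [exact: closed_closure|exact: compact_cbox].
have [C DC] := C1_supported_bound (unit_row i, 0) (conj dphi cphi) sphi.
have D0 z : ~ D z -> 'D_(unit_row i, 0) phi z = 0.
  move=> Dz; have := DC z; rewrite indicE memNset ?mulr0 ?normr_le0; first by move/eqP.
  by move=> /KD.
have phi0 z : ~ cbox c r s t z -> phi z = 0.
  by move=> Kz; apply: contrapT => /eqP/sphi/box_cbox.
transitivity (\int[nu]_(z in D) (f z * 'D_(unit_row i, 0) phi z)).
  rewrite [RHS]Rintegral_mkcond; apply: Rintegral_ae_congr.
  apply: ae_imply fU => z fUz _; rewrite patchE; case: ifPn => [/set_mem Dz|Dz].
    by rewrite fUz.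
  by rewrite D0 ?mulr0//; rewrite notin_setE in Dz.
transitivity (- \int[nu]_(z in D) (g z * phi z)); first exact: wphi.
congr (- _); rewrite [LHS]Rintegral_mkcond; apply: Rintegral_ae_congr.
apply: ae_imply gG => z gGz _; rewrite patchE.
have [Kz|Kz] := pselect (cbox c r s t z).
  by rewrite mem_set ?gGz ?indicE ?mem_set ?mulr1//; exact: KD.
by rewrite phi0// !mulr0; case: ifPn.
Qed.

End representatives.

Lemma measurable_comp_nneg d (X : measurableType d) (R : realType) (f : R -> R) (g : X -> R) :
  measurable_fun (`[0, +oo[ : set R) f -> measurable_fun setT g -> (forall x, 0 <= g x) ->
  measurable_fun setT (fun x => f (g x)).
Proof.
move=> mf mg g0; apply: (@measurable_comp _ _ _ _ _ _ (`[0, +oo[ : set R) f setT g) => //.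
by move=> _ [x _ <-]; rewrite /= in_itv/= g0.
Qed.

Lemma fine_le_EFin (R : realType) (x : \bar R) (e : R) :
  (0 <= x)%E -> (x <= e%:E)%E -> fine x <= e.
Proof. by case: x => [a| |]. Qed.

(** * Vanishing of the weighted energy at the initial time *)

Section initial_decay.
Context {R : realType} {n : nat}.
Variables (h P : R -> R) (hP : nonlinearities h P) (M : R) (M0 : 0 < M).
Variables (Omega : set 'rV[R]_n) (T : R) (T0 : 0 < T) (u : 'rV[R]_n * R -> R).
Local Notation H := (H_of h).
Local Notation mu := (lebesgue_row n).

Lemma slice_representative t :
  ae_measurable (lebesgue_row n) Omega (fun x => u (x, t)) ->
  {ae lebesgue_row n, forall x, Omega x -> 0 <= u (x, t) <= M} ->
  exists2 g : 'rV[R]_n -> R, measurable_fun setT g &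
    (forall x, 0 <= g x <= M) /\ {ae lebesgue_row n, forall x, Omega x -> u (x, t) = g x}.
Proof.
move=> [g mg ug] ub; exists (fun z => Num.min (Num.max (g z) 0) M).
  by apply: measurable_minr => //; exact: measurable_maxr.
split.
  move=> z; rewrite le_min (ltW M0) andbT le_max lexx orbT/=.
  by rewrite ge_min lexx orbT.
apply: ae_imply (ae_and ug ub) => x [ugx ubx] Ox.
have /andP[u0 uM] := ubx Ox.
by rewrite -ugx// max_l// min_l.
Qed.

Hypothesis slices : forall t, 0 <= t <= T ->
  ae_measurable (lebesgue_row n) Omega (fun x => u (x, t)).
Hypothesis bounds : forall t, 0 <= t <= T ->
  {ae lebesgue_row n, forall x, Omega x -> 0 <= u (x, t) <= M}.
Hypothesis ucvg : cvg_local_measure_at0 Omega u.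

(** Where u(s) is below a small level, H(u) is small by continuity of H at 0; the rest of the ball
    has small measure by convergence in measure to the zero datum, and there H(u) <= H(M). *)
Lemma initial_decay c rho e d : 0 < rho -> 0 < e -> 0 < d ->
  [set x | dist2 c x <= rho ^+ 2] `<=` Omega ->
  (forall x, dist2 c x <= rho ^+ 2 -> u (x, 0) = 0) ->
  exists2 s, 0 < s < d & \int[lebesgue_row n]_(x in Omega)
    (cutoff c rho x * H (u (x, s))) <= e.
Proof.
move=> r0 e0 d0 KO u00; set K := [set x | dist2 c x <= rho ^+ 2].
have mB : measurable (eball c rho) := measurable_eball c rho.
have Bfin : mu (eball c rho) \is a fin_num by rewrite ge0_fin_numE// eball_fin.
pose m := fine (mu (eball c rho)).
have m0 : 0 <= m by exact: fine_ge0.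
have HM0 : 0 <= H M := H_of_ge0 hP M.
set q := (rho ^+ 2) ^+ 2; have q0 : 0 <= q by exact: sqr_ge0.
(* The two parts contribute at most q m e1 and q H(M) e1, whose sum does not exceed e; the added 1
   avoids a zero denominator. *)
pose e1 := e / (q * (m + H M) + 1).
have den0 : 0 < q * (m + H M) + 1 by rewrite ltr_wpDl// mulr_ge0// addr_ge0.
have e10 : 0 < e1 by rewrite divr_gt0.
have [eta eta0 Heta] := H_of_small hP e10.
have near1 : \forall s \near 0^'+,
    (mu_ext mu [set x | K x /\ (eta <= `|u (x, s) - u (x, 0%R)|)%R] < e1%:E)%E.
  have /(_ [set y | (y < e1%:E)%E]) := ucvg (@compact_cball R n c rho) KO eta0.
  apply; apply: open_nbhs_nbhs; split; first exact: open_ereal_lt_ereal.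
  by rewrite /= lte_fin.
have pf : ProperFilter (0 : R)^'+ by exact: at_right_proper_filter.
have [s [Es [s0 [sd sT]]]] : exists s : R, (mu_ext mu
    [set x | K x /\ (eta <= `|u (x, s) - u (x, 0%R)|)%R] < e1%:E)%E /\
    (0 < s /\ (s < d /\ s <= T)).
  apply: (@filter_ex _ _ pf); apply: filterI near1 _.
  apply: filterI (nbhs_right_gt _) _.
  by apply: filterI (nbhs_right_lt _) (nbhs_right_le _).
exists s; first by rewrite s0.
have sT' : 0 <= s <= T by rewrite sT ltW.
have [g mg [gM ug]] := slice_representative (slices sT') (bounds sT').
have g0 x : 0 <= g x by have /andP[] := gM x.
have mH : measurable_fun setT (fun x => H (g x)).
  exact: measurable_comp_nneg (measurable_H_of hP) mg g0.
pose A := eball c rho `&` [set x | eta <= g x].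
have mA : measurable A.
  apply: measurableI => //.
  rewrite -[X in measurable X]setTI (_ : [set x | eta <= g x] = g @^-1` `[eta, +oo[%classic).
    exact: mg.
  by apply/seteqP; split => z /=; rewrite in_itv/= andbT.
have BK x : eball c rho x -> K x by move=> /(eballE _ _ r0)/ltW.
(* Convergence in measure controls u itself, in outer measure; passing to the representative [g]
   costs only the null set [Z]. *)
have muA : (mu A <= e1%:E)%E.
  have [Z [mZ Z0 sZ]] := ug; rewrite -(measurable_mu_extE _ mA).
  apply: (@le_trans _ _ (mu_ext mu ([set x | K x /\ (eta <= `|u (x, s) - u (x, 0%R)|)%R] `|` Z))).
    apply: le_mu_ext => x [Bx gx]; have [Zx|Zx] := pselect (Z x); [by right|left].
    have ugx : Omega x -> u (x, s) = g x.
      by apply: contrapT => ne; apply: Zx; exact: sZ.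
    split; first exact: BK.
    rewrite (u00 _ (BK _ Bx)) subr0 ugx; last exact/KO/BK.
    by rewrite ger0_norm.
  apply: le_trans (outer_measureU2 _ _ _) _.
  rewrite [X in (_ + X)%E](_ : _ = 0%E); first by rewrite adde0 ltW.
  by rewrite -[RHS]Z0 -(measurable_mu_extE _ mZ).
have tH x : cutoff c rho x * H (g x) <= q * e1 * \1_(eball c rho) x + q * H M * \1_A x.
  have [Bx|Bx] := pselect (eball c rho x); last first.
    by rewrite cutoff_eq0// mul0r; apply: addr_ge0; apply: mulr_ge0 => //; apply: mulr_ge0 => //; exact: ltW.
  rewrite indicE mem_set//= mulr1 indicE.
  have cq := cutoff_le c rho x; have c0 := cutoff_ge0 c rho x.
  have [gx|gx] := leP eta (g x).
    rewrite mem_set//= mulr1 (@le_trans _ _ (q * H M))//.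
      apply: ler_pM => //; first exact: (H_of_ge0 hP).
      by apply: (H_of_le hP) => //; have /andP[] := gM x.
    by rewrite lerDr mulr_ge0// ltW.
  apply: (@le_trans _ _ (q * e1)); last by rewrite lerDl; apply: mulr_ge0 => //; exact: mulr_ge0.
  apply: ler_pM => //; first exact: (H_of_ge0 hP).
  by apply: le_trans Heta; apply: (H_of_le hP) => //; exact: ltW.
have -> : \int[mu]_(x in Omega) (cutoff c rho x * H (u (x, s))) =
    \int[mu]_x (cutoff c rho x * H (g x)).
  rewrite Rintegral_mkcond; apply: Rintegral_ae_congr.
  apply: ae_imply ug => x ugx _; rewrite patchE; case: ifPn => [/set_mem Ox|Ox].
    by rewrite ugx.
  rewrite cutoff_eq0 ?mul0r// => /BK/KO Ox'.
  by move: Ox; rewrite mem_set.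
apply: fine_le_EFin.
  by apply: integral_ge0 => x _; rewrite lee_fin mulr_ge0 ?cutoff_ge0// (H_of_ge0 hP).
apply: (@le_trans _ _ (\int[mu]_x ((q * e1)%:E * (\1_(eball c rho) x)%:E +
    (q * H M)%:E * (\1_A x)%:E))%E).
  apply: ge0_le_integral => //.
  - by move=> x _; rewrite lee_fin mulr_ge0 ?cutoff_ge0// (H_of_ge0 hP).
  - by apply/measurable_EFinP; apply: measurable_funM => //; exact: measurable_cutoff.
  - by apply: emeasurable_funD; apply: measurable_funeM; apply/measurable_EFinP;
      exact: measurable_indic.
  - by move=> x _; rewrite -!EFinM -EFinD lee_fin; exact: tH.
rewrite ge0_integralD//; last 4 first.
- by move=> x _; rewrite -EFinM lee_fin; apply: mulr_ge0 => //; apply: mulr_ge0 => //; exact: ltW.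
- by apply: measurable_funeM; apply/measurable_EFinP; exact: measurable_indic.
- by move=> x _; rewrite -EFinM lee_fin; apply: mulr_ge0 => //; exact: mulr_ge0.
- by apply: measurable_funeM; apply/measurable_EFinP; exact: measurable_indic.
rewrite !ge0_integralZl_EFin//; do ?[by apply/measurable_EFinP; exact: measurable_indic
  |by rewrite mulr_ge0// ltW|by move=> x _; rewrite lee_fin].
rewrite !integral_indic// !setIT.
apply: (@le_trans _ _ ((q * e1)%:E * m%:E + (q * H M)%:E * e1%:E)%E).
  apply: leeD; first by rewrite /m fineK.
  by apply: lee_wpmul2l => //; rewrite lee_fin mulr_ge0.
rewrite -!EFinM -EFinD lee_fin (_ : _ + _ = e * ((q * (m + H M)) / (q * (m + H M) + 1))); last first.
  by rewrite /e1; field; rewrite gt_eqF.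
by rewrite ger_pMr// ler_pdivrMr// mul1r lerDl.
Qed.

End initial_decay.

Section integrability.
Context d (X : measurableType d) (R : realType).
Variable mu : {measure set X -> \bar R}.

Lemma bounded_mul_integrable (f g : X -> R) (C : R) :
  measurable_fun setT f -> (forall x, `|f x| <= C) -> mu.-integrable setT (EFin \o g) ->
  mu.-integrable setT (EFin \o (fun x => f x * g x)).
Proof.
move=> mf fC ig; have mg : measurable_fun setT g.
  by apply/measurable_EFinP; exact: measurable_int ig.
apply: (@le_integrable _ _ _ mu setT measurableT _ (fun x => (C%:E * (EFin \o g) x)%E)).
- by apply/measurable_EFinP; exact: measurable_funM.
- move=> x _; rewrite /= lee_fin normrM.
  by rewrite normrM ler_wpM2r// (le_trans (fC x))// ler_norm.
- exact: integrableZl.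
Qed.

Lemma L2_integrable (g : X -> R) (K : set X) :
  measurable_fun setT g -> measurable K -> (mu K < +oo)%E ->
  (\int[mu]_(x in K) (g x ^+ 2)%:E < +oo)%E ->
  mu.-integrable setT (EFin \o (fun x => g x * \1_K x)) /\
  mu.-integrable setT (EFin \o (fun x => g x ^+ 2 * \1_K x)).
Proof.
move=> mg mK Koo gK; have m1 : measurable_fun setT (\1_K : X -> R) by exact: measurable_indic.
have i2 : mu.-integrable setT (EFin \o (fun x => g x ^+ 2 * \1_K x)).
  apply/integrableP; split.
    by apply/measurable_EFinP; apply: measurable_funM => //; exact: measurable_funX.
  apply: le_lt_trans gK; rewrite [leRHS]integral_mkcond le_eqVlt; apply/orP; left; apply/eqP.
  apply: eq_integral => x _; rewrite patchE/= indicE; case: ifPn => xK.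
    by rewrite mulr1 ger0_norm// sqr_ge0.
  by rewrite mulr0 normr0.
have i1 : mu.-integrable setT (EFin \o (\1_K : X -> R)).
  apply: (@bounded_support_integrable _ _ _ _ _ 1 K) => // x.
  by rewrite mul1r ger0_norm.
split=> //; apply: (@le_integrable _ _ _ mu setT measurableT _
    (fun x => ((\1_K x : R)%:E + (g x ^+ 2 * \1_K x)%R%:E)%E)).
- by apply/measurable_EFinP; exact: measurable_funM.
- move=> x _; rewrite /= lee_fin indicE; case: (x \in K) => /=; last by rewrite !mulr0 addr0.
  rewrite mulr1n !mulr1 [leRHS]ger0_norm ?addr_ge0 ?sqr_ge0//.
  rewrite -[g x ^+ 2]real_normK ?num_real//; have := sqr_ge0 (`|g x| - 2^-1).
  by rewrite !expr2; move: `|g x| => y; nra.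
- exact: integrableD.
Qed.

End integrability.

Section spacetime_fubini.
Context {R : realType} {n : nat}.
Local Notation Rm := (measurableTypeR R).
Local Notation nu := (lebesgue_row n \x @lebesgue_measure R)%E.

Lemma Rintegral_spacetime (f : 'rV[R]_n * R -> R) :
  nu.-integrable [set: 'rV[R]_n * Rm] (EFin \o f) ->
  \int[lebesgue_measure]_tau \int[lebesgue_row n]_x f (x, tau) = \int[nu]_z f z.
Proof.
move=> fi; rewrite /Rintegral.
rewrite -(@integral21_prod_meas1 _ _ 'rV[R]_n Rm R (lebesgue_row n) lebesgue_measure _ fi).
congr fine; apply: integral_ae_congr.
apply: ae_imply (@ae_integrable2 _ _ 'rV[R]_n Rm R (lebesgue_row n) lebesgue_measure _ fi) => tau it _.
by rewrite fineK// integrable_fin_num.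
Qed.

(** Gradients are integrable only away from time 0. Bounds independent of the starting time s reach
    ]0, t[ by monotone convergence. *)
Lemma integral_box_limit (f : 'rV[R]_n * Rm -> \bar R) c r t A : 0 < t ->
  measurable_fun setT f -> (forall z, 0 <= f z)%E ->
  (forall s, 0 < s < t -> (\int[nu]_(z in box c r s t) f z <= A)%E) ->
  (\int[nu]_(z in box c r 0 t) f z <= A)%E.
Proof.
move=> t0 mf f0 fA.
(* The divisor k + 2, rather than k + 1, keeps the lower end strictly below t from the start. *)
pose F (k : nat) := box c r (t / k.+2%:R) t : set ('rV[R]_n * Rm).
have UF : \bigcup_k F k = box c r 0 t.
  apply/seteqP; split=> [[x a] [k _ [/= xr]]|[x a] [/= xr]].
    rewrite in_itv/= => /andP[ka at_]; split => //=; rewrite in_itv/= at_ andbT.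
    by apply: lt_trans ka; rewrite divr_gt0.
  rewrite in_itv/= => /andP[a0 at_].
  exists (Num.trunc (t / a)) => //; split => //=; rewrite in_itv/= at_ andbT.
  rewrite ltr_pdivrMr// mulrC -ltr_pdivrMr//.
  apply: lt_trans (truncnS_gt _) _.
  by rewrite ltr_nat.
rewrite -UF; have := @ge0_nondecreasing_set_cvg_integral _ ('rV[R]_n * Rm)%type R F f nu.
move=> /(_ _ _ _ _)/cvg_lim <-//.
- apply: lime_le => //.
    apply: ereal_nondecreasing_is_cvgn; apply: ge0_nondecreasing_set_nondecreasing_integral => //.
    + apply/nondecreasing_seqP => k; apply/subsetPset => -[x a] [/= xr].
      rewrite in_itv/= => /andP[ka at_]; split => //=; rewrite in_itv/= at_ andbT.
      by apply: le_lt_trans ka; rewrite ler_pM2l// lef_pV2 ?posrE// ler_nat.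
    + by move=> k; exact: measurable_box.
    + by move=> k; exact: measurable_funTS.
  near=> k; apply: fA; rewrite divr_gt0//=.
  by rewrite ltr_pdivrMr// ltr_pMr// ltr1n.
- apply/nondecreasing_seqP => k; apply/subsetPset => -[x a] [/= xr].
  rewrite in_itv/= => /andP[ka at_]; split => //=; rewrite in_itv/= at_ andbT.
  by apply: le_lt_trans ka; rewrite ler_pM2l// lef_pV2 ?posrE// ler_nat.
- by move=> k; exact: measurable_box.
- by move=> k; exact: measurable_funTS.
Unshelve. all: by end_near.
Qed.

End spacetime_fubini.

Lemma ae_neq_real (R : realType) (a : R) : {ae @lebesgue_measure R, forall t, t != a}.
Proof.
exists [set a]; split => //; first exact: lebesgue_measure_set1.
by move=> t /= /negP; rewrite negbK => /eqP.
Qed.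

Lemma indic_in (X : Type) (R : pzRingType) (A : set X) x : A x -> \1_A x = 1 :> R.
Proof. by move=> Ax; rewrite indicE mem_set. Qed.

Lemma indic_out (X : Type) (R : pzRingType) (A : set X) x : ~ A x -> \1_A x = 0 :> R.
Proof. by move=> Ax; rewrite indicE memNset. Qed.

(** * Arithmetic of the energy inequality and of the radii *)

Lemma energy_transport (R : realType) (a b i x y k : R) :
  a - b + i <= 0 -> 2^-1 * x - k * y <= i -> a + 2^-1 * x <= b + k * y.
Proof. by lra. Qed.

Lemma energy_relax (R : realType) (a b e x x' y y' k : R) :
  0 <= k -> x <= x' -> y' <= y -> b <= e ->
  a + 2^-1 * x' <= b + k * y' -> a + 2^-1 * x <= k * y + e.
Proof. by move=> k0 xx /(ler_wpM2l k0); move: (k * y) (k * y') => p q; lra. Qed.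

Lemma energy_double (R : realType) (a x y k l : R) :
  0 <= a -> a + 2^-1 * x <= 8 * k * l * y -> x <= 16 * k * l * y.
Proof. by rewrite -!mulrA; move: (k * (l * y)) => z; lra. Qed.

Lemma energy_half (R : realType) (a x y k l : R) :
  0 <= x -> 0 <= y -> 0 <= k * l -> a + 2^-1 * x <= 8 * k * l * y -> a <= 16 * k * l * y.
Proof.
move=> x0 y0 kl; have := mulr_ge0 kl y0.
by rewrite -!mulrA; move: (k * (l * y)) => z; lra.
Qed.

Lemma level_lt (R : realType) (r' r1 k : R) : r' < r1 -> 1 <= k ->
  r' + (r1 - r') / 2 / k < r1.
Proof.
move=> rr k1; have k0 : 0 < k := lt_le_trans ltr01 k1.
rewrite -ltrBrDl ltr_pdivrMr//; have := ler_wpM2l (_ : 0 <= r1 - r') k1.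
by rewrite subr_ge0 => /(_ (ltW rr)); lra.
Qed.

(** The squares of the radii r' + g/k and r' + (3/4) g/k differ by at least g r' / (4 k); squaring
    this in the denominator turns 16 into 256 = 16 x 4^2 and gives growth k^2 of the constant, that
    is 4^j when k = 2^j. *)
Lemma level_bound (R : realType) (C r' r1 g k y : R) :
  r' + g / k <= r1 -> 0 < r' -> 0 < g -> 0 < k -> 0 <= y ->
  ((r' + g / k) ^+ 2 - (r' + 3 / 4 * (g / k)) ^+ 2) ^- 2 *
    (16 * C ^+ 2 * (r' + g / k) ^+ 2 * y) <=
  256 * C ^+ 2 * r1 ^+ 2 / (g ^+ 2 * r' ^+ 2) * k ^+ 2 * y.
Proof.
move=> rr r0 g0 k0 y0; set rho := r' + g / k in rr *.
have gk0 : 0 < g / k by rewrite divr_gt0.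
have rho0 : 0 < rho by rewrite addr_gt0.
have r10 : 0 < r1 := lt_le_trans rho0 rr.
have d0 : 0 < (g / k / 4 * r') ^+ 2 by rewrite exprn_gt0// mulr_gt0// divr_gt0.
have -> : 256 * C ^+ 2 * r1 ^+ 2 / (g ^+ 2 * r' ^+ 2) * k ^+ 2 * y =
    (g / k / 4 * r') ^- 2 * (16 * C ^+ 2 * r1 ^+ 2 * y).
  by field; rewrite !gt_eqF.
have dd : (g / k / 4 * r') ^+ 2 <= (rho ^+ 2 - (r' + 3 / 4 * (g / k)) ^+ 2) ^+ 2.
  have le_d : g / k / 4 * r' <= rho ^+ 2 - (r' + 3 / 4 * (g / k)) ^+ 2.
    rewrite /rho; move: (g / k) gk0 => x x0; rewrite -subr_ge0.
    rewrite (_ : _ - _ = x * r' / 4 + 7 / 16 * x ^+ 2); last by field.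
    by rewrite addr_ge0// ?divr_ge0 ?mulr_ge0 ?sqr_ge0// ltW.
  have d1 : 0 <= g / k / 4 * r' by rewrite mulr_ge0 ?divr_ge0 ?ltW.
  by rewrite ler_pXn2r// nnegrE// (le_trans d1).
apply: ler_pM.
- by rewrite invr_ge0 sqr_ge0.
- by rewrite mulr_ge0// mulr_ge0 ?sqr_ge0// mulr_ge0// sqr_ge0.
- by rewrite lef_pV2// posrE// (lt_le_trans d0).
- apply: ler_wpM2r => //; apply: ler_wpM2l; first by rewrite mulr_ge0 ?sqr_ge0.
  by rewrite ler_pXn2r// ?nnegrE ltW.
Qed.

(** The intermediate radius, at 3/4 of the gap, exceeds the next one, at 1/2, by g / 2^k / 4: room
    for n axis moves of length e0 / 2^k. *)
Lemma level_gap (R : realType) (r' g e0 : R) (n k : nat) : 0 < n%:R :> R ->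
  e0 <= g / (4 * n%:R) ->
  r' + g / 2 ^+ k.+1 + e0 / 2 ^+ k * n%:R <= r' + 3 / 4 * (g / 2 ^+ k).
Proof.
move=> n0; rewrite ler_pdivlMr ?mulr_gt0// => en.
have k2 : 0 < 2 ^+ k :> R by rewrite exprn_gt0.
rewrite -addrA lerD2l exprS -subr_ge0.
have -> : 3 / 4 * (g / 2 ^+ k) - (g / (2 * 2 ^+ k) + e0 / 2 ^+ k * n%:R) =
    (g - e0 * (4 * n%:R)) / (4 * 2 ^+ k) by field; rewrite gt_eqF.
by rewrite divr_ge0 ?subr_ge0// mulr_ge0// ltW.
Qed.

Lemma lee_geometric0 (R : realType) (x : \bar R) (y q : R) : 0 < q -> q < 1 ->
  (forall k : nat, x <= (y * q ^+ k)%:E)%E -> (x <= 0)%E.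
Proof.
move=> q0 q1; case: x => [x| |] xk //; last by have := xk 0%N.
have cq : (fun k : nat => y * q ^+ k) @ \oo --> (0 : R).
  by apply: cvg_geometric; rewrite ger0_norm// ltW.
rewrite lee_fin -(cvg_lim _ cq)//; apply: limr_ge; first exact: cvgP cq.
by apply: nearW => k; have := xk k; rewrite lee_fin.
Qed.

(** * Geometric decay *)

Section geometric_decay.
Variable R : realType.

Lemma powRX (x a : R) k : 0 <= x -> (x ^+ k) `^ a = (x `^ a) ^+ k.
Proof.
by move=> x0; rewrite -powR_mulrn// -powRrM mulrC powRrM powR_mulrn// powR_ge0.
Qed.

(* With q = 2^n kappa^2 and delta_k = kappa^k, the condition 4 q <= kappa^p makes
   both terms of the square of order kappa^k; it can be met since p < 2. *)
Lemma geometric_decay (n : nat) (p C beta L y e1 : R) : 1 <= p < 2 -> 0 <= C ->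
  0 <= beta -> 0 < L -> 0 < y -> 0 < e1 ->
  exists e0 q t0 : R, [/\ 0 < e0 <= e1, 0 < q < 1, 0 < t0 &
    forall (t : R) (Y : nat -> R), 0 < t <= t0 -> (forall k, 0 <= Y k) -> Y 0 <= y ->
    (forall k d, 0 < d -> (e0 / 2 ^+ k) ^+ n * Y k.+1 <=
      (e0 / 2 ^+ k) ^+ n * (4 ^+ n * ((e0 / 2 ^+ k) ^+ 2 * (L * 4 ^+ k * Y k))) +
      2 * (t * (d * beta + d `^ (1 - p) * (C * (L * 4 ^+ k * Y k))) ^+ 2)) ->
    forall k, Y k <= y * q ^+ k].
Proof.
move=> /andP[p1 p2] C0 beta0 L0 y0 e10.
have p20 : 0 < 2 - p by rewrite subr_gt0.
(* This solves 2^(n+2) ka^2 = ka^p, so that 4 q = ka^p holds with equality. *)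
pose ka : R := (2 ^+ n.+2)^-1 `^ (2 - p)^-1.
have ka0 : 0 < ka by rewrite powR_gt0// invr_gt0 exprn_gt0.
have kap : ka `^ (2 - p) = (2 ^+ n.+2)^-1.
  by rewrite -powRrM mulVf ?gt_eqF// powRr1// invr_ge0 exprn_ge0.
(* The factor 2^n offsets the volume (e0 / 2^k)^n of the averaging cube on the left of the
   recursion. *)
pose q := 2 ^+ n * ka ^+ 2.
have q0 : 0 < q by rewrite mulr_gt0 ?exprn_gt0.
have q4 : 4 * q <= ka `^ p.
  rewrite /q; have -> : ka ^+ 2 = ka `^ (2 - p) * ka `^ p.
    by rewrite -powRD ?subrK ?powR_mulrn ?(ltW ka0)// (gt_eqF ka0) implybT.
  rewrite kap !exprS mulrA.
  rewrite le_eqVlt; apply/orP; left; apply/eqP; field.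
  by rewrite gt_eqF// exprn_gt0.
have ka1 : ka <= 1.
  rewrite (_ : 1 = 1 `^ (2 - p)^-1); last by rewrite powR1.
  apply: ge0_ler_powR; rewrite ?nnegrE ?invr_ge0 ?(ltW p20)//.
  by rewrite invf_le1 ?exprn_gt0// exprn_ege1// ler1n.
have q1 : q < 1.
  have p0 : 0 <= p := le_trans ler01 p1.
  have : ka `^ p <= 1 `^ p by apply: ge0_ler_powR; rewrite ?nnegrE ?(ltW ka0).
  by rewrite powR1; lra.
(* With e0 <= a and e0 <= 1, the gradient term contributes at most the fraction q / 2 of the bound
   at level k. *)
pose a := q / (2 * (4 ^+ n * L)).
have a0 : 0 < a by rewrite divr_gt0// !mulr_gt0// exprn_gt0.
pose e0 := Num.min e1 (Num.min 1 a).
have e00 : 0 < e0 by rewrite !lt_min e10 ltr01.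
have e0a : 4 ^+ n * (e0 ^+ 2 * L) <= q / 2.
  have e01 : e0 <= 1 by rewrite !ge_min lexx orbT.
  have e0a' : e0 <= a by rewrite !ge_min lexx !orbT.
  have : e0 ^+ 2 <= a by rewrite expr2 (le_trans _ e0a')// ler_piMr// ltW.
  rewrite /a ler_pdivlMr ?mulr_gt0 ?exprn_gt0//.
  by rewrite ler_pdivlMr//; move: (4 ^+ n) (e0 ^+ 2) => b c; nra.
pose W := beta + C * (L * y).
have W0 : 0 <= W by rewrite addr_ge0// !mulr_ge0// ltW.
(* For times up to [t0] the mass term contributes at most the other q / 2; [W] bounds the square
   root of its k-independent part. *)
pose t0 := e0 ^+ n * q * y / (4 * (W ^+ 2 + 1)).
have W1 : 0 < W ^+ 2 + 1 by rewrite ltr_wpDl ?sqr_ge0.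
have t00 : 0 < t0 by rewrite divr_gt0 ?mulr_gt0 ?exprn_gt0.
exists e0, q, t0; split => //; rewrite ?e00 ?q0 ?q1//= ?ge_min ?lexx//.
move=> t Y /andP[tgt0 tle] Y0 Yy rec; elim=> [|k ih]; first by rewrite expr0 mulr1.
have E0 : 0 < (e0 / 2 ^+ k) ^+ n by rewrite exprn_gt0// divr_gt0// exprn_gt0.
(* The truncation level d of the recursion is chosen as ka^k. *)
rewrite -(ler_pM2l E0); apply: le_trans (rec k (ka ^+ k) _) _; first by rewrite exprn_gt0.
have k2 : 0 < 2 ^+ k :> R by rewrite exprn_gt0.
have Yk0 := Y0 k.
have T1 : 4 ^+ n * ((e0 / 2 ^+ k) ^+ 2 * (L * 4 ^+ k * Y k)) <= q / 2 * (y * q ^+ k).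
  rewrite (_ : _ * _ = 4 ^+ n * (e0 ^+ 2 * L) * Y k); last first.
    rewrite (_ : 4 ^+ k = (2 ^+ k) ^+ 2); last by rewrite -exprM mulnC exprM (_ : 2 ^+ 2 = 4)//; ring.
    by field; rewrite gt_eqF.
  by apply: ler_pM => //; rewrite !mulr_ge0 ?exprn_ge0 ?sqr_ge0// ltW.
have T2 : ka ^+ k * beta + (ka ^+ k) `^ (1 - p) * (C * (L * 4 ^+ k * Y k)) <= ka ^+ k * W.
  rewrite /W mulrDr lerD2l.
  apply: (@le_trans _ _ ((ka ^+ k) `^ (1 - p) * (4 * q) ^+ k * (C * (L * y)))).
    rewrite exprMn (_ : _ * _ * (C * _) = (ka ^+ k) `^ (1 - p) * (C * (L * 4 ^+ k * (y * q ^+ k)))); last by ring.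
    by rewrite !ler_wpM2l ?powR_ge0// ?mulr_ge0 ?exprn_ge0// ltW.
  rewrite ler_wpM2r ?mulr_ge0// ?(ltW L0) ?(ltW y0)//.
  apply: (@le_trans _ _ ((ka `^ (1 - p)) ^+ k * (ka `^ p) ^+ k)).
    rewrite powRX ?(ltW ka0)// ler_wpM2l ?exprn_ge0 ?powR_ge0//.
    by rewrite lerXn2r// ?nnegrE ?powR_ge0// mulr_ge0// ltW.
  rewrite -exprMn -powRD ?(gt_eqF ka0) ?implybT//.
  by rewrite (_ : 1 - p + p = 1) ?powRr1 ?(ltW ka0)//; ring.
have T3 : (ka ^+ k * beta + (ka ^+ k) `^ (1 - p) * (C * (L * 4 ^+ k * Y k))) ^+ 2 <= (ka ^+ k * W) ^+ 2.
  rewrite lerXn2r// ?nnegrE ?mulr_ge0 ?exprn_ge0 ?(ltW ka0)//.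
  by rewrite addr_ge0 ?mulr_ge0 ?exprn_ge0 ?powR_ge0 ?(ltW ka0) ?(ltW L0).
have T4 : 2 * (t * (ka ^+ k * W) ^+ 2) <= (e0 / 2 ^+ k) ^+ n * (q / 2 * (y * q ^+ k)).
  have -> : (e0 / 2 ^+ k) ^+ n * (q / 2 * (y * q ^+ k)) = e0 ^+ n * q * y / 2 * (ka ^+ k) ^+ 2.
    have e2 : (e0 / 2 ^+ k) ^+ n * (2 ^+ n) ^+ k = e0 ^+ n.
      rewrite exprMn exprVn -!exprM (mulnC n k) mulfVK// gt_eqF// exprn_gt0//.
    by rewrite [q ^+ k]exprMn -e2 (exprAC ka k 2); move: ((e0 / 2 ^+ k) ^+ n) ((2 ^+ n) ^+ k) ((ka ^+ 2) ^+ k) => *; field.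
  rewrite (_ : 2 * _ = 2 * (t * W ^+ 2) * (ka ^+ k) ^+ 2); last by ring.
  rewrite ler_wpM2r ?sqr_ge0//.
  move: tle; rewrite /t0 ler_pdivlMr ?mulr_gt0//.
  have := sqr_ge0 W; move: (W ^+ 2) (e0 ^+ n * q * y) => w z w0; nra.
have q' : q / 2 * (y * q ^+ k) + q / 2 * (y * q ^+ k) = y * q ^+ k.+1.
  by rewrite exprS; field.
rewrite -q' mulrDr; apply: lerD; first by rewrite ler_pM2l.
apply: le_trans T4; rewrite ler_pM2l// ler_wpM2l//.
exact: ltW.
Qed.

End geometric_decay.

(** * One step of the iteration *)

Section iteration_step.
Context {R : realType} {n : nat}.
Local Notation Rm := (measurableTypeR R).
Local Notation nu := (lebesgue_row n \x @lebesgue_measure R)%E.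
Hypothesis n0 : (0 < n)%N.
Variables (c : 'rV[R]_n) (a m t1 e K : R).
Hypothesis a0 : 0 < a.
Hypothesis e0 : 0 < e.
Hypothesis am : a + e * n%:R <= m.
Hypothesis t10 : 0 < t1.
Variables (V Hu : 'rV[R]_n * R -> R) (g : 'I_n -> 'rV[R]_n * R -> R).
Hypothesis mV : measurable_fun [set: 'rV[R]_n * Rm] V.
Hypothesis V0 : forall z, 0 <= V z.
Hypothesis VK : forall z, `|V z| <= K.
Hypothesis mg : forall i, measurable_fun [set: 'rV[R]_n * Rm] (g i).
Hypothesis mHu : measurable_fun [set: 'rV[R]_n * Rm] Hu.
Hypothesis Hu0 : forall z, 0 <= Hu z.
Variables (p C beta E : R).
Hypothesis p1 : 1 <= p.
Hypothesis C0 : 0 <= C.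
Hypothesis VHu : forall z, V z `^ p <= C * Hu z.
Hypothesis ig : forall i s, 0 < s < t1 ->
  nu.-integrable [set: 'rV[R]_n * Rm] (EFin \o (fun z => g i z * \1_(cbox c m s t1) z)).
Hypothesis wV : forall i s, 0 < s < t1 ->
  weak_partial i V (fun z => g i z * \1_(cbox c m s t1) z) c m s t1.
Hypothesis gE : forall i s, 0 < s < t1 ->
  (\int[nu]_(z in box c m s t1) (g i z ^+ 2)%:E <= E%:E)%E.
Hypothesis HuE : {ae @lebesgue_measure R, forall tau, 0 < tau < t1 ->
  (\int[lebesgue_row n]_(x in eball c m) (Hu (x, tau))%:E <= E%:E)%E}.
Hypothesis ball_beta : (lebesgue_row n (eball c m) <= beta%:E)%E.

Let E0 : 0 <= E.
Proof.
have s01 : 0 < t1 / 2 < t1.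
  by rewrite divr_gt0//= ltr_pdivrMr// ltr_pMr// ltr1n.
rewrite -lee_fin; apply: le_trans (gE (Ordinal n0) s01).
by apply: integral_ge0 => z _; rewrite lee_fin sqr_ge0.
Qed.

Let beta0 : 0 <= beta.
Proof. by rewrite -lee_fin; apply: le_trans ball_beta; exact: measure_ge0. Qed.

Let cut s z := V z * \1_(box c m s t1) z.

Let mcut s : measurable_fun [set: 'rV[R]_n * Rm] (cut s).
Proof.
apply: measurable_funM => //; apply: measurable_indic.
exact: measurable_box.
Qed.

Let mass s (tau : R) : \bar R := (\int[lebesgue_row n]_x (cut s (x, tau))%:E)%E.

(** Young's inequality splits V into a part at most d, integrated over the ball, and a multiple of
    H(u), whose slice integral is bounded by the energy. *)
Let mass_le s d : 0 < s -> 0 < d -> {ae @lebesgue_measure R, forall tau,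
  (mass s tau <= (d * beta + d `^ (1 - p) * (C * E))%:E * (\1_(`]s, t1[%classic : set R) tau)%:E)%E}.
Proof.
move=> s0 d0; apply: ae_imply HuE => tau HE.
have [taus|taus] := pselect ((`]s, t1[%classic : set R) tau); last first.
  rewrite (indic_out _ taus) mule0 /mass integral0_eq// => x _.
  by rewrite /cut indic_out ?mulr0// => -[].
rewrite (indic_in _ taus) mule1 /mass.
have [stau taut] : s < tau /\ tau < t1 by move: taus; rewrite /= in_itv/= => /andP.
have {}HE := HE _; rewrite (lt_trans s0 stau) taut in HE.
have mHx : measurable_fun [set: 'rV[R]_n] (fun x => (Hu (x, tau))%:E).
  by apply/measurable_EFinP; apply: measurableT_comp mHu _; exact: measurable_pair2.
have mB := measurable_eball c m.
have q0 : 0 <= d `^ (1 - p) * C by rewrite mulr_ge0// powR_ge0.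
apply: (@le_trans _ _ (\int[lebesgue_row n]_(x in eball c m)
    (d%:E + (d `^ (1 - p) * C)%:E * (Hu (x, tau))%:E))%E).
  rewrite [leRHS]integral_mkcond; apply: ge0_le_integral => //.
  - by move=> x _; rewrite lee_fin mulr_ge0.
  - by apply/measurable_EFinP; apply: measurableT_comp (mcut s) _; exact: measurable_pair2.
  - apply/(measurable_restrictT _ _).1 => //; apply: measurable_funTS.
    by apply: emeasurable_funD => //; exact: measurable_funeM.
  move=> x _; rewrite patchE /cut; case: ifPn => [|xB].
    rewrite inE => Bx; rewrite indic_in ?mulr1; last by split => //=; rewrite in_itv/= stau.
    rewrite -EFinM -EFinD lee_fin; apply: le_trans (young_powR (V0 _) d0 p1) _.
    by rewrite lerD2l -mulrA ler_wpM2l ?powR_ge0.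
  rewrite indic_out ?mulr0// => -[/= Bx _].
  by move: xB; rewrite mem_set.
rewrite ge0_integralD//; last 3 first.
- by move=> x _; rewrite lee_fin ltW.
- by move=> x _; rewrite -EFinM lee_fin mulr_ge0.
- by apply: measurable_funTS; exact: measurable_funeM.
rewrite integral_cst// ge0_integralZl_EFin//; last 2 first.
- by move=> x _; rewrite lee_fin.
- exact: measurable_funTS.
rewrite EFinD (mulrA _ C) !EFinM; apply: leeD; apply: lee_wpmul2l => //.
- by rewrite lee_fin ltW.
- exact: HE.
Qed.

(** The translation estimate for all shifts in the cube feeds the averaging inequality, and the
    squared mass is integrated over a time interval of length at most t1. No constant depends on s,
    so the estimate reaches time 0. *)
Lemma iteration_step d : 0 < d ->
  ((e ^+ n)%:E * \int[nu]_(z in box c a 0 t1) (V z ^+ 2)%:E <=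
  (e ^+ n * (4 ^+ n * (e ^+ 2 * E)) +
   2 * (t1 * (d * beta + d `^ (1 - p) * (C * E)) ^+ 2))%:E)%E.
Proof.
move=> d0; set W := d * beta + _; set A := 4 ^+ n * _.
have W0 : 0 <= W.
  by rewrite addr_ge0 ?mulr_ge0 ?powR_ge0 ?(ltW d0).
have en0 : 0 < e ^+ n by rewrite exprn_gt0.
rewrite -lee_pdivlMl//; apply: integral_box_limit => //.
- by apply/measurable_EFinP; exact: measurable_funX.
- by move=> z; rewrite lee_fin sqr_ge0.
move=> s sT; have [s0 st] := andP sT; rewrite lee_pdivlMl//.
have hA w : cube e w ->
    (\int[nu]_(z in box c a s t1) ((V (shift_space w z) - V z) ^+ 2)%:E <= A%:E)%E.
  move=> Qw.
  have m1 : measurable_fun [set: 'rV[R]_n * Rm] (\1_(cbox c m s t1) : 'rV[R]_n * Rm -> R).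
    by apply: measurable_indic; exact: measurable_cbox.
  have gE' i : (\int[nu]_(z in box c m s t1)
      ((g i z * \1_(cbox c m s t1) z) ^+ 2)%:E <= E%:E)%E.
    apply: le_trans (gE i sT); rewrite le_eqVlt; apply/orP; left; apply/eqP.
    apply: eq_integral => z; rewrite inE => /box_cbox Bz.
    by rewrite (indic_in _ Bz) mulr1.
  have := @path_translate_L2 R n c m s t1 K st V (fun i z => g i z * \1_(cbox c m s t1) z)
    mV VK (fun i => measurable_funM (mg i) m1) (fun i => ig i sT) (fun i => wV i sT) E e gE' e0
    w (enum 'I_n) a n0 Qw a0.
  rewrite size_enum_ord => /(_ am); apply: le_trans.
  rewrite le_eqVlt; apply/orP; left; apply/eqP.
  by apply: eq_integral => z _; rewrite path_translate_enum.
apply: le_trans (average_L2 a0 e0 am mV V0 hA) _.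
rewrite [leRHS]EFinD; apply: leeD => //; rewrite [leRHS]EFinM; apply: lee_wpmul2l => //.
have mm : measurable_fun setT (mass s : Rm -> \bar R).
  apply: (@measurable_fun_fubini_tonelli_G _ _ 'rV[R]_n Rm R (lebesgue_row n) (EFin \o cut s)).
  - by apply/measurable_EFinP; exact: mcut.
  - by move=> z; rewrite lee_fin mulr_ge0.
have mass0 tau : (0 <= mass s tau)%E by apply: integral_ge0 => x _; rewrite lee_fin mulr_ge0.
apply: (@le_trans _ _ (\int[lebesgue_measure]_tau
    ((W ^+ 2)%:E * (\1_(`]s, t1[%classic : set R) tau)%:E))%E).
  apply: ae_ge0_le_integral => //.
  - by move=> tau _; apply: mule_ge0; exact: mass0.
  - exact: (emeasurable_funM mm mm).
  - by move=> tau _; rewrite -EFinM lee_fin mulr_ge0// sqr_ge0.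
  - by apply: measurable_funeM; apply/measurable_EFinP; exact: measurable_indic.
  apply: ae_imply (mass_le s0 d0) => tau mW _.
  apply: le_trans (lee_pmul (mass0 tau) (mass0 tau) mW mW) _.
  rewrite -/W; have [ts|ts] := pselect ((`]s, t1[%classic : set R) tau).
    by rewrite (indic_in _ ts) !mule1 -EFinM -expr2.
  by rewrite (indic_out _ ts) !mule0.
rewrite ge0_integralZl_EFin//; last 2 first.
- by apply/measurable_EFinP; exact: measurable_indic.
- by rewrite sqr_ge0.
rewrite integral_indic// setIT.
have muI : lebesgue_measure (`]s, t1[%classic : set R) = (t1 - s)%:E.
  by rewrite lebesgue_measure_itv/= lte_fin st -EFinB.
rewrite [X in (_ * X <= _)%E]muI -EFinM lee_fin mulrC.
by rewrite ler_wpM2r ?sqr_ge0// lerBlDr lerDl ltW.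
Qed.

End iteration_step.

(** * Energy estimates for the solution, and vanishing on the limit cylinder *)

Section energy.
Context {R : realType} {n : nat}.
Local Notation Rm := (measurableTypeR R).
Local Notation nu := (lebesgue_row n \x @lebesgue_measure R)%E.
Variables (h P : R -> R) (hP : nonlinearities h P) (M C1 : R).
Local Notation H := (H_of h).
Local Notation F := (F_of h P).
Local Notation G := (G_of h P).
Hypothesis M0 : 0 < M.
Hypothesis C10 : 0 < C1.
Hypothesis A1 : forall s, 0 < s <= M -> F s <= C1 * dG_of h P s * G s.
Variables (Omega : set 'rV[R]_n) (T : R).
Hypothesis T0 : 0 < T.
Hypothesis oOmega : open Omega.
Let D : set ('rV[R]_n * R) := Omega `*` `]0, T[.
Variables (u : 'rV[R]_n * R -> R) (Du DGu : 'rV[R]_n * R -> 'rV[R]_n).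
Variables (U : 'rV[R]_n * R -> R) (DU DV : 'I_n -> 'rV[R]_n * R -> R).
Hypothesis mU : measurable_fun [set: 'rV[R]_n * Rm] U.
Hypothesis UM : forall z, 0 <= U z <= M.
Hypothesis uU : {ae nu, forall z, D z -> u z = U z}.
Hypothesis mDU : forall i, measurable_fun [set: 'rV[R]_n * Rm] (DU i).
Hypothesis mDV : forall i, measurable_fun [set: 'rV[R]_n * Rm] (DV i).
Hypothesis DuU : forall i, {ae nu, forall z, D z -> Du z ord0 i = DU i z}.
Hypothesis DGV : forall i, {ae nu, forall z, D z -> DGu z ord0 i = DV i z}.
Hypothesis DU2 : forall i K, compact K -> K `<=` Omega `*` `]0, T] ->
  (\int[nu]_(z in K) (DU i z ^+ 2)%:E < +oo)%E.
Hypothesis DV2 : forall i K, compact K -> K `<=` Omega `*` `]0, T] ->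
  (\int[nu]_(z in K) (DV i z ^+ 2)%:E < +oo)%E.

(** Defined from the representative [U], it is Borel and bounded everywhere, not merely almost
    everywhere. *)
Definition potential z := G (U z).
Local Notation V := potential.

Hypothesis wU : forall i c r s t, 0 < r -> s < t -> cbox c r s t `<=` D ->
  weak_partial i U (fun z => DU i z * \1_(cbox c r s t) z) c r s t.
Hypothesis wV : forall i c r s t, 0 < r -> s < t -> cbox c r s t `<=` D ->
  weak_partial i V (fun z => DV i z * \1_(cbox c r s t) z) c r s t.
Hypothesis ineq : forall theta, Lip_c Omega theta -> (forall x, 0 <= theta x) ->
  forall s t, 0 < s -> s < t -> t <= T ->
  \int[lebesgue_row n]_(x in Omega) (theta x * H (u (x, t)))
  - \int[lebesgue_row n]_(x in Omega) (theta x * H (u (x, s)))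
  + \int[lebesgue_measure]_(tau in `[s, t])
      weak_diffusion h P Omega u Du DGu theta tau <= 0.

Variables (c : 'rV[R]_n) (r1 : R).
Hypothesis r10 : 0 < r1.
Hypothesis ball_sub : [set x | dist2 c x <= r1 ^+ 2] `<=` Omega.

Lemma measurable_potential : measurable_fun [set: 'rV[R]_n * Rm] V.
Proof.
apply: measurable_comp_nneg (measurable_G_of hP) mU _ => z.
by have /andP[] := UM z.
Qed.

Lemma potential_ge0 z : 0 <= V z.
Proof. by apply: (G_of_ge0 hP); have /andP[] := UM z. Qed.

Lemma potential_le z : `|V z| <= G M.
Proof.
rewrite ger0_norm ?potential_ge0//.
by have /andP[u0 uM] := UM z; exact: (G_of_le hP).
Qed.

Let cbox_D s t : 0 < s -> t < T -> cbox c r1 s t `<=` D.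
Proof.
move=> s0 tT [x a] [/= /ball_sub Ox]; rewrite in_itv/= => /andP[sa at_].
by split => //=; rewrite in_itv/= (lt_le_trans s0)// (le_lt_trans at_).
Qed.

Let D_DT : D `<=` Omega `*` `]0, T].
Proof.
move=> [x a] [/= Ox]; rewrite in_itv/= => /andP[a0 aT].
by split => //=; rewrite in_itv/= a0 ltW.
Qed.

Lemma DU_integrable i s t : 0 < s -> t < T ->
  nu.-integrable [set: 'rV[R]_n * Rm] (EFin \o (fun z => DU i z * \1_(cbox c r1 s t) z)) /\
  nu.-integrable [set: 'rV[R]_n * Rm] (EFin \o (fun z => DU i z ^+ 2 * \1_(cbox c r1 s t) z)).
Proof.
move=> s0 tT; apply: L2_integrable => //.
- exact: measurable_cbox.
- by apply: cbox_fin; exact: ltW.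
- apply: DU2; first exact: compact_cbox.
  exact: subset_trans (cbox_D s0 tT) D_DT.
Qed.

Lemma DV_integrable i s t : 0 < s -> t < T ->
  nu.-integrable [set: 'rV[R]_n * Rm] (EFin \o (fun z => DV i z * \1_(cbox c r1 s t) z)) /\
  nu.-integrable [set: 'rV[R]_n * Rm] (EFin \o (fun z => DV i z ^+ 2 * \1_(cbox c r1 s t) z)).
Proof.
move=> s0 tT; apply: L2_integrable => //.
- exact: measurable_cbox.
- by apply: cbox_fin; exact: ltW.
- apply: DV2; first exact: compact_cbox.
  exact: subset_trans (cbox_D s0 tT) D_DT.
Qed.

Hypothesis slices : forall t, 0 <= t <= T ->
  ae_measurable (lebesgue_row n) Omega (fun x => u (x, t)).
Hypothesis bounds : forall t, 0 <= t <= T ->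
  {ae lebesgue_row n, forall x, Omega x -> 0 <= u (x, t) <= M}.
Hypothesis ucvg : cvg_local_measure_at0 Omega u.
Hypothesis u00 : forall x, dist2 c x <= r1 ^+ 2 -> u (x, 0) = 0.

Section radius.
Variable rho : R.
Hypothesis rho0 : 0 < rho.
Hypothesis rho_r1 : rho < r1.

(** The gradients are truncated to the cylinder of radius r1, which makes them integrable; the
    strictly smaller radius rho leaves room for the difference quotients. *)
Lemma chain_box s t : 0 < s -> s < t -> t < T ->
  {ae nu, forall z, box c rho s t z -> forall i, F (U z) * `|DU i z| <= C1 * V z * `|DV i z|}.
Proof.
move=> s0 st tT.
suff : {ae nu, forall z, forall i, box c rho s t z -> F (U z) * `|DU i z| <= C1 * V z * `|DV i z|}.
  by apply: ae_imply => z H' Bz i; exact: H'.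
apply: ae_ord => i.
have m1 : measurable_fun [set: 'rV[R]_n * Rm] (\1_(cbox c r1 s t) : 'rV[R]_n * Rm -> R).
  by apply: measurable_indic; exact: measurable_cbox.
have := @chain_inequality R n i F G M C1 (G M) U V (fun z => DU i z * \1_(cbox c r1 s t) z)
  (fun z => DV i z * \1_(cbox c r1 s t) z) c rho r1 s t (ltW C10) (F_at0 hP)
  (F_of_continuous hP) (G_of_ge0 hP) (G_of_le hP) (F_of_increment hP C10 A1) UM (fun=> erefl)
  potential_le mU measurable_potential (measurable_funM (mDU i) m1) (measurable_funM (mDV i) m1)
  (DU_integrable i s0 tT).1 (DV_integrable i s0 tT).1 (wU i r10 st (cbox_D s0 tT))
  (wV i r10 st (cbox_D s0 tT)) rho0 rho_r1 st.
apply: ae_imply => z Cz Bz; have := Cz Bz.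
rewrite indicE mem_set ?mulr1//; apply: box_cbox; apply: box_le Bz.
exact: ltW.
Qed.

Definition dissipation z := cutoff c rho z.1 * \sum_i DV i z ^+ 2.

Lemma measurable_cutoff_fst : measurable_fun [set: 'rV[R]_n * Rm] (fun z => cutoff c rho z.1).
Proof. by apply: measurableT_comp measurable_fst; exact: measurable_cutoff. Qed.

Let density z := F (U z) * (\sum_i DU i z * grad (cutoff c rho) z.1 ord0 i) +
  (\sum_i DV i z ^+ 2) * cutoff c rho z.1.

Let box_rho s t : box c rho s t `<=` cbox c r1 s t.
Proof. by move=> z Bz; apply: box_cbox; apply: box_le Bz; exact: ltW. Qed.

Let F_le z : `|F (U z)| <= F M.
Proof.
have /andP[u0 uM] := UM z.
by rewrite ger0_norm ?(F_of_ge0 hP)//; exact: (F_of_ndecr hP).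
Qed.

Lemma dissipation_integrable s t : 0 < s -> t < T ->
  nu.-integrable [set: 'rV[R]_n * Rm] (EFin \o (fun z => dissipation z * \1_(box c rho s t) z)).
Proof.
move=> s0 tT.
rewrite (_ : (fun z => _) = fun z => \sum_i (cutoff c rho z.1 * \1_(box c rho s t) z) *
    (DV i z ^+ 2 * \1_(cbox c r1 s t) z)); last first.
  apply/funext => z; rewrite /dissipation -mulr_sumr -mulr_suml.
  have [Bz|Bz] := pselect (box c rho s t z); last first.
    by rewrite (indic_out _ Bz) !mulr0 mul0r.
  by rewrite (indic_in _ Bz) (indic_in _ (box_rho Bz)) !mulr1.
rewrite (_ : EFin \o _ = fun z => (\sum_i ((cutoff c rho z.1 * \1_(box c rho s t) z) *
    (DV i z ^+ 2 * \1_(cbox c r1 s t) z))%:E)%E); last first.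
  by apply/funext => z; rewrite /= sumEFin.
apply: integrable_sum => // i _.
apply: (@bounded_mul_integrable _ _ _ _ _ _ ((rho ^+ 2) ^+ 2)).
- apply: measurable_funM; first exact: measurable_cutoff_fst.
  by apply: measurable_indic; exact: measurable_box.
- move=> z; rewrite normrM ger0_norm ?cutoff_ge0// indicE.
  by case: (z \in _); rewrite ?normr1 ?normr0 ?mulr1 ?mulr0 ?cutoff_le ?sqr_ge0.
- exact: (DV_integrable i s0 tT).2.
Qed.

Lemma potential_sqr_integrable s t :
  nu.-integrable [set: 'rV[R]_n * Rm] (EFin \o (fun z => V z ^+ 2 * \1_(box c rho s t) z)).
Proof.
apply: (@bounded_support_integrable _ ('rV[R]_n * Rm)%type R nu (fun z => V z ^+ 2 * \1_(box c rho s t) z) (G M ^+ 2) (box c rho s t)).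
- apply: measurable_funM; first exact: (measurable_funX 2 measurable_potential).
  by apply: measurable_indic; exact: measurable_box.
- exact: measurable_box.
- exact: box_fin.
- move=> z; rewrite normrM normrX; have i0 : 0 <= \1_(box c rho s t) z :> R by [].
  rewrite (ger0_norm i0); apply: ler_wpM2r => //.
  by rewrite ler_pXn2r// ?nnegrE ?potential_le// (le_trans _ (potential_le z)).
Qed.

Let grad_le x i : eball c rho x -> `|grad (cutoff c rho) x ord0 i| <= 4 * rho ^+ 2 * rho.
Proof.
move=> /(eballE _ _ rho0) xr; rewrite grad_cutoff normrN.
have := dist2_coord c x i; have := dist2_ge0 c x; move: xr.
move: (dist2 c x) (x ord0 i - c ord0 i) => d y dr d0 yd.
have yr : `|y| <= rho.
  rewrite -(@ler_pXn2r _ 2)// ?nnegrE ?(ltW rho0)// real_normK ?num_real//.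
  exact: le_trans yd (ltW dr).
rewrite normrM max_l; last by rewrite subr_ge0 ltW.
apply: ler_pM => //; rewrite ger0_norm; last by rewrite mulr_ge0// subr_ge0 ltW.
by rewrite ler_pM2l// lerBlDr lerDl.
Qed.

Let density_integrable s t : 0 < s -> t < T ->
  nu.-integrable [set: 'rV[R]_n * Rm] (EFin \o (fun z => density z * \1_(box c rho s t) z)).
Proof.
move=> s0 tT.
have mF : measurable_fun [set: 'rV[R]_n * Rm] (fun z => F (U z)).
  apply: (measurable_comp_nneg _ mU) => [|z]; last by have /andP[] := UM z.
  apply: ndecr_measurable; first exact: interval_is_interval.
  by move=> a b /=; rewrite !in_itv/= !andbT => a0 _; exact: (F_of_ndecr hP).
rewrite (_ : (fun z => _) = fun z => (\sum_i (F (U z) * grad (cutoff c rho) z.1 ord0 i * \1_(box c rho s t) z) *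
    (DU i z * \1_(cbox c r1 s t) z)) + dissipation z * \1_(box c rho s t) z); last first.
  apply/funext => z; rewrite /density mulrDl (mulrC (\sum_i _ ^+ 2)); congr (_ + _).
  rewrite mulr_sumr mulr_suml; apply: eq_bigr => i _.
  have [Bz|Bz] := pselect (box c rho s t z); last first.
    by rewrite (indic_out _ Bz) !mulr0 mul0r.
  rewrite (indic_in _ Bz) (indic_in _ (box_rho Bz)) !mulr1.
  by rewrite -mulrA (mulrC (DU i z)).
pose f1 z := (\sum_i ((F (U z) * grad (cutoff c rho) z.1 ord0 i * \1_(box c rho s t) z) *
    (DU i z * \1_(cbox c r1 s t) z))%:E)%E.
pose f2 z := (dissipation z * \1_(box c rho s t) z)%:E.
rewrite (_ : EFin \o _ = (fun z => f1 z + f2 z)%E); last first.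
  by apply/funext => z; rewrite /f1 /f2 sumEFin.
apply: integrableD => //; last exact: dissipation_integrable.
apply: integrable_sum => // i _.
apply: (@bounded_mul_integrable _ _ _ _ _ _ (F M * (4 * rho ^+ 2 * rho))).
- apply: measurable_funM; last by apply: measurable_indic; exact: measurable_box.
  apply: measurable_funM => //.
  exact: (measurableT_comp (measurable_grad_cutoff c rho i) measurable_fst).
- move=> z; have [Bz|Bz] := pselect (box c rho s t z); last first.
    rewrite (indic_out _ Bz) mulr0 normr0 mulr_ge0 ?(F_of_ge0 hP) ?(ltW M0)//.
    by rewrite !mulr_ge0 ?sqr_ge0 ?(ltW rho0).
  rewrite (indic_in _ Bz) mulr1 normrM; apply: ler_pM => //.
  by apply: grad_le; case: Bz.
- exact: (DU_integrable i s0 tT).1.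
Qed.

(** For almost every time the slice integral may be computed with the representatives, and Fubini
    joins the slices. The two endpoint times, absent from the open cylinder, form a null set. *)
Lemma weak_diffusion_integral s t : 0 < s -> s < t -> t < T ->
  \int[lebesgue_measure]_(tau in `[s, t])
    weak_diffusion h P Omega u Du DGu (cutoff c rho) tau =
  \int[nu]_z (density z * \1_(box c rho s t) z).
Proof.
move=> s0 st tT; rewrite -(Rintegral_spacetime (density_integrable s0 tT)).
rewrite Rintegral_mkcond; apply: Rintegral_ae_congr.
have E := ae_and uU (ae_and (ae_ord DuU) (ae_ord DGV)).
apply: ae_imply (ae_and (ae_slice E) (ae_and (ae_neq_real s) (ae_neq_real t))).
move=> tau [Et [ts tt]] _; rewrite patchE.
have Bball x : eball c rho x -> Omega x.
  move=> /(eballE _ _ rho0) xr; apply: ball_sub => /=; apply: le_trans (ltW xr) _.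
  by rewrite ler_pXn2r// ?nnegrE ?ltW.
case: ifPn => [|/negP taust]; last first.
  rewrite /Rintegral integral0_eq// => x _; rewrite indic_out ?mulr0// => -[_ /=].
  rewrite in_itv/= => /andP[a b]; apply: taust; rewrite inE/= in_itv/=.
  by rewrite !ltW.
rewrite inE/= in_itv/= => /andP[stau taut].
have stau' : s < tau by rewrite lt_neqAle eq_sym ts.
have taut' : tau < t by rewrite lt_neqAle tt.
rewrite /weak_diffusion Rintegral_mkcond; apply: Rintegral_ae_congr.
apply: ae_imply Et => x [uUx [DuUx DGVx]] _; rewrite patchE; case: ifPn => [|Ox].
  rewrite inE => Ox; have Dx : D (x, tau).
    by split => //=; rewrite in_itv/= (lt_trans s0)//= (lt_trans taut').
  rewrite uUx// /density /=.
  have -> : dotv (Du (x, tau)) (grad (cutoff c rho) x) =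
      \sum_i DU i (x, tau) * grad (cutoff c rho) x ord0 i.
    by apply: eq_bigr => i _; rewrite DuUx.
  have -> : enorm (DGu (x, tau)) ^+ 2 = \sum_i DV i (x, tau) ^+ 2.
    rewrite /enorm sqr_sqrtr; last by apply: sumr_ge0 => i _; rewrite -expr2 sqr_ge0.
    by apply: eq_bigr => i _; rewrite DGVx// expr2.
  have [Bx|Bx] := pselect (eball c rho x).
    by rewrite indicE mem_set ?mulr1//; split => //=; rewrite in_itv/= stau'.
  rewrite cutoff_eq0// mulr0 addr0 big1 ?mulr0; last first.
    move=> i _; rewrite grad_cutoff max_r ?mulr0 ?mul0r ?oppr0 ?mulr0//.
    by rewrite subr_le0 leNgt; apply/negP => /(eballE _ _ rho0).
  by rewrite indicE memNset ?mulr0// => -[].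
rewrite indicE memNset ?mulr0// => -[/= /Bball Ox' _].
by move: Ox; rewrite mem_set.
Qed.

Lemma energy_step s t : 0 < s -> s < t -> t < T ->
  \int[lebesgue_row n]_(x in Omega) (cutoff c rho x * H (u (x, t))) +
  2^-1 * \int[nu]_z (dissipation z * \1_(box c rho s t) z) <=
  \int[lebesgue_row n]_(x in Omega) (cutoff c rho x * H (u (x, s))) +
  8 * C1 ^+ 2 * rho ^+ 2 * \int[nu]_z (V z ^+ 2 * \1_(box c rho s t) z).
Proof.
move=> s0 st tT.
have LO : Lip_c Omega (cutoff c rho).
  apply: Lip_c_cutoff => // x /= xr; apply: ball_sub; apply: le_trans xr _.
  by rewrite ler_pXn2r// ?nnegrE ?ltW.
have := ineq LO (cutoff_ge0 c rho) s0 st (ltW tT).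
rewrite weak_diffusion_integral//.
have id := dissipation_integrable s0 tT; have iV := potential_sqr_integrable s t.
pose low z := 2^-1 * (dissipation z * \1_(box c rho s t) z) -
  8 * C1 ^+ 2 * rho ^+ 2 * (V z ^+ 2 * \1_(box c rho s t) z).
have ilow1 : nu.-integrable [set: 'rV[R]_n * Rm]
    (EFin \o (fun z => 2^-1 * (dissipation z * \1_(box c rho s t) z))).
  exact: (integrableZl measurableT 2^-1 id).
have ilow2 : nu.-integrable [set: 'rV[R]_n * Rm]
    (EFin \o (fun z => 8 * C1 ^+ 2 * rho ^+ 2 * (V z ^+ 2 * \1_(box c rho s t) z))).
  exact: (integrableZl measurableT (8 * C1 ^+ 2 * rho ^+ 2) iV).
have : \int[nu]_z low z <= \int[nu]_z (density z * \1_(box c rho s t) z).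
  rewrite -subr_ge0 -RintegralB//; last 2 first.
  - exact: density_integrable.
  - exact: (integrableB measurableT ilow1 ilow2).
  (* The integrand is known to be nonnegative only almost everywhere, so it is replaced by its
     absolute value. *)
  suff -> : \int[nu]_z (density z * \1_(box c rho s t) z - low z) =
      \int[nu]_z `|density z * \1_(box c rho s t) z - low z| by exact: Rintegral_ge0.
  apply: Rintegral_ae_congr.
  apply: ae_imply (chain_box s0 st tT) => z Cz _; rewrite ger0_norm//.
  rewrite /low; have [Bz|Bz] := pselect (box c rho s t z); last first.
    by rewrite (indic_out _ Bz) !mulr0 !subr0.
  rewrite (indic_in _ Bz) !mulr1 subr_ge0.
  apply: diffusion_ge => //; [exact: potential_ge0|exact: ltW|by case: Bz| |exact: Cz].
  by apply: (F_of_ge0 hP); have /andP[] := UM z.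
rewrite RintegralB// !RintegralZl// => low_le ineq_st.
exact: energy_transport ineq_st low_le.
Qed.

(** The initial term is removed: the inequality is started at some s' < s where it is below an
    arbitrary e, and enlarging the time intervals makes the remaining bound independent of s'. *)
Lemma energy T1 s t : 0 < s -> s < t -> t <= T1 -> T1 < T ->
  \int[lebesgue_row n]_(x in Omega) (cutoff c rho x * H (u (x, t))) +
  2^-1 * \int[nu]_z (dissipation z * \1_(box c rho s t) z) <=
  8 * C1 ^+ 2 * rho ^+ 2 * \int[nu]_z (V z ^+ 2 * \1_(box c rho 0 T1) z).
Proof.
move=> s0 st tT1 T1T; have tT : t < T := le_lt_trans tT1 T1T.
apply/ler_addgt0Pr => e e0.
have Kr : [set x | dist2 c x <= rho ^+ 2] `<=` [set x | dist2 c x <= r1 ^+ 2].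
  by move=> x /= xr; apply: le_trans xr _; rewrite ler_pXn2r// ?nnegrE ?ltW.
have [s' /andP[s'0 s's] s'e] := initial_decay hP M0 T0 slices bounds ucvg rho0 e0 s0
  (subset_trans Kr ball_sub) (fun x xr => u00 (Kr x xr)).
have box_mono a b a' b' : a' <= a -> b <= b' -> forall z (f : 'rV[R]_n * R -> R), 0 <= f z ->
    f z * \1_(box c rho a b) z <= f z * \1_(box c rho a' b') z.
  move=> aa bb z f f0; apply: ler_wpM2l => //; rewrite !indicE.
  have [Bz|Bz] := pselect (box c rho a b z); last by rewrite (memNset Bz).
  rewrite mem_set// mem_set//; case: Bz => ? /=; rewrite in_itv/= => /andP[? ?].
  by split => //=; rewrite in_itv/= (le_lt_trans aa)// (lt_le_trans _ bb).
have L1 : \int[nu]_z (dissipation z * \1_(box c rho s t) z) <=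
    \int[nu]_z (dissipation z * \1_(box c rho s' t) z).
  apply: le_Rintegral => //; [exact: dissipation_integrable..|].
  move=> z _; apply: box_mono => //; first exact: ltW.
  by rewrite mulr_ge0 ?cutoff_ge0// sumr_ge0// => i _; exact: sqr_ge0.
have L2 : \int[nu]_z (V z ^+ 2 * \1_(box c rho s' t) z) <=
    \int[nu]_z (V z ^+ 2 * \1_(box c rho 0 T1) z).
  apply: le_Rintegral => //; [exact: potential_sqr_integrable..|].
  by move=> z _; apply: (box_mono _ _ _ _ _ _ _ (fun z => V z ^+ 2)); rewrite ?sqr_ge0// ltW.
have L3 : 0 <= 8 * C1 ^+ 2 * rho ^+ 2.
  by apply: mulr_ge0; [apply: mulr_ge0|]; rewrite ?sqr_ge0.
exact: energy_relax L3 L1 L2 s'e (energy_step s'0 (lt_trans s's st) tT).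
Qed.

End radius.

Let Y T1 rho := \int[nu]_z (V z ^+ 2 * \1_(box c rho 0 T1) z).

Let Y_ge0 T1 rho : 0 <= Y T1 rho.
Proof. by apply: Rintegral_ge0 => z _; rewrite mulr_ge0// sqr_ge0. Qed.

Let gap_gt0 (rho rho' : R) : 0 < rho' -> rho' < rho -> 0 < (rho ^+ 2 - rho' ^+ 2) ^+ 2.
Proof. by move=> r0 rr; rewrite exprn_gt0// subr_gt0 ltrXn2r// ?nnegrE ltW// (lt_trans r0). Qed.

(** The nonnegative mass term at the final time is dropped, and on the smaller ball the cutoff is
    bounded below by the squared gap of the squared radii. *)
Lemma gradient_le T1 rho rho' i s : 0 < rho' -> rho' < rho -> rho < r1 -> 0 < s < T1 -> T1 < T ->
  (\int[nu]_(z in box c rho' s T1) (DV i z ^+ 2)%:E <=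
   ((rho ^+ 2 - rho' ^+ 2) ^- 2 * (16 * C1 ^+ 2 * rho ^+ 2 * Y T1 rho))%:E)%E.
Proof.
move=> r'0 rr rr1 /andP[s0 sT1] T1T; have r0 := lt_trans r'0 rr.
have k0 := gap_gt0 r'0 rr; set k := (rho ^+ 2 - rho' ^+ 2) in k0 *.
have idiss := dissipation_integrable rr1 s0 T1T.
have mdiss : measurable_fun [set: 'rV[R]_n * Rm]
    (EFin \o (fun z => dissipation rho z * \1_(box c rho s T1) z)) by exact: measurable_int idiss.
have diss0 z : 0 <= dissipation rho z * \1_(box c rho s T1) z.
  rewrite mulr_ge0// mulr_ge0 ?cutoff_ge0// sumr_ge0// => j _; exact: sqr_ge0.
have := energy r0 rr1 s0 sT1 (lexx T1) T1T.
set a := \int[lebesgue_row n]_(x in Omega) _ => en.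
have a0 : 0 <= a.
  by apply: Rintegral_ge0 => x _; rewrite mulr_ge0 ?cutoff_ge0// (H_of_ge0 hP).
have {en a0} I_le : \int[nu]_z (dissipation rho z * \1_(box c rho s T1) z) <=
    16 * C1 ^+ 2 * rho ^+ 2 * Y T1 rho := energy_double a0 en.
apply: (@le_trans _ _ ((k ^- 2)%:E * \int[nu]_z (dissipation rho z * \1_(box c rho s T1) z)%:E)%E); last first.
  rewrite -EFin_Rintegral// -EFinM lee_fin ler_wpM2l//.
  by rewrite invr_ge0 ltW.
rewrite -ge0_integralZl_EFin//; last 2 first.
- by move=> z _; rewrite lee_fin.
- by rewrite invr_ge0 ltW.
rewrite [leLHS]integral_mkcond; apply: ge0_le_integral => //.
- by move=> z _; rewrite patchE; case: ifPn => // _; rewrite lee_fin sqr_ge0.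
- apply/(measurable_restrictT _ _).1; first exact: measurable_box.
  by apply: measurable_funTS; apply/measurable_EFinP; exact: measurable_funX.
- exact: measurable_funeM.
move=> z _; rewrite patchE; case: ifPn => [|_]; last first.
  by rewrite -EFinM lee_fin mulr_ge0// invr_ge0 ltW.
rewrite inE => Bz; rewrite -EFinM lee_fin.
rewrite (indic_in _ (box_le (ltW rr) Bz)) mulr1 -(ler_pM2l k0) mulVKf ?gt_eqF//.
apply: ler_pM; [exact: ltW|exact: sqr_ge0|by apply: cutoff_ge => //; case: Bz|].
by rewrite (bigD1 i)//= lerDl sumr_ge0// => j _; exact: sqr_ge0.
Qed.

(** Here the dissipation is dropped instead. The inequality holds at each time for u, but u agrees
    with [U] on the slice only for almost every time. *)
Lemma slice_energy_le T1 rho rho' : 0 < rho' -> rho' < rho -> rho < r1 -> T1 < T ->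
  {ae @lebesgue_measure R, forall tau, 0 < tau < T1 ->
  (\int[lebesgue_row n]_(x in eball c rho') (H (U (x, tau)))%:E <=
   ((rho ^+ 2 - rho' ^+ 2) ^- 2 * (16 * C1 ^+ 2 * rho ^+ 2 * Y T1 rho))%:E)%E}.
Proof.
move=> r'0 rr rr1 T1T; have r0 := lt_trans r'0 rr.
have k0 := gap_gt0 r'0 rr; set k := (rho ^+ 2 - rho' ^+ 2) in k0 *.
apply: ae_imply (ae_slice uU) => tau utau /andP[tau0 tauT1].
have tauT : tau < T := lt_trans tauT1 T1T.
have U0 z : 0 <= U z by have /andP[] := UM z.
have H0 := H_of_ge0 hP.
have mH : measurable_fun [set: 'rV[R]_n] (fun x => H (U (x, tau))).
  apply: measurable_comp_nneg (measurable_H_of hP) _ _ => //.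
  by apply: measurableT_comp mU _; exact: measurable_pair2.
have mtH : measurable_fun [set: 'rV[R]_n] (fun x => cutoff c rho x * H (U (x, tau))).
  by apply: measurable_funM => //; exact: measurable_cutoff.
have itH : (lebesgue_row n).-integrable setT (EFin \o (fun x => cutoff c rho x * H (U (x, tau)))).
  apply: (@bounded_support_integrable _ _ _ _ _ ((rho ^+ 2) ^+ 2 * H M) (eball c rho)) => //.
  - exact: measurable_eball.
  - exact: eball_fin.
  move=> x; have [Bx|Bx] := pselect (eball c rho x); last first.
    by rewrite cutoff_eq0// mul0r normr0 indic_out// mulr0.
  rewrite (indic_in _ Bx) mulr1 (ger0_norm (mulr_ge0 (cutoff_ge0 _ _ _) (H0 _))).
  apply: ler_pM; [exact: cutoff_ge0|exact: H0|exact: cutoff_le|].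
  by apply: (H_of_le hP) => //; have /andP[] := UM (x, tau).
have t20 : 0 < tau / 2 by rewrite divr_gt0.
have t2 : tau / 2 < tau by rewrite ltr_pdivrMr// ltr_pMr// ltr1n.
have := energy r0 rr1 t20 t2 (ltW tauT1) T1T.
have -> : \int[lebesgue_row n]_(x in Omega) (cutoff c rho x * H (u (x, tau))) =
    \int[lebesgue_row n]_x (cutoff c rho x * H (U (x, tau))).
  rewrite Rintegral_mkcond; apply: Rintegral_ae_congr.
  apply: ae_imply utau => y uy _; rewrite patchE; case: ifPn => [|Ox].
    by rewrite inE => Ox; rewrite uy//; split => //=; rewrite in_itv/= tau0.
  rewrite cutoff_eq0 ?mul0r// => /(eballE _ _ r0) xr; case/negP: Ox; rewrite inE.
  by apply: ball_sub => /=; apply: le_trans (ltW xr) _; rewrite ler_pXn2r// ?nnegrE ?ltW.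
set b := \int[nu]_z _ => en.
have b0 : 0 <= b.
  apply: Rintegral_ge0 => z _; rewrite mulr_ge0// mulr_ge0 ?cutoff_ge0// sumr_ge0// => j _.
  exact: sqr_ge0.
have I_le := energy_half b0 (Y_ge0 T1 rho) (mulr_ge0 (sqr_ge0 C1) (sqr_ge0 rho)) en.
apply: (@le_trans _ _ ((k ^- 2)%:E * \int[lebesgue_row n]_x (cutoff c rho x * H (U (x, tau)))%:E)%E); last first.
  rewrite -EFin_Rintegral// -EFinM lee_fin ler_wpM2l//.
  by rewrite invr_ge0 ltW.
rewrite -ge0_integralZl_EFin//; last 3 first.
- by move=> x _; rewrite lee_fin mulr_ge0 ?cutoff_ge0.
- exact/measurable_EFinP.
- by rewrite invr_ge0 ltW.
rewrite [leLHS]integral_mkcond; apply: ge0_le_integral => //.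
- by move=> x _; rewrite patchE; case: ifPn => // _; rewrite lee_fin.
- apply/(measurable_restrictT _ _).1; first exact: measurable_eball.
  by apply: measurable_funTS; exact/measurable_EFinP.
- by apply: measurable_funeM; exact/measurable_EFinP.
move=> x _; rewrite patchE; case: ifPn => [|_]; last first.
  rewrite -EFinM lee_fin; apply: mulr_ge0; first by rewrite invr_ge0 ltW.
  exact: mulr_ge0 (cutoff_ge0 _ _ _) (H0 _).
rewrite inE => Bx; rewrite -EFinM lee_fin -(ler_pM2l k0) mulVKf ?gt_eqF//.
by apply: ler_wpM2r => //; exact: cutoff_ge.
Qed.

Lemma vanishing r' : (0 < n)%N -> 0 < r' < r1 ->
  (exists C3 p, [/\ 0 < C3, 1 <= p < 2 & forall s, 0 <= s <= M -> G s `^ p <= C3 * H s]) ->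
  exists2 t1, 0 < t1 < T & {ae nu, forall z, box c r' 0 t1 z -> U z = 0}.
Proof.
move=> n0 /andP[r'0 r'r1] [C3 [p [C30 p12 GH]]].
(* Half of the available gap, so that even the first radius r' + g stays strictly below r1. *)
pose g := (r1 - r') / 2; have g0 : 0 < g by rewrite divr_gt0// subr_gt0.
(* Each level uses two shrinkings: the energy estimate leads from [rk k] to [mk k], the averaging
   over translations from [mk k] to [rk k.+1]. *)
pose rk (k : nat) := r' + g / 2 ^+ k; pose mk (k : nat) := r' + 3 / 4 * (g / 2 ^+ k).
have k2 k : 0 < 2 ^+ k :> R by rewrite exprn_gt0.
have gk k : 0 < g / 2 ^+ k by rewrite divr_gt0.
have rk_r1 k : rk k < r1 := level_lt r'r1 (exprn_ege1 k (ler1n R 2)).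
have mk_rk k : mk k < rk k by rewrite ltrD2l gtr_pMl// ltr_pdivrMr// mul1r ltr_nat.
have mk0 k : 0 < mk k by rewrite addr_gt0// mulr_gt0.
have rk0 k : 0 < rk k := lt_trans (mk0 k) (mk_rk k).
pose L := 256 * C1 ^+ 2 * r1 ^+ 2 / (g ^+ 2 * r' ^+ 2).
have L0 : 0 < L.
  apply: divr_gt0; last by apply: mulr_gt0; exact: exprn_gt0.
  apply: mulr_gt0; last exact: exprn_gt0.
  by apply: mulr_gt0; [rewrite ltr0n|exact: exprn_gt0].
have Bfin : lebesgue_row n (eball c r1) \is a fin_num by rewrite ge0_fin_numE// eball_fin.
pose beta := fine (lebesgue_row n (eball c r1)).
have beta0 : 0 <= beta by exact: fine_ge0.
have mu_beta rho : rho <= r1 -> (lebesgue_row n (eball c rho) <= beta%:E)%E.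
  move=> rr; rewrite /beta fineK//; apply: le_measure; rewrite ?inE; [exact: measurable_eball..|].
  exact: eball_le.
(* A bound for Y at level 0 known before the final time is chosen: v <= G(M) on a cylinder of volume
   at most beta T; the 1 makes it positive. *)
pose y := G M ^+ 2 * (beta * T) + 1.
have y0 : 0 < y.
  by apply: ltr_wpDl => //; apply: mulr_ge0; [exact: sqr_ge0|apply: mulr_ge0 => //; exact: ltW].
have nR : 0 < n%:R :> R by rewrite ltr0n.
have e10 : 0 < g / (4 * n%:R) by rewrite divr_gt0// mulr_gt0.
have [e0 [q [t0 [/andP[e00 e01] /andP[q0 q1] t00 decay]]]] :=
  geometric_decay n p12 (ltW C30) beta0 L0 y0 e10.
(* Half of T keeps the closed cylinders away from the final time T, as the energy estimates
   require. *)
pose t1 := Num.min t0 (T / 2).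
have t10 : 0 < t1 by rewrite lt_min t00 divr_gt0.
have t1T : t1 < T.
  by rewrite gt_min ltr_pdivrMr// ltr_pMr// ltr1n orbT.
exists t1; first by rewrite t10.
have V0 := potential_ge0; have mV := measurable_potential.
have EY k : (\int[nu]_(z in box c (rk k) 0 t1) (V z ^+ 2)%:E)%E = (Y t1 (rk k))%:E.
  rewrite EFin_Rintegral//; last exact: potential_sqr_integrable.
  rewrite [LHS]integral_mkcond; apply: eq_integral => z _; rewrite patchE.
  case: ifPn => [|Bz]; first by rewrite inE => Bz; rewrite (indic_in _ Bz) mulr1.
  by rewrite indic_out ?mulr0// => Bz'; case/negP: Bz; rewrite inE.
have Y0 : Y t1 (rk 0%N) <= y.
  rewrite -lee_fin -EY.
  apply: (@le_trans _ _ (\int[nu]_(z in box c (rk 0%N) 0 t1) (G M ^+ 2)%:E)%E).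
    apply: ge0_le_integral => //.
    - exact: measurable_box.
    - by move=> z _; rewrite lee_fin sqr_ge0.
    - by apply: measurable_funTS; apply/measurable_EFinP; exact: measurable_funX.
    - move=> z _; rewrite lee_fin -[V z ^+ 2]real_normK ?num_real//.
      by rewrite ler_pXn2r// ?nnegrE// ?potential_le// (le_trans _ (potential_le z)).
  rewrite integral_cst; last exact: measurable_box.
  have bT : (nu (box c (rk 0%N) 0 t1) <= (beta * T)%:E)%E.
    rewrite /box product_measure1E//; last exact: measurable_eball.
    rewrite EFinM; apply: lee_pmul => //; first exact/mu_beta/ltW.
    have muI : lebesgue_measure (`]0, t1[%classic : set R) = t1%:E.
      by rewrite lebesgue_measure_itv/= lte_fin t10 -EFinB subr0.
    by rewrite [leLHS]muI lee_fin ltW.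
  apply: (@le_trans _ _ ((G M ^+ 2)%:E * (beta * T)%:E)%E).
    by apply: lee_wpmul2l => //; rewrite lee_fin sqr_ge0.
  by rewrite -EFinM lee_fin lerDl.
have mHU : measurable_fun [set: 'rV[R]_n * Rm] (fun z => H (U z)).
  by apply: measurable_comp_nneg (measurable_H_of hP) mU _ => z; have /andP[] := UM z.
have Yk := decay t1 (fun k => Y t1 (rk k)) _ (fun k => Y_ge0 t1 (rk k)) Y0.
have {}Yk k : Y t1 (rk k) <= y * q ^+ k.
  apply: Yk; first by rewrite t10 ge_min lexx.
  move=> {}k d d0; pose ek := e0 / 2 ^+ k.
  have ek0 : 0 < ek by rewrite divr_gt0.
  have lvl := level_bound C1 (ltW (rk_r1 k)) r'0 g0 (k2 k) (Y_ge0 t1 (rk k)).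
  have p4 : (2 ^+ k) ^+ 2 = 4 ^+ k :> R by rewrite exprAC -natrX.
  rewrite p4 -/L -/(rk k) -/(mk k) in lvl.
  have sub s : 0 < s < t1 -> cbox c (mk k) s t1 `<=` D.
    move=> /andP[s0 _]; apply: subset_trans (cbox_D s0 t1T) => -[x a] [/= xm xa]; split => //=.
    by apply: le_trans xm _; rewrite ler_pXn2r// ?nnegrE ?ltW// (lt_trans (mk_rk k)).
  have step := @iteration_step R n n0 c (rk k.+1) (mk k) t1 ek (G M) (rk0 k.+1) ek0
    (level_gap r' k nR e01) t10 V (fun z => H (U z)) DV mV V0 potential_le mDV mHU
    (fun z => H_of_ge0 hP (U z)) p C3 beta (L * 4 ^+ k * Y t1 (rk k)) (proj1 (andP p12)) (ltW C30).
  rewrite -lee_fin EFinM -EY; apply: step => //.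
  - by move=> z; exact: GH.
  - move=> i s sT; have [s0 _] := andP sT; apply: (L2_integrable _ _ _ _).1 => //.
    + exact: measurable_cbox.
    + by apply: cbox_fin; exact: ltW.
    + apply: DV2; first exact: compact_cbox.
      exact: subset_trans (sub s sT) D_DT.
  - by move=> i s sT; apply: wV => //; [have /andP[] := sT|exact: sub].
  - move=> i s sT; apply: le_trans (gradient_le i (mk0 k) (mk_rk k) (rk_r1 k) sT t1T) _.
    by rewrite lee_fin.
  - apply: ae_imply (slice_energy_le (mk0 k) (mk_rk k) (rk_r1 k) t1T) => tau le_tau taut.
    by apply: le_trans (le_tau taut) _; rewrite lee_fin.
  - by apply: mu_beta; apply: ltW; exact: lt_trans (mk_rk k) (rk_r1 k).
have mB : measurable (box c r' 0 t1 : set ('rV[R]_n * Rm)) by exact: measurable_box.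
have V20 : (\int[nu]_(z in box c r' 0 t1) (V z ^+ 2)%:E = 0)%E.
  apply/eqP; rewrite eq_le integral_ge0 ?andbT; last by move=> z _; rewrite lee_fin sqr_ge0.
  have le_k k : (\int[nu]_(z in box c r' 0 t1) (V z ^+ 2)%:E <= (y * q ^+ k)%:E)%E.
    apply: (@le_trans _ _ (Y t1 (rk k))%:E); last by rewrite lee_fin.
    rewrite -EY; apply: ge0_subset_integral => //.
    - exact: measurable_box.
    - by apply: measurable_funTS; apply/measurable_EFinP; exact: measurable_funX.
    - by move=> z _; rewrite lee_fin sqr_ge0.
    - by apply: box_le; rewrite lerDl ltW.
  apply: lee_geometric0 q0 q1 le_k.
have mV2 : measurable_fun (box c r' 0 t1 : set ('rV[R]_n * Rm)) (fun z => (V z ^+ 2)%:E).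
  by apply: measurable_funTS; apply/measurable_EFinP; exact: measurable_funX.
have /(ae_eq_integral_abs nu mB mV2) : (\int[nu]_(z in box c r' 0 t1) `|(V z ^+ 2)%:E| = 0)%E.
  by rewrite -[RHS]V20; apply: eq_integral => z _; rewrite gee0_abs// lee_fin sqr_ge0.
apply: ae_imply => z Vz Bz; have /eqP := Vz Bz.
rewrite eqe expf_eq0/= => /eqP Vz0.
have /andP[] := UM z; rewrite le_eqVlt => /predU1P[<-//|Uz0] UzM.
have := G_of_gt0 hP A1 (_ : 0 < U z <= M); rewrite Uz0 UzM => /(_ isT).
by rewrite -/(V z) Vz0 ltxx.
Qed.

End energy.

(** * From the Borel representatives back to the solution *)

Theorem theorem1 (R : realType) (N : nat) (N_gt0 : (0 < N)%N)
  (Omega : set 'rV[R]_N) (Omega_domain : domain Omega)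
  (Omega_bounded : bounded_set Omega)
  (Omega_lipschitz : lipschitz_boundary Omega)
  (T M : R) (T_gt0 : 0 < T) (M_gt0 : 0 < M)
  (P h : R -> R) (hP : nonlinearities h P)
  (A1 : exists2 C1 : R, 0 < C1 & forall s, 0 < s <= M ->
    F_of h P s <= C1 * dG_of h P s * G_of h P s)
  (A2 : exists C2 lambda : R, [/\ 0 < C2, 0 < lambda < 2 &
    forall s, 0 <= s <= M ->
      Num.sqrt (s * F_of h P s) `^ lambda <= C2 * H_of h s])
  (u : 'rV[R]_N * R -> R)
  (u_bounds : forall t, 0 <= t <= T ->
    {ae lebesgue_row N, forall x, Omega x -> 0 <= u (x, t) <= M})
  (u_solution : subsolution h P Omega T u)
  (u_boundary : zero_lateral_boundary Omega T u)
  (u0_ge0 : forall x, Omega x -> 0 <= u (x, 0))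
  (u0_continuous : {within Omega, continuous (fun x => u (x, 0))})
  (Omega' : set 'rV[R]_N) (Omega'_sub : Omega' `<=` Omega)
  (u0_zero : forall x, Omega' x -> u (x, 0) = 0) :
  forall (x0 : 'rV[R]_N) (r r' : R), compactly_inside (eball x0 r) Omega' ->
  0 < r' < r ->
  exists2 T' : R, 0 < T' <= T &
    {ae lebesgue_spacetime N, forall z,
      (eball x0 r' `*` `[0, T']) z -> u z = 0}.
Proof.
move=> x0 r r' [_ ball_sub] /andP[r'0 r'r].
have [_ oOmega _] := Omega_domain.
have [C1 C10 {}A1] := A1; have [C2 [lam [C20 lam02 {}A2]]] := A2.
have [[Linf _] slices _ ucvg [Du [DGu [DuL wDu DGuL wDGu ineq]]]] := u_solution.
(* The closed ball of this radius lies in the ball of radius r, hence in [Omega'], and the iteration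
   has room to shrink down to r'. *)
pose r1 := (r' + r) / 2.
have r'r1 : r' < r1 by rewrite /r1 ltr_pdivlMr//; lra.
have r1r : r1 < r by rewrite /r1 ltr_pdivrMr//; lra.
have r10 : 0 < r1 := lt_trans r'0 r'r1.
have r_gt0 : 0 < r := lt_trans r10 r1r.
have cball_sub x : dist2 x0 x <= r1 ^+ 2 -> Omega' x.
  move=> xr1; apply: ball_sub; apply: subset_closure; apply/eballE => //.
  by apply: le_lt_trans xr1 _; rewrite !expr2; nra.
have cballO : [set x | dist2 x0 x <= r1 ^+ 2] `<=` Omega.
  by move=> x /cball_sub/Omega'_sub.
have [U mU [UM uU]] := bounded_representative oOmega (ltW M_gt0) Linf u_bounds.
have /choice[DU DUP] := fun i => L2_representative (DuL i).
have /choice[DV DVP] := fun i => L2_representative (DGuL i).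
have GuU : {ae lebesgue_spacetime N, forall z, (Omega `*` `]0, T[) z ->
    (G_of h P \o u) z = potential h P U z}.
  by apply: ae_imply uU => z uUz Dz; rewrite /potential /= uUz.
have wU i c a s t : 0 < a -> s < t -> cbox c a s t `<=` Omega `*` `]0, T[ ->
    weak_partial i U (fun z => DU i z * \1_(cbox c a s t) z) c a s t.
  by move=> a0 st KD; have [_ e _] := DUP i; exact: (weak_partial_of a0 st KD (wDu i) uU e).
have wV i c a s t : 0 < a -> s < t -> cbox c a s t `<=` Omega `*` `]0, T[ ->
    weak_partial i (potential h P U) (fun z => DV i z * \1_(cbox c a s t) z) c a s t.
  by move=> a0 st KD; have [_ e _] := DVP i; exact: (weak_partial_of a0 st KD (wDGu i) GuU e).
have [t1 /andP[t10 t1T] Uz] := @vanishing R N h P hP M C1 M_gt0 C10 A1 Omega T T_gt0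
  u Du DGu U DU DV mU UM uU (fun i => let: And3 m _ _ := DUP i in m)
  (fun i => let: And3 m _ _ := DVP i in m) (fun i => let: And3 _ e _ := DUP i in e)
  (fun i => let: And3 _ e _ := DVP i in e) (fun i => let: And3 _ _ l := DUP i in l)
  (fun i => let: And3 _ _ l := DVP i in l) wU wV ineq x0 r1 r10 cballO
  (fun t tT => (slices t tT).1) u_bounds ucvg (fun x xr => u0_zero x (cball_sub x xr))
  r' N_gt0 (introT andP (conj r'0 r'r1)) (G_of_powR_ge1 hP M_gt0 C20 lam02 A2).
(* The iteration yields the open interval ]0, t1[, while the closed interval claimed has to end
   strictly before t1. *)
exists (t1 / 2); first by rewrite divr_gt0//= ltW// ltr_pdivrMr//; lra.
apply: ae_imply (ae_and uU Uz) => -[x t] [uUz Uz0] [/= xr]; rewrite in_itv/= => /andP[t0 tt].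
have xr1 : dist2 x0 x <= r1 ^+ 2 by apply/ltW/eballE => //; exact: eball_le (ltW r'r1) _ xr.
have tt1 : t < t1 by apply: le_lt_trans tt _; rewrite ltr_pdivrMr//; lra.
(* Time 0 lies outside the open cylinder where u and [U] are compared; there the initial datum is
   used directly. *)
move: t0 uUz Uz0; rewrite le_eqVlt => /predU1P[<- _ _|t0 uUz Uz0].
  exact/u0_zero/cball_sub.
rewrite uUz; last by split; [exact: cballO|rewrite /= in_itv/= t0 (lt_trans tt1)].
by apply: Uz0; split => //=; rewrite in_itv/= t0.
Qed.
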